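(* Let $\Lambda$ be a gentle order, and let $\mathcal D_\Lambda = D^-(\mathsf{mod}\,\Lambda)$. Let $\mathcal X_1,\dots,\mathcal X_b$ be the distinct $\kappa$-orbits in the set $Q_0^t$ of transition vertices, and for $1\le a\le b$ let $\mathbb T_a = I(\mathcal X_a)\otimes^{\mathbf L}_\Lambda - \colon \mathcal D_\Lambda \to \mathcal D_\Lambda$. Let $\xi^* = {}_\xi\Lambda\otimes^{\mathbf L}_\Lambda -\colon \mathcal D_\Lambda\to\mathcal D_\Lambda$. Then $\xi^*, \mathbb T_1,\dots,\mathbb T_b$ are auto-equivalences of $\mathcal D_\Lambda$, any two of them commute with each other (up to isomorphism of functors), and the derived Nakayama functor $\nu=\omega\otimes^{\mathbf L}_\Lambda-$ admits a factorization $$\nu \;\cong\; \xi^*\circ \mathbb T_b\circ\cdots\circ\mathbb T_2\circ\mathbb T_1\colon \mathcal D_\Lambda \xrightarrow{\ \sim\ }\mathcal D_\Lambda .$$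
   Context: Let $k$ be a field and $R=k[[x]]$. Modules are left modules. Quivers $Q=(Q_0,Q_1,s,t)$ are finite, paths are composed from right to left. $(Q,I)$ is a quiver with relations, $I$ generated by combinations of paths of length at least two. A vertex $i$ is a transition vertex if exactly one arrow $\alpha$ ends at $i$, exactly one arrow $\beta$ starts at $i$, and $\beta\alpha\notin I$. It is a crossing vertex if exactly two different arrows $\alpha_1,\alpha_2$ end at $i$, exactly two different arrows $\beta_1,\beta_2$ start at $i$, and (suitably numbered) $\beta_j\alpha_i\in I$ if and only if $i=j$. $Q_0^t$, $Q_0^c$ denote the sets of transition and crossing vertices. $(Q,I)$ is 2-regular gentle if $Q_0=Q_0^c$ and $I$ is generated by the zero relations at crossing vertices; it is gentle if it is obtained from a 2-regular gentle quiver by deleting any choice of arrows and removing the relations involving deleted arrows. A gentle order $\Lambda$ is the completion of $kQ/I$ with respect to the arrow ideal, where $(Q,I)$ is a gentle quiver with $Q_0=Q_0^t\cup Q_0^c$. For each arrow $\alpha$ let $\sigma(\alpha)$ be the unique arrow with $\sigma(\alpha)\alpha\notin I$; $\sigma$ is a permutation of $Q_1$. A permitted cycle is a cyclic path $\alpha_n\cdots\alpha_1\notin I$ with different arrows and $\alpha_1\alpha_n\notin I$. $\Lambda$ is an $R$-order (free and finitely generated over the central image of $R$) via $R\to\Lambda$ sending $x$ to the sum of all permitted cycles. Put $\omega=\operatorname{Hom}_R(\Lambda,R)$. Permutation $\kappa$: a forbidden cycle is a cyclic path $\beta_n\cdots\beta_1$ of $n\ge1$ different arrows with all $\beta_{i+1}\beta_i\in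 I$ and $\beta_1\beta_n\in I$. A forbidden thread is a path $\beta_n\cdots\beta_1$ of $n\ge 1$ different arrows with $\beta_{i+1}\beta_i\in I$ for $1\le i<n$, which is not a forbidden cycle and cannot be extended on the left or right by a composable arrow such that the new length-two subpath lies in $I$ (an arrow between transition vertices is a forbidden thread). For $j\in Q_0^t$ there is a unique forbidden thread $f_1$ starting at $j$; put $\kappa(j)=t(f_1)\in Q_0^t$. This defines a permutation $\kappa$ of $Q_0^t$. For a subset $\mathcal X\subseteq Q_0^t$ with $\kappa(\mathcal X)=\mathcal X$, $I(\mathcal X)$ is the two-sided ideal of $\Lambda$ generated by all $e_i$ with $i\in Q_0\setminus\mathcal X$ and all arrows $\alpha$ with $s(\alpha)\in\mathcal X$. If $j\in\mathcal X_a$, the functor $\mathbb T_a$ is the standard equivalence associated to the exceptional cycle $(S_j,S_{\kappa(j)},\dots)$ formed by the simple modules at the vertices of the orbit $\mathcal X_a$. The involution $\xi\colon\Lambda\to\Lambda$ is the $k$-algebra automorphism with $\xi(e_i)=e_i$ for all $i\in Q_0$ and: if $\operatorname{char}k=2$, $\xi(\alpha)=\alpha$ for all $\alpha\in Q_1$; otherwise choose $\operatorname{sgn}\colon Q_1\to\{-1,1\}$ with $\operatorname{sgn}(\alpha)\ne\operatorname{sgn}(\beta)$ whenever $\alpha\ne\beta$ and $s(\alpha)=s(\beta)$, and put $\xi(\alpha)=\operatorname{sgn}(\sigma(\alpha))\operatorname{sgn}(\alpha)\,\alpha$. ${}_\xi\Lambda$ is the bimodule $\Lambda$ with regular right action and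 left action $a\cdot x=\xi(a)x$. *)

(* Defs.v *)
From HB Require Import structures.
From mathcomp Require Import all_boot all_algebra.
From mathcomp Require Import generic_quotient boolp.

Set Implicit Arguments.
Unset Strict Implicit.
Unset Printing Implicit Defensive.

Import GRing.Theory.
Local Open Scope ring_scope.
Local Open Scope quotient_scope.

(* A quiver with relations (Q, I) whose ideal I is generated by zero relations of
   length two.  Paths are composed from right to left, and [zrel b a] states that
   the path [b a] (first [a], then [b]) lies in I; a length-two path that is not
   among the [zrel] pairs does not lie in I. *)
Record quiver := Quiver {
  Q0 : finType;
  Q1 : finType;
  src : Q1 -> Q0;
  tgt : Q1 -> Q0;
  zrel : rel Q1;
  zrel_comp : forall b a, zrel b a -> src b = tgt a }.

Section Quivers.
Variable Q : quiver.
Implicit Types (i : Q0 Q) (a b : Q1 Q) (s : seq (Q1 Q)).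

Definition ends_at i : {set Q1 Q} := [set a | tgt a == i].
Definition starts_at i : {set Q1 Q} := [set b | src b == i].

Definition transition : {set Q0 Q} :=
  [set i | [exists a, exists b,
     [&& ends_at i == [set a], starts_at i == [set b] & ~~ zrel b a]]].

Definition crossing : {set Q0 Q} :=
  [set i | [exists a1, exists a2, exists b1, exists b2,
     [&& a1 != a2, b1 != b2, ends_at i == [set a1; a2],
         starts_at i == [set b1; b2] &
      [&& zrel b1 a1, zrel b2 a2, ~~ zrel b2 a1 & ~~ zrel b1 a2]]]].

(* The path beta_n ... beta_1 starting at i is encoded by i together with the list
   [:: beta_1; ...; beta_n] of its arrows in the order of travel; (i, [::]) is the
   trivial path e_i.  As I is generated by paths of length two, [permitted i s]
   says that (i, s) is a path and that it does not lie in I. *)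
Definition permitted i s : bool :=
  if s is a :: s' then
    (src a == i) && path (fun a b => (src b == tgt a) && ~~ zrel b a) a s'
  else true.

Definition path_end i s : Q0 Q := last i (map (@tgt Q) s).

Lemma path_end_cat i s1 s2 :
  path_end i (s1 ++ s2) = path_end (path_end i s1) s2.
Proof. by rewrite /path_end map_cat last_cat. Qed.

Lemma permitted_cat i s1 s2 :
  permitted i (s1 ++ s2) -> permitted i s1 && permitted (path_end i s1) s2.
Proof.
case: s1 => [|a s1] //=.
rewrite cat_path => /and3P[-> -> /=].
case: s2 => [|b s2] //= /andP[/andP[/eqP-> _] ->].
by rewrite andbT /path_end /= last_map.
Qed.

Lemma permitted_take i s j : permitted i s -> permitted i (take j s).
Proof. by rewrite -{1}(cat_take_drop j s) => /permitted_cat/andP[]. Qed.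

Lemma permitted_drop i s j :
  permitted i s -> permitted (path_end i (take j s)) (drop j s).
Proof. by rewrite -{1}(cat_take_drop j s) => /permitted_cat/andP[]. Qed.

End Quivers.

(* [zrel] only relates composable arrows, so when all vertices are crossing the
   generators of I are exactly the zero relations at the crossing vertices. *)
Definition two_regular_gentle (Q : quiver) : Prop :=
  forall i : Q0 Q, i \in crossing Q.

(* Deleting arrows from Q' means keeping the vertices (v is bijective) and
   retaining a subset of the arrows (e is injective) together with the relations
   among them. *)
Definition gentle (Q : quiver) : Prop :=
  exists (Q' : quiver) (v : Q0 Q -> Q0 Q') (e : Q1 Q -> Q1 Q'),
    [/\ two_regular_gentle Q', bijective v, injective e,
        (forall a, src (e a) = v (src a) /\ tgt (e a) = v (tgt a)) &
        forall b a, zrel b a = zrel (e b) (e a)].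

Record gentle_order_quiver := GentleOrderQuiver {
  goq :> quiver;
  goq_gentle : gentle goq;
  goq_vertices : forall i : Q0 goq, i \in transition goq :|: crossing goq }.

Section Algebra.
Variables (k : fieldType) (Q : quiver).

(* The ideal I is spanned by paths, so kQ/I has the permitted paths as a k-basis
   and the n-th power of the arrow ideal is spanned by those of length >= n, all
   but finitely many basis paths.  Hence the completion consists of arbitrary
   families of coefficients indexed by the permitted paths, i.e. of formal sums
   of permitted paths; [coef f i s] is the coefficient of the path (i, s). *)
Record completed_alg := CompletedAlg {
  coef : Q0 Q -> seq (Q1 Q) -> k;
  coef_permitted : forall i s, ~~ permitted i s -> coef i s = 0 }.

Implicit Types f g h : completed_alg.

Lemma algP f g : (forall i s, permitted i s -> coef f i s = coef g i s) -> f = g.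
Proof.
case: f g => [f Hf] [g Hg] /= E.
have Efg : f = g.
  apply/funext => i; apply/funext => s.
  by have [/E//|np] := boolP (permitted i s); rewrite Hf ?Hg.
by subst g; congr CompletedAlg; apply: Prop_irrelevance.
Qed.

Definition mk_alg (F : Q0 Q -> seq (Q1 Q) -> k) : completed_alg.
Proof.
exists (fun i s => if permitted i s then F i s else 0).
by move=> i s /negbTE ->.
Defined.
Arguments coef : simpl never.

Lemma mk_algE F i s : permitted i s -> coef (mk_alg F) i s = F i s.
Proof. by rewrite /mk_alg /coef => ->. Qed.

HB.instance Definition _ := gen_eqMixin completed_alg.
HB.instance Definition _ := gen_choiceMixin completed_alg.

Definition alg_zero := mk_alg (fun _ _ => 0).
Definition alg_opp f := mk_alg (fun i s => - coef f i s).
Definition alg_add f g := mk_alg (fun i s => coef f i s + coef g i s).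

Lemma alg_addA : associative alg_add.
Proof. by move=> f g h; apply: algP => i s p; rewrite !mk_algE // addrA. Qed.
Lemma alg_addC : commutative alg_add.
Proof. by move=> f g; apply: algP => i s p; rewrite !mk_algE // addrC. Qed.
Lemma alg_add0 : left_id alg_zero alg_add.
Proof. by move=> f; apply: algP => i s p; rewrite !mk_algE // add0r. Qed.
Lemma alg_addN : left_inverse alg_zero alg_opp alg_add.
Proof. by move=> f; apply: algP => i s p; rewrite !mk_algE // addNr. Qed.

HB.instance Definition _ :=
  GRing.isZmodule.Build completed_alg alg_addA alg_addC alg_add0 alg_addN.

(* The coefficient of p in f g is the sum over all factorizations p = q r into
   paths of f_q g_r; the path r = (i, take j s) is travelled first. *)
Definition alg_mul f g := mk_alg (fun i s =>
  \sum_(0 <= j < (size s).+1)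
     coef f (path_end i (take j s)) (drop j s) * coef g i (take j s)).

Definition alg_one := mk_alg (fun _ s => (s == [::])%:R).

Lemma alg_coefD f g i s : coef (f + g) i s = coef f i s + coef g i s.
Proof.
have [p|np] := boolP (permitted i s); first by rewrite mk_algE.
by rewrite !coef_permitted // addr0.
Qed.

Lemma alg_mulE f g i s : permitted i s -> coef (alg_mul f g) i s =
  \sum_(0 <= j < (size s).+1)
     coef f (path_end i (take j s)) (drop j s) * coef g i (take j s).
Proof. exact: mk_algE. Qed.

Lemma alg_mulDl : left_distributive alg_mul +%R.
Proof.
move=> f g h; apply: algP => i s p; rewrite (alg_coefD (alg_mul f h)) !alg_mulE // -big_split /=.
by apply: eq_bigr => j _; rewrite alg_coefD mulrDl.
Qed.

Lemma alg_mulDr : right_distributive alg_mul +%R.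
Proof.
move=> f g h; apply: algP => i s p; rewrite (alg_coefD (alg_mul f g)) !alg_mulE // -big_split /=.
by apply: eq_bigr => j _; rewrite alg_coefD mulrDr.
Qed.

Lemma alg_oneE i s : coef alg_one i s = (s == [::])%:R.
Proof.
have [p|np] := boolP (permitted i s); first by rewrite mk_algE.
by rewrite coef_permitted //; case: s np.
Qed.

Lemma alg_mul1l : left_id alg_one alg_mul.
Proof.
move=> f; apply: algP => i s p; rewrite alg_mulE // big_nat_recr //= big_nat.
rewrite big1 ?add0r; last first.
  move=> j /andP[_ ltj].
  by rewrite alg_oneE -size_eq0 size_drop subn_eq0 leqNgt ltj mul0r.
by rewrite alg_oneE drop_size take_size /= mul1r.
Qed.

Lemma alg_mul1r : right_id alg_one alg_mul.
Proof.
move=> f; apply: algP => i s p; rewrite alg_mulE // big_nat_recl //= big_nat.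
rewrite big1 ?addr0; last first.
  move=> j /andP[_ ltj].
  by rewrite alg_oneE -size_eq0 size_takel // mulr0.
by rewrite alg_oneE drop0 take0 /= mulr1.
Qed.

Lemma triangle_exchange n (F : nat -> nat -> k) :
  \sum_(0 <= j < n.+1) \sum_(0 <= l < j.+1) F j l =
  \sum_(0 <= l < n.+1) \sum_(0 <= j < (n - l).+1) F (j + l)%N l.
Proof.
rewrite [LHS]big_nat.
under eq_bigr => j /andP[_ ltj].
  rewrite (big_nat_widen _ _ n.+1) //; over.
rewrite -big_nat (exchange_big_dep_nat xpredT) //=.
apply: eq_big_nat => l /andP[_ ltl].
rewrite -subSn // -(big_addn 0 n.+1 l xpredT (F^~ l)) add0n.
by rewrite [RHS](big_nat_widenl _ 0).
Qed.

Lemma alg_mulA : associative alg_mul.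
Proof.
move=> f g h; apply: algP => i s p; rewrite !alg_mulE //.
transitivity (\sum_(0 <= j < (size s).+1) \sum_(0 <= l < j.+1)
   coef f (path_end i (take j s)) (drop j s) *
   (coef g (path_end i (take l s)) (drop l (take j s)) * coef h i (take l s))).
  apply: eq_big_nat => j /andP[_ ltj].
  rewrite alg_mulE; last exact: permitted_take.
  rewrite big_distrr /= size_takel //.
  by apply: eq_big_nat => l /andP[_ ltl]; rewrite take_takel.
rewrite triangle_exchange; apply: eq_big_nat => l /andP[_ ltl].
rewrite alg_mulE; last exact: permitted_drop.
rewrite big_distrl /= size_drop; apply: eq_big_nat => j _.
rewrite mulrA; congr (_ * _ * _).
  by rewrite drop_drop -path_end_cat -takeD addnC.
by rewrite take_drop.
Qed.

HB.instance Definition _ := GRing.Zmodule_isPzRing.Build completed_alg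
  alg_mulA alg_mul1l alg_mul1r alg_mulDl alg_mulDr.

End Algebra.
Arguments coef : simpl never.

Section Elements.
Variables (k : fieldType) (Q : quiver).
Local Notation L := (completed_alg k Q).
Implicit Types f g : L.

Lemma alg_coefM f g i s : permitted i s -> coef (f * g) i s =
  \sum_(0 <= j < (size s).+1)
     coef f (path_end i (take j s)) (drop j s) * coef g i (take j s).
Proof. exact: alg_mulE. Qed.

Lemma alg_coef1 i s : coef (1 : L) i s = (s == [::])%:R.
Proof. exact: alg_oneE. Qed.

Definition alg_scale (c : k) f : L := mk_alg (fun i s => c * coef f i s).

Lemma alg_coefZ c f i s : coef (alg_scale c f) i s = c * coef f i s.
Proof.
have [p|np] := boolP (permitted i s); first by rewrite mk_algE.
by rewrite !coef_permitted // mulr0.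
Qed.

Lemma alg_scaleA a b f : alg_scale a (alg_scale b f) = alg_scale (a * b) f.
Proof. by apply: algP => i s _; rewrite !alg_coefZ mulrA. Qed.
Lemma alg_scale1 : left_id 1 alg_scale.
Proof. by move=> f; apply: algP => i s _; rewrite alg_coefZ mul1r. Qed.
Lemma alg_scaleDr : right_distributive alg_scale +%R.
Proof.
by move=> a f g; apply: algP => i s _; rewrite alg_coefZ !alg_coefD !alg_coefZ mulrDr.
Qed.
Lemma alg_scaleDl f : {morph alg_scale^~ f : a b / a + b}.
Proof.
by move=> a b; apply: algP => i s _; rewrite alg_coefD !alg_coefZ mulrDl.
Qed.

HB.instance Definition _ := GRing.Zmodule_isLmodule.Build k L
  alg_scaleA alg_scale1 alg_scaleDr alg_scaleDl.

Definition idem (i : Q0 Q) : L :=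
  mk_alg (fun i' s => ((i' == i) && (s == [::]))%:R).

Definition arrow (a : Q1 Q) : L :=
  mk_alg (fun i s => ((i == src a) && (s == [:: a]))%:R).

(* Rotations of a permitted cycle are different paths, and all of them are
   summands of [cycle_sum]. *)
Definition permitted_cycle (i : Q0 Q) (s : seq (Q1 Q)) : bool :=
  if s is a :: s' then
    [&& permitted i s, uniq s, tgt (last a s') == i & ~~ zrel a (last a s')]
  else false.

Definition cycle_sum : L := mk_alg (fun i s => (permitted_cycle i s)%:R).

Lemma coef_cycle_sum i s : coef cycle_sum i s = (permitted_cycle i s)%:R.
Proof.
have [p|np] := boolP (permitted i s); first by rewrite mk_algE.
by rewrite coef_permitted //; case: s np => //= a s /negbTE->.
Qed.

End Elements.

Definition sigma (Q : quiver) (a : Q1 Q) : Q1 Q :=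
  odflt a [pick b | (src b == tgt a) && ~~ zrel b a].

Section Sigma.
Variable Q : gentle_order_quiver.

Lemma sigmaP (a b : Q1 Q) : ((src b == tgt a) && ~~ zrel b a) = (sigma a == b).
Proof.
suff [c cP] : exists c, forall b, (src b == tgt a) && ~~ zrel b a = (c == b).
  rewrite /sigma; case: pickP => [d|/(_ c)] /=; last by rewrite cP eqxx.
  by rewrite !cP => /eqP->.
have := goq_vertices (tgt a); rewrite in_setU => /orP[]; rewrite inE.
  move=> /existsP[a' /existsP[c /and3P[/eqP Ea /eqP Eb nz]]].
  have : a \in ends_at (tgt a) by rewrite inE.
  rewrite Ea inE => /eqP ea; subst a'.
  exists c => {}b; have := congr1 (fun A : {set _} => b \in A) Eb.
  rewrite /= !inE => ->; rewrite (eq_sym c).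
  by case: eqP => // ->.
move=> /existsP[a1 /existsP[a2 /existsP[b1 /existsP[b2]]]].
case/and5P=> na nb /eqP Ea /eqP Eb /and4P[z1 z2 n1 n2].
have : a \in ends_at (tgt a) by rewrite inE.
have Eb' b' := congr1 (fun A : {set _} => b' \in A) Eb.
rewrite Ea !inE => /orP[]/eqP ea; subst a.
  exists b2 => {}b; have := Eb' b; rewrite /= !inE => ->; rewrite (eq_sym b2).
  case: (b =P b2) => [->|_]; first by rewrite n1 orbT.
  by rewrite orbF; case: eqP => // ->; rewrite z1.
exists b1 => {}b; have := Eb' b; rewrite /= !inE => ->; rewrite (eq_sym b1).
case: (b =P b1) => [->|_]; first by rewrite n2.
by case: eqP => // ->; rewrite z2.
Qed.

Lemma sigma_inj : injective (@sigma Q).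
Proof.
move=> a a' Es; set b := sigma a.
have /andP[/eqP sb nz] : (src b == tgt a) && ~~ zrel b a by rewrite sigmaP.
have /andP[/eqP sb' nz'] : (src b == tgt a') && ~~ zrel b a'.
  by rewrite sigmaP -Es.
have a1 : a \in ends_at (src b) by rewrite inE sb.
have a1' : a' \in ends_at (src b) by rewrite inE sb'.
have b1 : b \in starts_at (src b) by rewrite inE.
have := goq_vertices (src b); rewrite in_setU => /orP[]; rewrite inE.
  move=> /existsP[c /existsP[d /and3P[/eqP Ea _ _]]].
  by move: a1 a1'; rewrite Ea !inE => /eqP-> /eqP->.
move=> /existsP[c1 /existsP[c2 /existsP[d1 /existsP[d2]]]].
case/and5P=> _ _ /eqP Ea /eqP Eb /and4P[z1 z2 n1 n2].
move: a1 a1' b1; rewrite Ea Eb !inE.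
move=> /orP[]/eqP e1 /orP[]/eqP e2 /orP[]/eqP e3; rewrite e1 e2 //;
  by move: nz nz'; rewrite e1 e2 e3 ?z1 ?z2.
Qed.

Lemma permittedE i (a : Q1 Q) s :
  permitted i (a :: s) = (src a == i) && fpath (@sigma Q) a s.
Proof. by rewrite /=; congr (_ && _); apply: eq_path => b c; rewrite sigmaP. Qed.

Lemma permitted_cycleE i (a : Q1 Q) s : permitted i (a :: s) ->
  permitted_cycle i (a :: s) = (order (@sigma Q) a == (size s).+1).
Proof.
move=> p; rewrite /permitted_cycle p.
have := p; rewrite permittedE => /andP[/eqP <- fp].
have -> : (tgt (last a s) == src a) && ~~ zrel a (last a s)
          = (sigma (last a s) == a) by rewrite -sigmaP eq_sym.
have Es : s = traject (@sigma Q) (sigma a) (size s).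
  by have /fpathP[n ->] := fp; rewrite size_traject.
rewrite andTb; apply/idP/eqP => [/andP[us sl]|os].
  apply: (order_cycle _ us (mem_head a s)).
  by rewrite /cycle rcons_path fp.
have Eo : a :: s = orbit (@sigma Q) a by rewrite /orbit os trajectS -Es.
apply/andP; split; first by rewrite Eo orbit_uniq.
have := cycle_orbit sigma_inj a; rewrite -Eo /= rcons_path.
by case/andP.
Qed.

End Sigma.

Section PowerSeries.
Variable k : fieldType.

Record power_series := PowerSeries { pcoef : nat -> k }.
Implicit Types r : power_series.

HB.instance Definition _ := gen_eqMixin power_series.
HB.instance Definition _ := gen_choiceMixin power_series.

Lemma pseriesP r1 r2 : pcoef r1 =1 pcoef r2 -> r1 = r2.
Proof. by case: r1 r2 => [f] [g] /= /funext->. Qed.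

Definition ps_zero := PowerSeries (fun _ => 0).
Definition ps_opp r := PowerSeries (fun n => - pcoef r n).
Definition ps_add r1 r2 := PowerSeries (fun n => pcoef r1 n + pcoef r2 n).

Lemma ps_addA : associative ps_add.
Proof. by move=> a b c; apply: pseriesP => n; exact: addrA. Qed.
Lemma ps_addC : commutative ps_add.
Proof. by move=> a b; apply: pseriesP => n; exact: addrC. Qed.
Lemma ps_add0 : left_id ps_zero ps_add.
Proof. by move=> a; apply: pseriesP => n; exact: add0r. Qed.
Lemma ps_addN : left_inverse ps_zero ps_opp ps_add.
Proof. by move=> a; apply: pseriesP => n; exact: addNr. Qed.

HB.instance Definition _ :=
  GRing.isZmodule.Build power_series ps_addA ps_addC ps_add0 ps_addN.

Definition ps_one := PowerSeries (fun n => (n == 0)%:R).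
Definition ps_mul r1 r2 :=
  PowerSeries (fun n => \sum_(i < n.+1) pcoef r1 i * pcoef r2 (n - i)).

Let tr N r : {poly k} := \poly_(i < N) pcoef r i.

Let mul_tr N r1 r2 n : (n < N)%N ->
  pcoef (ps_mul r1 r2) n = (tr N r1 * tr N r2)`_n.
Proof.
move=> ltn; rewrite coefM /=; apply: eq_bigr => i _; rewrite !coef_poly.
by rewrite (leq_ltn_trans _ ltn) ?(leq_ltn_trans _ ltn) ?leq_subr // -ltnS.
Qed.

Lemma ps_mulA : associative ps_mul.
Proof.
move=> a b c; apply: pseriesP => n.
transitivity ((tr n.+1 a * (tr n.+1 b * tr n.+1 c))`_n).
  rewrite coefM; apply: eq_bigr => i _; rewrite coef_poly ltn_ord.
  by rewrite (@mul_tr n.+1) // ltnS leq_subr.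
rewrite mulrA coefM; apply: eq_bigr => i _.
by rewrite (@mul_tr n.+1) // coef_poly ltnS leq_subr.
Qed.

Lemma ps_mulC : commutative ps_mul.
Proof.
by move=> a b; apply: pseriesP => n; rewrite !(@mul_tr n.+1) // mulrC.
Qed.

Lemma ps_mul1 : left_id ps_one ps_mul.
Proof.
move=> a; apply: pseriesP => n /=; rewrite big_ord_recl /= mul1r subn0.
by rewrite big1 ?addr0 // => i _; rewrite mul0r.
Qed.

Lemma ps_mulDl : left_distributive ps_mul +%R.
Proof.
move=> a b c; apply: pseriesP => n /=; rewrite -big_split /=.
by apply: eq_bigr => i _; exact: mulrDl.
Qed.

HB.instance Definition _ := GRing.Zmodule_isComPzRing.Build power_series
  ps_mulA ps_mulC ps_mul1 ps_mulDl.

End PowerSeries.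

Section OrderMap.
Variables (k : fieldType).

(* The R-algebra structure k[[x]] -> Lambda with x |-> [cycle_sum], that is
   sum_n r_n x^n |-> sum_n r_n (cycle_sum)^n.  The coefficient at a path p is a
   finite sum because (cycle_sum)^n only involves paths of length >= n. *)
Definition order_map (Q : quiver) (r : power_series k) : completed_alg k Q :=
  mk_alg (fun i s =>
    \sum_(0 <= n < (size s).+1) pcoef r n * coef (cycle_sum k Q ^+ n) i s).

Variable Q : gentle_order_quiver.
Local Notation L := (completed_alg k Q).
Implicit Types (f : L) (r : power_series k).

Lemma cycle_sum_comm f : cycle_sum k Q * f = f * cycle_sum k Q.
Proof.
apply: algP => i [|a s] p; rewrite !alg_coefM //.
  by rewrite !big_nat1 !coef_cycle_sum mul0r mulr0.
have [/eqP si fp] : src a == i /\ fpath (@sigma Q) a s.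
  by apply/andP; rewrite -permittedE.
set S := @sigma Q; set m := (size s).+1; set n := order S a.
have Es : a :: s = traject S a m.
  by rewrite /m trajectS; have /fpathP[q ->] := fp; rewrite size_traject.
have ordS j : order S (iter j S a) = n.
  rewrite /n -[RHS]size_orbit.
  apply: (order_cycle (cycle_orbit (@sigma_inj Q) a) (orbit_uniq _ _)).
  by rewrite -fconnect_orbit fconnect_iter.
have drE j : (j <= m)%N -> drop j (a :: s) = traject S (iter j S a) (m - j).
  move=> lej; rewrite Es -{1}(subnKC lej) trajectD drop_cat size_traject.
  by rewrite ltnn subnn drop0.
have cE i' s' b l : permitted i' s' -> s' = traject S b l.+1 ->
    coef (cycle_sum k Q) i' s' = (order S b == l.+1)%:R.
  move=> p' E; rewrite coef_cycle_sum; rewrite E trajectS in p' *.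
  by rewrite permitted_cycleE // size_traject.
have dp j : permitted (path_end i (take j (a :: s))) (drop j (a :: s)).
  exact: permitted_drop.
have tp j : permitted i (take j (a :: s)) by exact: permitted_take.
transitivity (\sum_(0 <= j < m.+1) if (j == m - n)%N && (n <= m)%N
               then coef f i (take (m - n) (a :: s)) else 0).
  apply: eq_big_nat => j /andP[_]; rewrite ltnS => lej.
  have [ltj|] := ltnP j m; last first.
    move=> gej; have -> : j = m by apply/eqP; rewrite eqn_leq lej.
    rewrite drE // subnn coef_cycle_sum mul0r.
    case: ifP => // /andP[/eqP em len].
    have := order_gt0 S a; rewrite -/n => n0.
    by move: (ltn_subrL n m); rewrite -em ltnn n0 /m.
  have E := drE j lej; rewrite -(subnSK ltj) in E.
  rewrite (cE _ _ _ _ (dp j) E) ordS subnSK //.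
  have -> : (n == m - j)%N = (j == m - n)%N && (n <= m)%N.
    apply/eqP/andP => [->|[/eqP-> len]]; last by rewrite subKn.
    by rewrite subKn // leq_subr.
  case: ifP => [/andP[/eqP-> _]|_]; first by rewrite mul1r.
  by rewrite mul0r.
transitivity (\sum_(0 <= j < m.+1) if (j == n)%N
               then coef f i (take (m - n) (a :: s)) else 0).
  rewrite -!big_mkcond /= big_nat1_eq.
  case: (leqP n m) => len; last first.
    by rewrite ltnNge len /= big1 // => ? /andP[].
  under eq_bigl => j do rewrite andbT.
  by rewrite big_nat1_eq ltnS leq_subr ltnS len.
apply: eq_big_nat => -[|j] /andP[_ ltj].
  rewrite take0 coef_cycle_sum mulr0; case: eqP => // e.
  by have := order_gt0 S a; rewrite -/n -e.
have lej : (j.+1 <= m)%N by rewrite -ltnS.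
have E : take j.+1 (a :: s) = traject S a j.+1.
  by rewrite Es take_traject.
rewrite (cE _ _ _ _ (tp j.+1) E) -/n (eq_sym n).
case: eqP => [en|_]; last by rewrite mulr0.
rewrite mulr1 drE // en iter_order; last exact: sigma_inj.
have pe : path_end i (take n (a :: s)) = i.
  have := tp j.+1; rewrite -en E trajectS => p'.
  have := permitted_cycleE p'; rewrite size_traject -/S -/n en eqxx.
  case/and4P=> _ _ /eqP <- _; rewrite /path_end /= last_map.
  by case: (traject _ _ _).
rewrite pe; congr (coef f i _).
by rewrite Es take_traject // leq_subr.
Qed.

Lemma cycle_sumX_support n i s :
  (size s < n)%N -> coef (cycle_sum k Q ^+ n) i s = 0.
Proof.
elim: n i s => // n IH i s; rewrite ltnS => les.
have [p|/coef_permitted-> //] := boolP (permitted i s).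
rewrite exprSr alg_coefM // big_nat_recl // take0 coef_cycle_sum mulr0 add0r.
rewrite big_nat big1 // => j /andP[_ ltj].
rewrite IH ?mul0r // size_drop.
by apply: leq_trans les; rewrite ltn_subrL /= (leq_ltn_trans _ ltj).
Qed.

Lemma order_map_coef r N i s : (size s <= N)%N ->
  coef (order_map Q r) i s =
  \sum_(0 <= n < N.+1) pcoef r n * coef (cycle_sum k Q ^+ n) i s.
Proof.
move=> les; have [p|np] := boolP (permitted i s); last first.
  rewrite coef_permitted // big1 // => n _; by rewrite coef_permitted ?mulr0.
rewrite mk_algE // [RHS](@big_cat_nat _ _ _ (size s).+1) //=.
rewrite [X in _ = _ + X]big_nat [X in _ = _ + X]big1 ?addr0 // => n /andP[ltn _].
by rewrite cycle_sumX_support ?mulr0.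
Qed.

Lemma order_map_central r f : order_map Q r * f = f * order_map Q r.
Proof.
apply: algP => i s p.
transitivity (\sum_(0 <= n < (size s).+1)
    pcoef r n * coef (cycle_sum k Q ^+ n * f) i s).
  rewrite alg_coefM //; under [RHS]eq_bigr do rewrite alg_coefM // big_distrr.
  rewrite exchange_big /=; apply: eq_bigr => j _.
  rewrite (@order_map_coef _ (size s)) ?size_drop ?leq_subr // big_distrl /=.
  by apply: eq_bigr => n _; rewrite mulrA.
have comm n : cycle_sum k Q ^+ n * f = f * cycle_sum k Q ^+ n.
  by apply/esym/commrX/esym/cycle_sum_comm.
under eq_bigr do rewrite comm.
rewrite [RHS]alg_coefM //; under eq_bigr do rewrite alg_coefM // big_distrr.
rewrite exchange_big /=; apply: eq_bigr => j _.
rewrite (@order_map_coef _ (size s)); last by rewrite size_take; case: ifP => // /ltnW.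
by rewrite big_distrr /=; apply: eq_bigr => n _; rewrite mulrCA.
Qed.

End OrderMap.

Record bimodule (A : pzRingType) := Bimodule {
  bcarrier :> lmodType A;
  ract : bcarrier -> A -> bcarrier;
  ractA : forall x a b, ract (ract x a) b = ract x (a * b);
  ract1 : forall x, ract x 1 = x;
  ractDl : forall x y a, ract (x + y) a = ract x a + ract y a;
  ractDr : forall x a b, ract x (a + b) = ract x a + ract x b;
  lractA : forall a x b, a *: ract x b = ract (a *: x) b }.

Definition finitely_generated (A : pzRingType) (M : lmodType A) : Prop :=
  exists (n : nat) (g : 'I_n -> M), forall x : M,
  exists c : 'I_n -> A, x = \sum_i c i *: g i.

Section Twist.
Variables (A : pzRingType) (xi : {rmorphism A -> A}).

Definition twisted (_ : {rmorphism A -> A}) : Type := A.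
Local Notation T := (twisted xi).
HB.instance Definition _ := GRing.Zmodule.on T.

Definition twist_scale (a : A) (x : T) : T := (xi a * (x : A) : A).

Lemma twist_scaleA a b x :
  twist_scale a (twist_scale b x) = twist_scale (a * b) x.
Proof. by rewrite /twist_scale rmorphM mulrA. Qed.
Lemma twist_scale1 : left_id 1 twist_scale.
Proof. by move=> x; rewrite /twist_scale rmorph1 mul1r. Qed.
Lemma twist_scaleDr : right_distributive twist_scale +%R.
Proof. by move=> a x y; exact: mulrDr. Qed.
Lemma twist_scaleDl x : {morph twist_scale^~ x : a b / a + b}.
Proof. by move=> a b; rewrite /twist_scale rmorphD; exact: mulrDl. Qed.

HB.instance Definition _ := GRing.Zmodule_isLmodule.Build A T
  twist_scaleA twist_scale1 twist_scaleDr twist_scaleDl.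

Definition twist_ract (x : T) (a : A) : T := ((x : A) * a : A).

Definition twist_bimodule : bimodule A.
Proof.
apply: (@Bimodule A T twist_ract).
- by move=> x a b; rewrite /twist_ract mulrA.
- by move=> x; exact: mulr1.
- by move=> x y a; exact: mulrDl.
- by move=> x a b; exact: mulrDr.
- by move=> a x b; exact: mulrA.
Defined.
End Twist.

Section Ideal.
Variables (A : pzRingType) (G : A -> Prop).

Inductive ideal_generated : A -> Prop :=
| ideal_gen x of G x : ideal_generated x
| ideal_zero : ideal_generated 0
| ideal_add x y of ideal_generated x & ideal_generated y :
    ideal_generated (x + y)
| ideal_mull a x of ideal_generated x : ideal_generated (a * x)
| ideal_mulr x a of ideal_generated x : ideal_generated (x * a).

Record ideal_elt :=
  IdealElt { ival :> A; ivalP : ideal_generated ival }.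

Lemma ival_inj : injective ival.
Proof.
by case=> x hx [y hy] /= e; subst y; congr IdealElt; apply: Prop_irrelevance.
Qed.

HB.instance Definition _ := gen_eqMixin ideal_elt.
HB.instance Definition _ := gen_choiceMixin ideal_elt.

Lemma ideal_opp x : ideal_generated x -> ideal_generated (- x).
Proof. by rewrite -mulN1r; exact: ideal_mull. Qed.

Definition ie_zero := IdealElt ideal_zero.
Definition ie_opp (x : ideal_elt) := IdealElt (ideal_opp (ivalP x)).
Definition ie_add (x y : ideal_elt) :=
  IdealElt (ideal_add (ivalP x) (ivalP y)).
Definition ie_scale (a : A) (x : ideal_elt) :=
  IdealElt (ideal_mull a (ivalP x)).
Definition ie_ract (x : ideal_elt) (a : A) :=
  IdealElt (ideal_mulr a (ivalP x)).

Lemma ie_addA : associative ie_add.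
Proof. by move=> x y z; apply: ival_inj; exact: addrA. Qed.
Lemma ie_addC : commutative ie_add.
Proof. by move=> x y; apply: ival_inj; exact: addrC. Qed.
Lemma ie_add0 : left_id ie_zero ie_add.
Proof. by move=> x; apply: ival_inj; exact: add0r. Qed.
Lemma ie_addN : left_inverse ie_zero ie_opp ie_add.
Proof. by move=> x; apply: ival_inj; exact: addNr. Qed.

HB.instance Definition _ :=
  GRing.isZmodule.Build ideal_elt ie_addA ie_addC ie_add0 ie_addN.

Lemma ie_scaleA a b x : ie_scale a (ie_scale b x) = ie_scale (a * b) x.
Proof. by apply: ival_inj; exact: mulrA. Qed.
Lemma ie_scale1 : left_id 1 ie_scale.
Proof. by move=> x; apply: ival_inj; exact: mul1r. Qed.
Lemma ie_scaleDr : right_distributive ie_scale +%R.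
Proof. by move=> a x y; apply: ival_inj; exact: mulrDr. Qed.
Lemma ie_scaleDl x : {morph ie_scale^~ x : a b / a + b}.
Proof. by move=> a b; apply: ival_inj; exact: mulrDl. Qed.

HB.instance Definition _ := GRing.Zmodule_isLmodule.Build A ideal_elt
  ie_scaleA ie_scale1 ie_scaleDr ie_scaleDl.

Definition ideal_bimodule : bimodule A.
Proof.
apply: (@Bimodule A ideal_elt ie_ract).
- by move=> x a b; apply: ival_inj; rewrite /= mulrA.
- by move=> x; apply: ival_inj; exact: mulr1.
- by move=> x y a; apply: ival_inj; exact: mulrDl.
- by move=> x a b; apply: ival_inj; exact: mulrDr.
- by move=> a x b; apply: ival_inj; exact: mulrA.
Defined.
End Ideal.

(* omega = Hom_R(Lambda, R) with (a phi b)(x) = phi (b x a). *)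
Section Omega.
Variables (k : fieldType) (Q : gentle_order_quiver).
Local Notation L := (completed_alg k Q).
Local Notation R := (power_series k).

Record dual_alg := DualAlg {
  dual_fun :> L -> R;
  dual_add : forall x y, dual_fun (x + y) = dual_fun x + dual_fun y;
  dual_lin : forall r x, dual_fun (order_map Q r * x) = r * dual_fun x }.
Implicit Types phi psi : dual_alg.

Lemma dualP phi psi : phi =1 psi -> phi = psi.
Proof.
case: phi psi => [f fD fL] [g gD gL] /= /funext e; subst g.
by congr DualAlg; apply: Prop_irrelevance.
Qed.

HB.instance Definition _ := gen_eqMixin dual_alg.
HB.instance Definition _ := gen_choiceMixin dual_alg.

Definition du_zero : dual_alg.
Proof.
apply: (@DualAlg (fun _ => 0)) => [x y|r x]; first by rewrite addr0.
by rewrite mulr0.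
Defined.

Definition du_opp phi : dual_alg.
Proof.
apply: (@DualAlg (fun x => - phi x)) => [x y|r x].
  by rewrite dual_add opprD.
by rewrite dual_lin mulrN.
Defined.

Definition du_add phi psi : dual_alg.
Proof.
apply: (@DualAlg (fun x => phi x + psi x)) => [x y|r x].
  by rewrite !dual_add addrACA.
by rewrite !dual_lin mulrDr.
Defined.

Definition du_scale (a : L) phi : dual_alg.
Proof.
apply: (@DualAlg (fun x => phi (x * a))) => [x y|r x].
  by rewrite mulrDl dual_add.
by rewrite -mulrA dual_lin.
Defined.

Definition du_ract phi (a : L) : dual_alg.
Proof.
apply: (@DualAlg (fun x => phi (a * x))) => [x y|r x].
  by rewrite mulrDr dual_add.
by rewrite mulrA -order_map_central -mulrA dual_lin.
Defined.

Lemma du_addA : associative du_add.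
Proof. by move=> a b c; apply: dualP => x; exact: addrA. Qed.
Lemma du_addC : commutative du_add.
Proof. by move=> a b; apply: dualP => x; exact: addrC. Qed.
Lemma du_add0 : left_id du_zero du_add.
Proof. by move=> a; apply: dualP => x; exact: add0r. Qed.
Lemma du_addN : left_inverse du_zero du_opp du_add.
Proof. by move=> a; apply: dualP => x; exact: addNr. Qed.

HB.instance Definition _ :=
  GRing.isZmodule.Build dual_alg du_addA du_addC du_add0 du_addN.

Lemma du_scaleA a b phi : du_scale a (du_scale b phi) = du_scale (a * b) phi.
Proof. by apply: dualP => x /=; rewrite mulrA. Qed.
Lemma du_scale1 : left_id 1 du_scale.
Proof. by move=> phi; apply: dualP => x /=; rewrite mulr1. Qed.
Lemma du_scaleDr : right_distributive du_scale +%R.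
Proof. by move=> a phi psi; apply: dualP. Qed.
Lemma du_scaleDl phi : {morph du_scale^~ phi : a b / a + b}.
Proof. by move=> a b; apply: dualP => x /=; rewrite mulrDr dual_add. Qed.

HB.instance Definition _ := GRing.Zmodule_isLmodule.Build L dual_alg
  du_scaleA du_scale1 du_scaleDr du_scaleDl.

Definition omega : bimodule L.
Proof.
apply: (@Bimodule L dual_alg du_ract).
- by move=> phi a b; apply: dualP => x /=; rewrite mulrA.
- by move=> phi; apply: dualP => x /=; rewrite mul1r.
- by move=> phi psi a; apply: dualP.
- by move=> phi a b; apply: dualP => x /=; rewrite mulrDl dual_add.
- by move=> a phi b; apply: dualP => x /=; rewrite mulrA.
Defined.
End Omega.

(* B (x)_A M: finite formal sums of pairs (b, m), i.e. lists, modulo the smallest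
   congruence making (b, m) biadditive and A-balanced.  No formal inverses are
   needed, since - (b (x) m) = (- b) (x) m. *)
Section Tensor.
Variables (A : pzRingType) (B : bimodule A) (M : lmodType A).

Inductive tensor_rel : seq (B * M) -> seq (B * M) -> Prop :=
| tr_refl s : tensor_rel s s
| tr_sym s t of tensor_rel s t : tensor_rel t s
| tr_trans s t u of tensor_rel s t & tensor_rel t u : tensor_rel s u
| tr_cat s s' t t' of tensor_rel s s' & tensor_rel t t' :
    tensor_rel (s ++ t) (s' ++ t')
| tr_comm s t : tensor_rel (s ++ t) (t ++ s)
| tr_zero m : tensor_rel [:: (0, m)] [::]
| tr_addl b b' m : tensor_rel [:: (b + b', m)] [:: (b, m); (b', m)]
| tr_addr b m m' : tensor_rel [:: (b, m + m')] [:: (b, m); (b, m')]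
| tr_balanced b a m : tensor_rel [:: (ract b a, m)] [:: (b, a *: m)].

Definition tensor_relb s t : bool := `[< tensor_rel s t >].

Lemma tensor_relb_equiv : equiv_class_of tensor_relb.
Proof.
split=> [s|s t|t s u].
- by apply/asboolP; exact: tr_refl.
- by apply/asboolP/asboolP; exact: tr_sym.
- by move=> /asboolP st /asboolP tu; apply/asboolP; exact: tr_trans tu.
Qed.

Canonical tensor_equiv := EquivRelPack tensor_relb_equiv.

Definition tensor := {eq_quot tensor_equiv}.
HB.instance Definition _ := Choice.on tensor.
HB.instance Definition _ := EqQuotient.on tensor.

Definition formal (s : seq (B * M)) : tensor := \pi_tensor s.

Lemma formalP s t : formal s = formal t <-> tensor_rel s t.
Proof.
split=> [/eqmodP/asboolP //|h].
by apply/eqmodP/asboolP.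
Qed.

Lemma formal_repr (x : tensor) : formal (repr x) = x.
Proof. exact: reprK. Qed.

Lemma repr_formal s : tensor_rel (repr (formal s)) s.
Proof. by apply/formalP; exact: formal_repr. Qed.

Definition ts_opp1 (p : B * M) := (- p.1, p.2).
Definition ts_scale1 (a : A) (p : B * M) := (a *: p.1, p.2).
Definition ts_add (x y : tensor) := formal (repr x ++ repr y).
Definition ts_opp (x : tensor) := formal (map ts_opp1 (repr x)).
Definition ts_scale a (x : tensor) := formal (map (ts_scale1 a) (repr x)).

Lemma ts_addE s t : ts_add (formal s) (formal t) = formal (s ++ t).
Proof. by apply/formalP/tr_cat; exact: repr_formal. Qed.

Lemma tensor_rel_map (f : B -> B) :
  f 0 = 0 -> {morph f : x y / x + y} -> (forall b a, f (ract b a) = ract (f b) a) ->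
  forall s t, tensor_rel s t ->
  tensor_rel (map (fun p => (f p.1, p.2)) s) (map (fun p => (f p.1, p.2)) t).
Proof.
move=> f0 fD fA s t.
elim=> {s t} /= [s|s t _ h|s t u _ h1 _ h2|s s' t t' _ h1 _ h2|s t|m|b b' m|b m m'|b a m].
- exact: tr_refl.
- exact: tr_sym.
- exact: tr_trans h2.
- by rewrite !map_cat; exact: tr_cat.
- by rewrite !map_cat; exact: tr_comm.
- by rewrite f0; exact: tr_zero.
- by rewrite fD; exact: tr_addl.
- exact: tr_addr.
- by rewrite fA; exact: tr_balanced.
Qed.

Lemma ract0l a : ract (0 : B) a = 0.
Proof. by apply: (addIr (ract (0 : B) a)); rewrite -ractDl !add0r. Qed.

Lemma ractNl (b : B) a : ract (- b) a = - ract b a.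
Proof. by apply: (addIr (ract b a)); rewrite -ractDl !addNr ract0l. Qed.

Lemma ts_oppE s : ts_opp (formal s) = formal (map ts_opp1 s).
Proof.
apply/formalP/tensor_rel_map; last exact: repr_formal.
- exact: oppr0.
- exact: opprD.
- by move=> b a; rewrite ractNl.
Qed.

Lemma ts_scaleE a s : ts_scale a (formal s) = formal (map (ts_scale1 a) s).
Proof.
apply/formalP/tensor_rel_map; last exact: repr_formal.
- exact: scaler0.
- exact: scalerDr.
- by move=> b c; rewrite lractA.
Qed.

Lemma ts_addA : associative ts_add.
Proof.
move=> x y z; rewrite -(formal_repr x) -(formal_repr y) -(formal_repr z).
by rewrite !ts_addE catA.
Qed.
Lemma ts_addC : commutative ts_add.
Proof.
move=> x y; rewrite -(formal_repr x) -(formal_repr y) !ts_addE.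
by apply/formalP; exact: tr_comm.
Qed.
Lemma ts_add0 : left_id (formal [::]) ts_add.
Proof. by move=> x; rewrite -(formal_repr x) ts_addE. Qed.
Lemma ts_addN : left_inverse (formal [::]) ts_opp ts_add.
Proof.
move=> x; rewrite -(formal_repr x) ts_oppE ts_addE.
elim: (repr x) => [|[b m] s IH] //=.
have E p u : formal (p :: u) = ts_add (formal [:: p]) (formal u).
  by rewrite ts_addE.
rewrite E -ts_addE (E (b, m) s) (ts_addA (formal (map _ _))).
rewrite (ts_addC (formal (map _ _))) -ts_addA ts_addE IH.
rewrite (ts_addC (formal [:: (b, m)])) ts_add0 ts_addE.
apply/formalP; apply: (tr_trans (tr_sym (tr_addl _ _ _))).
by rewrite addNr; exact: tr_zero.
Qed.

HB.instance Definition _ :=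
  GRing.isZmodule.Build tensor ts_addA ts_addC ts_add0 ts_addN.

Lemma formal_cat s t : formal (s ++ t) = formal s + formal t.
Proof. by rewrite -ts_addE. Qed.

Lemma ts_scaleA a b x : ts_scale a (ts_scale b x) = ts_scale (a * b) x.
Proof.
rewrite -(formal_repr x) !ts_scaleE -map_comp; congr formal.
by apply: eq_map => -[c m] /=; rewrite /ts_scale1 /= scalerA.
Qed.
Lemma ts_scale1l : left_id 1 ts_scale.
Proof.
move=> x; rewrite -(formal_repr x) ts_scaleE; congr formal.
by rewrite -[RHS]map_id; apply: eq_map => -[c m]; rewrite /ts_scale1 /= scale1r.
Qed.
Lemma ts_scaleDr : right_distributive ts_scale +%R.
Proof.
move=> a x y; rewrite -(formal_repr x) -(formal_repr y) -formal_cat !ts_scaleE.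
by rewrite map_cat formal_cat.
Qed.
Lemma ts_scaleDl x : {morph ts_scale^~ x : a b / a + b}.
Proof.
move=> a b; rewrite -(formal_repr x) !ts_scaleE.
elim: (repr x) => [|[c m] s IH] /=; first by rewrite addr0.
rewrite -cat1s formal_cat IH -[in RHS]cat1s formal_cat.
rewrite -[X in _ = _ + formal X]cat1s formal_cat addrACA; congr (_ + _).
rewrite -formal_cat /ts_scale1 /= scalerDl; apply/formalP; exact: tr_addl.
Qed.

HB.instance Definition _ := GRing.Zmodule_isLmodule.Build A tensor
  ts_scaleA ts_scale1l ts_scaleDr ts_scaleDl.

Definition pure (b : B) (m : M) : tensor := formal [:: (b, m)].

Lemma pureDl b b' m : pure (b + b') m = pure b m + pure b' m.
Proof. by rewrite -formal_cat; apply/formalP; exact: tr_addl. Qed.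
Lemma pureDr b m m' : pure b (m + m') = pure b m + pure b m'.
Proof. by rewrite -formal_cat; apply/formalP; exact: tr_addr. Qed.
Lemma pure_balanced b a m : pure (ract b a) m = pure b (a *: m).
Proof. by apply/formalP; exact: tr_balanced. Qed.
Lemma pureZ a b m : pure (a *: b) m = a *: pure b m.
Proof. by rewrite [RHS]ts_scaleE. Qed.
Lemma pure0l m : pure 0 m = 0.
Proof. by apply/formalP; exact: tr_zero. Qed.
Lemma pure0r b : pure b 0 = 0.
Proof. by apply: (addIr (pure b 0)); rewrite -pureDr !add0r. Qed.

Lemma formal_sum s : formal s = \sum_(p <- s) pure p.1 p.2.
Proof.
elim: s => [|[b m] s IH]; first by rewrite big_nil.
by rewrite big_cons -cat1s formal_cat IH.
Qed.

End Tensor.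

Section TensorFunctoriality.
Variables (A : pzRingType) (B : bimodule A).

Section Map.
Variables (M N : lmodType A) (f : {linear M -> N}).

Definition tensor_map (x : tensor B M) : tensor B N :=
  formal (map (fun p => (p.1, f p.2)) (repr x)).

Lemma tensor_mapE s :
  tensor_map (formal s) = formal (map (fun p => (p.1, f p.2)) s).
Proof.
apply/formalP; have := repr_formal s; move: (repr _) => t.
elim=> {s t} /= [s|s t _ h|s t u _ h1 _ h2|s s' t t' _ h1 _ h2|s t|m|b b' m|b m m'|b a m].
- exact: tr_refl.
- exact: tr_sym.
- exact: tr_trans h2.
- by rewrite !map_cat; exact: tr_cat.
- by rewrite !map_cat; exact: tr_comm.
- exact: tr_zero.
- exact: tr_addl.
- by rewrite linearD; exact: tr_addr.
- by rewrite linearZ; exact: tr_balanced.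
Qed.

Lemma tensor_map_is_linear : linear tensor_map.
Proof.
move=> a x y; rewrite -(formal_repr x) -(formal_repr y).
rewrite [a *: _]ts_scaleE -formal_cat !tensor_mapE map_cat formal_cat.
rewrite [a *: _]ts_scaleE; congr (formal _ + _).
by rewrite -!map_comp; apply: eq_map.
Qed.

HB.instance Definition _ :=
  GRing.isLinear.Build A (tensor B M) (tensor B N) _ tensor_map
    tensor_map_is_linear.

Lemma tensor_map_pure b m : tensor_map (pure b m) = pure b (f m).
Proof. exact: tensor_mapE. Qed.
End Map.

Lemma tensor_ext (M N : lmodType A) (g h : {linear tensor B M -> N}) :
  (forall b m, g (pure b m) = h (pure b m)) -> g =1 h.
Proof.
move=> e x; rewrite -(formal_repr x) formal_sum !linear_sum.
by apply: eq_bigr => p _; exact: e.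
Qed.

Lemma tensor_finitely_generated (M : lmodType A) :
  finitely_generated B -> finitely_generated M ->
  finitely_generated (tensor B M).
Proof.
move=> [p [u hu]] [q [v hv]].
pose I := ('I_p * 'I_q)%type.
pose ev : 'I_#|{: I}| -> I := enum_val.
exists #|{: I}|, (fun l => pure (u (ev l).1) (v (ev l).2)).
suff H (x : tensor B M) :
    exists c : I -> A, x = \sum_ij c ij *: pure (u ij.1) (v ij.2).
  move=> x; have [c ->] := H x; exists (fun l => c (ev l)).
  by rewrite (reindex ev) //; apply/onW_bij; exact: enum_val_bij.
rewrite -(formal_repr x) formal_sum.
elim: (repr x) => [|[b m] s [c IH]].
  by exists (fun=> 0); rewrite big_nil big1 // => ij _; rewrite scale0r.
have [d ->] := hv m.
have hd j : exists e, ract b (d j) = \sum_i e i *: u i by exact: hu.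
have [e he] := choice hd.
exists (fun ij => e ij.2 ij.1 + c ij).
rewrite big_cons IH; under [RHS]eq_bigr do rewrite scalerDl.
rewrite [RHS]big_split /=; congr (_ + _).
rewrite -(pair_bigA _ (fun i j => e j i *: pure (u i) (v j))) exchange_big /=.
have -> : pure b (\sum_j d j *: v j) = \sum_j pure b (d j *: v j) :> tensor B M.
  exact: (big_morph _ (pureDr b) (pure0r M b)).
apply: eq_bigr => j _; rewrite -pure_balanced he.
rewrite (big_morph (fun z => pure z (v j)) (fun x y => pureDl x y (v j))
           (pure0l B (v j))).
by apply: eq_bigr => i _; rewrite pureZ.
Qed.

End TensorFunctoriality.

(* Categories whose hom-types carry an explicit equality [heq]. *)
Record category := Category {
  obj :> Type;
  hom : obj -> obj -> Type;
  heq : forall X Y, hom X Y -> hom X Y -> Prop;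
  idc : forall X, hom X X;
  comp : forall X Y Z, hom Y Z -> hom X Y -> hom X Z;
  heq_refl : forall X Y (f : hom X Y), heq f f;
  heq_sym : forall X Y (f g : hom X Y), heq f g -> heq g f;
  heq_trans : forall X Y (f g h : hom X Y), heq f g -> heq g h -> heq f h;
  comp_heq : forall X Y Z (g g' : hom Y Z) (f f' : hom X Y),
    heq g g' -> heq f f' -> heq (comp g f) (comp g' f');
  comp_id_l : forall X Y (f : hom X Y), heq (comp (idc Y) f) f;
  comp_id_r : forall X Y (f : hom X Y), heq (comp f (idc X)) f;
  comp_assoc : forall X Y Z W (h : hom Z W) (g : hom Y Z) (f : hom X Y),
    heq (comp h (comp g f)) (comp (comp h g) f) }.

Arguments hom {c}.
Arguments heq {c X Y}.
Arguments idc {c}.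
Arguments comp {c X Y Z}.

Local Notation "f === g" := (heq f g) (at level 70).
Local Notation "g \oc f" := (comp g f) (at level 50, format "g  \oc  f").

Record functor (C D : category) := Functor {
  fobj :> C -> D;
  fmap : forall X Y : C, hom X Y -> hom (fobj X) (fobj Y);
  fmap_heq : forall (X Y : C) (f g : hom X Y), f === g -> fmap f === fmap g;
  fmap_id : forall X : C, fmap (idc X) === idc (fobj X);
  fmap_comp : forall (X Y Z : C) (g : hom Y Z) (f : hom X Y),
    fmap (g \oc f) === fmap g \oc fmap f }.

Arguments fmap {C D} _ {X Y} _.

Definition functor_id (C : category) : functor C C.
Proof.
by apply: (@Functor C C (fun X => X) (fun X Y f => f)) => // *; exact: heq_refl.
Defined.

Definition functor_comp (C D E : category)
  (G : functor D E) (F : functor C D) : functor C E.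
Proof.
apply: (@Functor C E (fun X => G (F X)) (fun X Y f => fmap G (fmap F f))).
- by move=> X Y f g e; do 2!apply: fmap_heq.
- move=> X; apply: heq_trans (fmap_id G (F X)).
  by apply: fmap_heq; exact: fmap_id.
- move=> X Y Z g f; apply: heq_trans (fmap_comp G _ _).
  by apply: fmap_heq; exact: fmap_comp.
Defined.

Record nat_trans (C D : category) (F G : functor C D) := NatTrans {
  ncomp :> forall X : C, hom (F X) (G X);
  naturality : forall (X Y : C) (f : hom X Y),
    ncomp Y \oc fmap F f === fmap G f \oc ncomp X }.

Definition nat_iso (C D : category) (F G : functor C D) : Prop :=
  exists (u : nat_trans F G) (v : nat_trans G F),
    (forall X : C, v X \oc u X === idc (F X)) /\
    (forall X : C, u X \oc v X === idc (G X)).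

Definition is_equivalence (C D : category) (F : functor C D) : Prop :=
  exists G : functor D C,
    nat_iso (functor_comp G F) (functor_id C) /\
    nat_iso (functor_comp F G) (functor_id D).

(* Gabriel-Zisman localization C[W^-1]: morphisms are formal composites of
   morphisms of C and formal inverses of elements of W, and [loc_heq] is the
   smallest congruence making [loc_fwd] a functor inverting W. *)
Section Localization.
Variables (C : category) (W : forall X Y : C, hom X Y -> Prop).

Inductive loc_hom : C -> C -> Type :=
| loc_id X : loc_hom X X
| loc_comp X Y Z : loc_hom Y Z -> loc_hom X Y -> loc_hom X Z
| loc_fwd X Y : hom X Y -> loc_hom X Y
| loc_inv X Y (w : hom X Y) : W w -> loc_hom Y X.

Inductive loc_heq : forall X Y, loc_hom X Y -> loc_hom X Y -> Prop :=
| lh_refl X Y (f : loc_hom X Y) : loc_heq f f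
| lh_sym X Y (f g : loc_hom X Y) : loc_heq f g -> loc_heq g f
| lh_trans X Y (f g h : loc_hom X Y) :
    loc_heq f g -> loc_heq g h -> loc_heq f h
| lh_comp X Y Z (g g' : loc_hom Y Z) (f f' : loc_hom X Y) :
    loc_heq g g' -> loc_heq f f' -> loc_heq (loc_comp g f) (loc_comp g' f')
| lh_id_l X Y (f : loc_hom X Y) : loc_heq (loc_comp (loc_id Y) f) f
| lh_id_r X Y (f : loc_hom X Y) : loc_heq (loc_comp f (loc_id X)) f
| lh_assoc X Y Z V (h : loc_hom Z V) (g : loc_hom Y Z) (f : loc_hom X Y) :
    loc_heq (loc_comp h (loc_comp g f)) (loc_comp (loc_comp h g) f)
| lh_fwd X Y (f g : hom X Y) : f === g -> loc_heq (loc_fwd f) (loc_fwd g)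
| lh_fwd_id X : loc_heq (loc_fwd (idc X)) (loc_id X)
| lh_fwd_comp X Y Z (g : hom Y Z) (f : hom X Y) :
    loc_heq (loc_fwd (g \oc f)) (loc_comp (loc_fwd g) (loc_fwd f))
| lh_inv_l X Y (w : hom X Y) (Ww : W w) :
    loc_heq (loc_comp (loc_inv Ww) (loc_fwd w)) (loc_id X)
| lh_inv_r X Y (w : hom X Y) (Ww : W w) :
    loc_heq (loc_comp (loc_fwd w) (loc_inv Ww)) (loc_id Y).

Definition localization : category :=
  @Category C loc_hom loc_heq loc_id loc_comp
    lh_refl lh_sym lh_trans lh_comp lh_id_l lh_id_r lh_assoc.

Definition loc_functor : functor C localization :=
  @Functor C localization (fun X => X) loc_fwd lh_fwd lh_fwd_id lh_fwd_comp.

End Localization.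

(* (LF, eps) is the total left derived functor of F with respect to the
   localization q: it is terminal among the pairs (G, eta : G q -> q F). *)
Definition is_left_derived (C D : category) (q : functor C D)
    (F : functor C C) (LF : functor D D)
    (eps : nat_trans (functor_comp LF q) (functor_comp q F)) : Prop :=
  forall (G : functor D D) (eta : nat_trans (functor_comp G q) (functor_comp q F)),
  exists theta : nat_trans G LF,
    (forall X : C, eps X \oc theta (q X) === eta X) /\
    (forall theta' : nat_trans G LF,
       (forall X : C, eps X \oc theta' (q X) === eta X) ->
       forall Y : D, theta' Y === theta Y).

Section Complexes.
Variable A : pzRingType.

(* Cochain complexes of finitely generated modules, bounded above. *)
Record complex := Complex {
  cobj :> int -> lmodType A;
  diff : forall n, {linear cobj n -> cobj (n + 1)};
  diff_diff : forall n x, diff (n + 1) (diff n x) = 0;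
  cobj_fg : forall n, finitely_generated (cobj n);
  cobj_bounded : exists N : int, forall n, (N < n)%R ->
    forall x : cobj n, x = 0 }.

Record chain_map (X Y : complex) := ChainMap {
  cmap :> forall n, {linear X n -> Y n};
  cmap_diff : forall n x, cmap (n + 1) (diff X n x) = diff Y n (cmap n x) }.

Definition chain_id (X : complex) : chain_map X X :=
  @ChainMap X X (fun n => idfun) (fun n x => erefl).

Definition chain_comp (X Y Z : complex) (g : chain_map Y Z) (f : chain_map X Y)
  : chain_map X Z.
Proof.
apply: (@ChainMap X Z (fun n => (g n \o f n)%FUN)) => n x /=.
by rewrite !cmap_diff.
Defined.

Definition complexes : category.
Proof.
apply: (@Category complex chain_map
  (fun X Y f g => forall n, f n =1 g n) chain_id chain_comp) => //.
- by move=> X Y f g e n x; rewrite e.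
- by move=> X Y f g h e1 e2 n x; rewrite e1 e2.
- by move=> X Y Z g g' f f' eg ef n x /=; rewrite ef eg.
Defined.

(* For every n, the map H^{n+1}(f) is injective (first clause) and surjective
   (second clause). *)
Definition quasi_iso (X Y : complexes) (f : hom X Y) : Prop :=
  forall n : int,
    (forall x : X (n + 1), diff X (n + 1) x = 0 ->
       (exists y, diff Y n y = (f : chain_map X Y) (n + 1) x) ->
       exists x', diff X n x' = x) /\
    (forall y : Y (n + 1), diff Y (n + 1) y = 0 ->
       exists x, diff X (n + 1) x = 0 /\
       exists y', y - (f : chain_map X Y) (n + 1) x = diff Y n y').

(* D^-(mod A) *)
Definition derived_cat : category := localization quasi_iso.

Section TensorComplex.
Variables (B : bimodule A) (Bfg : finitely_generated B).

Definition tensor_complex (X : complex) : complex.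
Proof.
apply: (@Complex (fun n => tensor B (X n) : lmodType A)
  (fun n => tensor_map (diff X n)
     : {linear tensor B (X n) -> tensor B (X (n + 1))})).
- move=> n x; change (tensor_map (diff X (n + 1)) (tensor_map (diff X n) x) = 0).
  rewrite -(formal_repr x) !tensor_mapE formal_sum -map_comp.
  by rewrite big_map big1 // => p _ /=; rewrite diff_diff pure0r.
- by move=> n; exact: tensor_finitely_generated (cobj_fg X n).
- have [N hN] := cobj_bounded X; exists N => n /hN h x.
  rewrite -(formal_repr x) formal_sum big1 // => p _.
  by rewrite (h p.2) pure0r.
Defined.

Definition tensor_chain_map (X Y : complex) (f : chain_map X Y) :
  chain_map (tensor_complex X) (tensor_complex Y).
Proof.
apply: (@ChainMap (tensor_complex X) (tensor_complex Y)
  (fun n => tensor_map (f n) : {linear tensor B (X n) -> tensor B (Y n)}))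
  => n x.
change (tensor_map (f (n + 1)) (tensor_map (diff X n) x) =
        tensor_map (diff Y n) (tensor_map (f n) x)).
rewrite -(formal_repr x) !tensor_mapE -!map_comp; congr formal.
by apply: eq_map => p /=; rewrite cmap_diff.
Defined.

Definition tensor_functor : functor complexes complexes.
Proof.
apply: (@Functor complexes complexes tensor_complex tensor_chain_map).
- move=> X Y f g e n x.
  change (tensor_map ((f : chain_map X Y) n) x =
          tensor_map ((g : chain_map X Y) n) x).
  rewrite -(formal_repr x) !tensor_mapE.
  by congr formal; apply: eq_map => p /=; rewrite e.
- move=> X n x.
  change (tensor_map (chain_id X n) x = x); rewrite -[RHS](formal_repr x) -{1}(formal_repr x).
  by rewrite tensor_mapE; congr formal; apply: map_id_in => -[].
- move=> X Y Z g f n x.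
  change (tensor_map (chain_comp g f n) x =
    tensor_map ((g : chain_map Y Z) n) (tensor_map ((f : chain_map X Y) n) x)).
  rewrite -(formal_repr x) !tensor_mapE.
  by congr formal; rewrite -map_comp; apply: eq_map.
Defined.

(* LF is B (x)^L_A - on D^-(mod A). *)
Definition derived_tensor (LF : functor derived_cat derived_cat) : Prop :=
  exists eps, @is_left_derived _ _ (loc_functor quasi_iso) tensor_functor LF eps.

End TensorComplex.
End Complexes.

Section GentleData.
Variables (k : fieldType) (Q : gentle_order_quiver).
Local Notation L := (completed_alg k Q).

Definition forbidden_thread (w : seq (Q1 Q)) : bool :=
  if w is b :: w' then
    [&& uniq w, path (fun a b => zrel b a) b w', ~~ zrel b (last b w'),
        [forall a, ~~ zrel b a] & [forall a, ~~ zrel a (last b w')]]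
  else false.

Definition thread_from (j : Q0 Q) (w : seq (Q1 Q)) : bool :=
  forbidden_thread w && (if w is b :: _ then src b == j else false).

(* There is a forbidden thread starting at j, and it is unique, when j is a
   transition vertex; only then is the value relevant. *)
Definition kappa (j : Q0 Q) : Q0 Q :=
  if pselect (exists w, thread_from j w) is left h
  then path_end j (sval (cid h)) else j.

Definition kappa_orbit (X : {set Q0 Q}) : Prop :=
  exists2 j, j \in transition Q & X = [set i in orbit kappa j].

Definition ideal_gens (X : {set Q0 Q}) (x : L) : Prop :=
  (exists2 i, i \notin X & x = idem k i) \/
  (exists2 a, src a \in X & x = arrow k a).

Definition gentle_ideal (X : {set Q0 Q}) : bimodule L :=
  ideal_bimodule (ideal_gens X).

(* The sign attached to the arrow a is (-1) ^+ sgn a. *)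
Definition is_xi (xi : {rmorphism L -> L}) : Prop :=
  [/\ bijective xi, (forall (c : k) (f : L), xi (c *: f) = c *: xi f),
      (forall i, xi (idem k i) = idem k i) &
      if 2%N \in [pchar k] then forall a, xi (arrow k a) = arrow k a
      else exists sgn : Q1 Q -> bool,
        (forall a b, a != b -> src a = src b -> sgn a != sgn b) /\
        (forall a, xi (arrow k a) =
           ((-1) ^+ sgn (sigma a) * (-1) ^+ sgn a : k) *: arrow k a)].

End GentleData.

(* T_{b-1} o ... o T_0 *)
Definition composite (C : category) (b : nat) (T : 'I_b -> functor C C) :
  functor C C :=
  foldr (fun a G => functor_comp G (T a)) (functor_id C) (enum 'I_b).

(* Main.v *)
(** The ideal I(X) consists of the elements whose constant terms vanish at X.  On modules
    that are exact along the forbidden threads joining vertices of X, tensoring with I(X)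
    is exact and Hom(I(X), -) is inverse to it; and I(X) (x) I(Y) (x) M is I(X u Y) (x) M
    when X and Y are disjoint unions of kappa-orbits.  Every module is a quotient of the
    thread-exact module Hom_R(I(Q_0^t), M) and embeds into Hom_R(Lambda, M), which is exact
    in the dual sense.  Passing to kernels (cokernels) gains one step along the threads, and
    the threads have bounded length, so each bounded above complex has a functorial
    resolution of this kind on either side, which computes the derived functors.  Hence the
    T_X are equivalences with T_X T_Y = T_(X u Y), and they commute.  Finally the sign-twisted
    sum of the coefficients of the permitted cycles is a trace that identifies omega with the
    xi-twist of I(Q_0^t), the ideal of the union of all orbits. *)
From HB Require Import structures.
From mathcomp Require Import all_boot all_order all_algebra.
From mathcomp Require Import boolp zify ring.
Require Import Defs.

Set Implicit Arguments.
Unset Strict Implicit.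
Unset Printing Implicit Defensive.

Import Order.TTheory GRing.Theory Num.Theory.
Local Open Scope ring_scope.

Local Notation "f === g" := (heq f g) (at level 70).
Local Notation "g \oc f" := (Defs.comp g f) (at level 50, format "g  \oc  f").

(** * Localizations and total left derived functors *)

Section NatIso.

(** Derived functors live on a formal localization, so a resolution must be a functor of the complex
    and keep its terms finitely generated: free covers on chosen generators are not functorial, free
    covers on all elements are not finitely generated. The functors Hom_R(B, -), with B finitely
    generated over the power series ring R, meet both demands. Their values need not be projective;
    exactness along threads suffices because of the shape of the tensor product: outside X, I(X) (x)
    M agrees with M, and at a vertex of X that is the end of an arrow c it is M at the start of c
    modulo the image of the arrow before c. Dually, Hom(I(X), N) at a vertex of X is a kernel.
    Forbidden cycles, which can make the homological dimension infinite, are never met, so one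
    length of resolution serves all complexes; this keeps the right resolutions bounded above. The
    map Hom_R(I, M) -> M for I = I(Q_0^t) is the canonical element of the duality between I and
    Lambda given by the trace, so the identification of omega already enters the construction of the
    resolutions. *)

Lemma comp_congl (C : category) (X Y Z : C) (g g' : hom Y Z) (f : hom X Y) :
  g === g' -> g \oc f === g' \oc f.
Proof. by move=> e; apply: comp_heq => //; exact: heq_refl. Qed.

Lemma comp_congr (C : category) (X Y Z : C) (g : hom Y Z) (f f' : hom X Y) :
  f === f' -> g \oc f === g \oc f'.
Proof. by move=> e; apply: comp_heq => //; exact: heq_refl. Qed.

Lemma comp_cancel (C : category) (X Y Z V : C)
    (h : hom Y V) (v : hom Z Y) (u : hom Y Z) (f : hom X Y) :
  v \oc u === idc Y -> (h \oc v) \oc (u \oc f) === h \oc f.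
Proof.
move=> e; apply: heq_trans (heq_sym (comp_assoc _ _ _)) _; apply: comp_congr.
apply: heq_trans (comp_assoc _ _ _) _.
by apply: heq_trans (comp_congl _ e) _; exact: comp_id_l.
Qed.

Definition nat_comp (C D : category) (F G H : functor C D)
  (v : nat_trans G H) (u : nat_trans F G) : nat_trans F H.
Proof.
exists (fun X => v X \oc u X) => X Y f /=.
apply: heq_trans (heq_sym (comp_assoc _ _ _)) _.
apply: heq_trans (comp_congr _ (naturality u f)) _.
apply: heq_trans (comp_assoc _ _ _) _.
apply: heq_trans (comp_congl _ (naturality v f)) _.
exact: heq_sym (comp_assoc _ _ _).
Defined.

Definition nat_id (C D : category) (F : functor C D) : nat_trans F F.
Proof.
exists (fun X => idc (F X)) => X Y f /=.
by apply: heq_trans (comp_id_l _) (heq_sym (comp_id_r _)).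
Defined.

Definition nat_whisk_l (C D E : category) (H : functor D E) (F G : functor C D)
  (u : nat_trans F G) : nat_trans (functor_comp H F) (functor_comp H G).
Proof.
exists (fun X => fmap H (u X)) => X Y f /=.
apply: heq_trans (heq_sym (fmap_comp _ _ _)) _.
apply: heq_trans (fmap_heq H (naturality u f)) _.
exact: fmap_comp.
Defined.

Definition nat_whisk_r (C D E : category) (F G : functor D E) (H : functor C D)
  (u : nat_trans F G) : nat_trans (functor_comp F H) (functor_comp G H).
Proof. by exists (fun X => u (H X)) => X Y f; exact: (naturality u (fmap H f)). Defined.

Lemma nat_iso_refl (C D : category) (F : functor C D) : nat_iso F F.
Proof. by exists (nat_id F), (nat_id F); split=> X; exact: comp_id_l. Qed.

Lemma nat_iso_sym (C D : category) (F G : functor C D) :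
  nat_iso F G -> nat_iso G F.
Proof. by case=> u [v [h1 h2]]; exists v, u. Qed.

Lemma nat_iso_trans (C D : category) (F G H : functor C D) :
  nat_iso F G -> nat_iso G H -> nat_iso F H.
Proof.
case=> u [v [h1 h2]] [u' [v' [h1' h2']]].
exists (nat_comp u' u), (nat_comp v v'); split=> X /=.
  by apply: heq_trans (comp_cancel _ _ (h1' X)) (h1 X).
by apply: heq_trans (comp_cancel _ _ (h2 X)) (h2' X).
Qed.

Lemma nat_iso_whisk_l (C D E : category) (H : functor D E) (F G : functor C D) :
  nat_iso F G -> nat_iso (functor_comp H F) (functor_comp H G).
Proof.
case=> u [v [h1 h2]]; exists (nat_whisk_l H u), (nat_whisk_l H v).
split=> X /=; apply: heq_trans (heq_sym (fmap_comp _ _ _)) _;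
  by apply: heq_trans (fmap_heq H _) (fmap_id H _).
Qed.

Lemma nat_iso_whisk_r (C D E : category) (F G : functor D E) (H : functor C D) :
  nat_iso F G -> nat_iso (functor_comp F H) (functor_comp G H).
Proof.
by case=> u [v [h1 h2]]; exists (nat_whisk_r H u), (nat_whisk_r H v); split=> X /=.
Qed.

Lemma nat_iso_comp (C D E : category) (G G' : functor D E) (F F' : functor C D) :
  nat_iso G G' -> nat_iso F F' -> nat_iso (functor_comp G F) (functor_comp G' F').
Proof.
move=> hG hF; apply: nat_iso_trans (nat_iso_whisk_r F hG) _.
exact: nat_iso_whisk_l.
Qed.

(** Naturality of [b] follows from that of [a] by composing its square with the inverses, so only
    one square ever has to be checked. *)
Lemma nat_iso_id_comps (C D : category) (F G : functor C D)
    (a : forall X, hom (F X) (G X)) (b : forall X, hom (G X) (F X)) :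
  (forall X Y (f : hom X Y), a Y \oc fmap F f === fmap G f \oc a X) ->
  (forall X, b X \oc a X === idc _) -> (forall X, a X \oc b X === idc _) ->
  nat_iso F G.
Proof.
move=> nat ba ab.
have nat' X Y (f : hom X Y) : b Y \oc fmap G f === fmap F f \oc b X.
  apply: heq_trans (comp_congr _ (heq_sym (comp_id_r _))) _.
  apply: heq_trans (comp_congr _ (comp_congr _ (heq_sym (ab X)))) _.
  apply: heq_trans (comp_congr _ (comp_assoc _ _ _)) _.
  apply: heq_trans (comp_congr _ (comp_congl _ (heq_sym (nat _ _ f)))) _.
  apply: heq_trans (comp_assoc _ _ _) _; apply: comp_congl.
  apply: heq_trans (comp_assoc _ _ _) _.
  by apply: heq_trans (comp_congl _ (ba Y)) (comp_id_l _).
by exists (NatTrans nat), (NatTrans nat').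
Qed.

Lemma functor_compA (C D E B : category) (H : functor E B) (G : functor D E)
    (F : functor C D) :
  nat_iso (functor_comp H (functor_comp G F)) (functor_comp (functor_comp H G) F).
Proof.
apply: (@nat_iso_id_comps _ _ (functor_comp H (functor_comp G F))
  (functor_comp (functor_comp H G) F) (fun X => idc _) (fun X => idc _)).
- by move=> X Y f; apply: heq_trans (comp_id_l _) (heq_sym (comp_id_r _)).
- by move=> X; exact: comp_id_l.
- by move=> X; exact: comp_id_l.
Qed.

Lemma functor_comp1 (C D : category) (F : functor C D) :
  nat_iso (functor_comp F (functor_id C)) F.
Proof.
apply: (@nat_iso_id_comps _ _ (functor_comp F (functor_id C)) F
  (fun X => idc _) (fun X => idc _)).
- by move=> X Y f; apply: heq_trans (comp_id_l _) (heq_sym (comp_id_r _)).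
- by move=> X; exact: comp_id_l.
- by move=> X; exact: comp_id_l.
Qed.

Lemma is_equivalence_iso (C D : category) (F F' : functor C D) :
  nat_iso F F' -> is_equivalence F -> is_equivalence F'.
Proof.
move=> e [G [h1 h2]]; exists G; split.
  exact: nat_iso_trans (nat_iso_whisk_l G (nat_iso_sym e)) h1.
exact: nat_iso_trans (nat_iso_whisk_r G (nat_iso_sym e)) h2.
Qed.

Lemma is_equivalence_comp (C D E : category) (F : functor D E) (G : functor C D) :
  is_equivalence F -> is_equivalence G -> is_equivalence (functor_comp F G).
Proof.
have half (C' D' E' : category) (F1 : functor D' E') (G1 : functor C' D')
    (F2 : functor E' D') (G2 : functor D' C') :
    nat_iso (functor_comp F2 F1) (functor_id _) ->
    nat_iso (functor_comp G2 G1) (functor_id _) ->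
    nat_iso (functor_comp (functor_comp G2 F2) (functor_comp F1 G1)) (functor_id _).
  move=> hF hG; apply: nat_iso_trans (functor_compA _ _ _) _.
  apply: nat_iso_trans hG; apply: nat_iso_whisk_r.
  apply: nat_iso_trans (nat_iso_sym (functor_compA _ _ _)) _.
  exact: nat_iso_trans (nat_iso_whisk_l G2 hF) (functor_comp1 _).
move=> [F' [f1 f2]] [G' [g1 g2]]; exists (functor_comp G' F').
by split; apply: half.
Qed.

End NatIso.

Section LocalizationFunctors.
Variables (C : category) (W : forall X Y : C, hom X Y -> Prop).
Let D := localization W.

Definition preserves_w (F : functor C C) : Prop :=
  forall X Y (f : hom X Y), W f -> W (fmap F f).

Section Lift.
Variables (F : functor C C) (hF : preserves_w F).

Fixpoint loc_map (X Y : C) (f : loc_hom W X Y) : loc_hom W (F X) (F Y) :=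
  match f in loc_hom _ X' Y' return loc_hom W (F X') (F Y') with
  | loc_id X => loc_id W (F X)
  | loc_comp X Y Z g f => loc_comp (loc_map g) (loc_map f)
  | loc_fwd X Y f => loc_fwd W (fmap F f)
  | loc_inv X Y w Ww => loc_inv (hF Ww)
  end.

Definition loc_lift : functor D D.
Proof.
apply: (@Functor D D (F : C -> C) loc_map) => [X Y f g||]; last 2 first.
- by move=> X; exact: lh_refl.
- by move=> X Y Z g f; exact: lh_refl.
rewrite /=; elim=> {X Y f g} /=.
- by move=> *; exact: lh_refl.
- by move=> *; exact: lh_sym.
- by move=> X Y f g h _ h1 _ h2; exact: lh_trans h1 h2.
- by move=> *; exact: lh_comp.
- by move=> *; exact: lh_id_l.
- by move=> *; exact: lh_id_r.
- by move=> *; exact: lh_assoc.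
- by move=> X Y f g e; apply: lh_fwd; exact: fmap_heq.
- by move=> X; apply: lh_trans (lh_fwd W (fmap_id F X)) (lh_fwd_id W _).
- by move=> X Y Z g f; apply: lh_trans (lh_fwd W (fmap_comp F g f)) (lh_fwd_comp W _ _).
- by move=> *; exact: lh_inv_l.
- by move=> *; exact: lh_inv_r.
Defined.

End Lift.

(* Morphisms of the localization are generated by those of C and their inverses. *)
Lemma loc_natural (E : category) (F G : functor D E) (a : forall X : D, hom (F X) (G X)) :
  (forall (X Y : C) (f : hom X Y),
     a Y \oc fmap F (loc_fwd W f : @hom D X Y) === fmap G (loc_fwd W f : @hom D X Y) \oc a X) ->
  forall (X Y : D) (f : hom X Y), a Y \oc fmap F f === fmap G f \oc a X.
Proof.
move=> nat X Y; elim=> {X Y}.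
- move=> X; apply: heq_trans (comp_congr _ (fmap_id F X)) _.
  apply: heq_trans (comp_id_r _) _; apply: heq_sym.
  by apply: heq_trans (comp_congl _ (fmap_id G X)) (comp_id_l _).
- move=> X Y Z g hg f hf.
  apply: heq_trans (comp_congr _ (fmap_comp F (g : @hom D _ _) (f : @hom D _ _))) _.
  apply: heq_trans (comp_assoc _ _ _) _.
  apply: heq_trans (comp_congl _ hg) _.
  apply: heq_trans (heq_sym (comp_assoc _ _ _)) _.
  apply: heq_trans (comp_congr _ hf) _.
  apply: heq_trans (comp_assoc _ _ _) _; apply: comp_congl.
  exact: heq_sym (fmap_comp G (g : @hom D _ _) (f : @hom D _ _)).
- exact: nat.
move=> X Y w Ww.
pose i : @hom D Y X := loc_inv Ww; pose f : @hom D X Y := loc_fwd W w.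
change (a X \oc fmap F i === fmap G i \oc a Y).
have Fe : fmap F f \oc fmap F i === idc _.
  apply: heq_trans (heq_sym (fmap_comp F f i)) _.
  by apply: heq_trans (fmap_heq F (lh_inv_r Ww)) (fmap_id F _).
have Ge : fmap G i \oc fmap G f === idc _.
  apply: heq_trans (heq_sym (fmap_comp G i f)) _.
  by apply: heq_trans (fmap_heq G (lh_inv_l Ww)) (fmap_id G _).
apply: heq_trans (comp_congl _ (heq_sym (comp_id_l _))) _.
apply: heq_trans (comp_congl _ (comp_congl _ (heq_sym Ge))) _.
apply: heq_trans (comp_congl _ (heq_sym (comp_assoc _ _ _))) _.
apply: heq_trans (comp_congl _ (comp_congr _ (heq_sym (nat _ _ w)))) _.
apply: heq_trans (heq_sym (comp_assoc _ _ _)) _; apply: comp_congr.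
apply: heq_trans (heq_sym (comp_assoc _ _ _)) _.
by apply: heq_trans (comp_congr _ Fe) (comp_id_r _).
Qed.

(** No inverse of [u] is needed in [C] itself. The comparisons of derived functors below are zigzags
    of such transformations. *)
Lemma loc_lift_iso (F G : functor C C) (hF : preserves_w F) (hG : preserves_w G)
    (u : nat_trans F G) :
  (forall X, W (u X)) -> nat_iso (loc_lift hF) (loc_lift hG).
Proof.
move=> Wu.
apply: (@nat_iso_id_comps D D (loc_lift hF) (loc_lift hG)
  (fun X => loc_fwd W (u X)) (fun X => loc_inv (Wu X))).
- apply: loc_natural => X Y f /=.
  apply: lh_trans (lh_sym (lh_fwd_comp W _ _)) _.
  by apply: lh_trans (lh_fwd W (naturality u f)) (lh_fwd_comp W _ _).
- by move=> X; exact: lh_inv_l.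
- by move=> X; exact: lh_inv_r.
Qed.

Lemma loc_lift_comp (F G : functor C C) (hF : preserves_w F) (hG : preserves_w G)
    (hGF : preserves_w (functor_comp G F)) :
  nat_iso (functor_comp (loc_lift hG) (loc_lift hF)) (loc_lift hGF).
Proof.
apply: (@nat_iso_id_comps D D (functor_comp (loc_lift hG) (loc_lift hF)) (loc_lift hGF)
  (fun X => loc_id W _) (fun X => loc_id W _)).
- apply: loc_natural => X Y f /=.
  exact: lh_trans (lh_id_l _) (lh_sym (lh_id_r _)).
- by move=> X; exact: lh_id_l.
- by move=> X; exact: lh_id_l.
Qed.

Lemma loc_lift_id (h1 : preserves_w (functor_id C)) :
  nat_iso (loc_lift h1) (functor_id D).
Proof.
apply: (@nat_iso_id_comps D D (loc_lift h1) (functor_id D)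
  (fun X => loc_id W _) (fun X => loc_id W _)).
- apply: loc_natural => X Y f /=.
  exact: lh_trans (lh_id_l _) (lh_sym (lh_id_r _)).
- by move=> X; exact: lh_id_l.
- by move=> X; exact: lh_id_l.
Qed.

(** A composite of the two comparison maps and the identity are both compatible with [eps], so the
    uniqueness clause identifies them. This carries results from explicit models over to arbitrary
    derived functors. *)
Lemma left_derived_unique (F : functor C C) (L1 L2 : functor D D) eps1 eps2 :
  @is_left_derived C D (loc_functor W) F L1 eps1 ->
  @is_left_derived C D (loc_functor W) F L2 eps2 -> nat_iso L1 L2.
Proof.
move=> d1 d2.
have [t12 [e12 _]] := d2 L1 eps1; have [t21 [e21 _]] := d1 L2 eps2.
have half (L L' : functor D D) eps eps' (t : nat_trans L L') (t' : nat_trans L' L) :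
    @is_left_derived C D (loc_functor W) F L eps ->
    (forall X : C, eps' X \oc t (loc_functor W X) === eps X) ->
    (forall X : C, eps X \oc t' (loc_functor W X) === eps' X) ->
    forall Y, t' Y \oc t Y === idc _.
  move=> d e e' Y; have [i [_ iu]] := d L eps.
  have h1 := iu (nat_comp t' t) _ Y; have h2 := iu (nat_id L) _ Y.
  apply: heq_trans (h1 _) (heq_sym (h2 _)) => X.
    apply: (heq_trans (comp_assoc (eps X) (t' X) (t X))).
    exact: heq_trans (comp_congl _ (e' X)) (e X).
  exact: (comp_id_r (eps X)).
exists t12, t21; split=> Y.
  exact: (half _ _ _ _ _ _ d1 e12 e21).
exact: (half _ _ _ _ _ _ d2 e21 e12).
Qed.

(** [F] need not preserve [W]. It is enough that [F r] does, and that [F] sends [p] into [W] at the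
    resolved objects [r X]; the second condition is what gives uniqueness in the universal
    property. *)
Lemma left_derived_of_resolution (F r : functor C C) (p : nat_trans r (functor_id C))
    (hFr : preserves_w (functor_comp F r)) :
  (forall X, W (p X)) -> (forall X, W (fmap F (p (r X)))) ->
  exists eps, @is_left_derived C D (loc_functor W) F (loc_lift hFr) eps.
Proof.
move=> Wp WFp.
have enat (X Y : C) (f : hom X Y) :
  @heq D _ _ (@Defs.comp D _ _ _ (loc_fwd W (fmap F (p Y))) (loc_fwd W (fmap F (fmap r f))))
    (@Defs.comp D _ _ _ (loc_fwd W (fmap F f)) (loc_fwd W (fmap F (p X)))).
  apply: lh_trans (lh_sym (lh_fwd_comp W _ _)) _.
  apply: lh_trans (lh_trans (lh_fwd W _) (lh_fwd_comp W _ _)) (lh_refl _).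
  apply: heq_trans (heq_sym (fmap_comp F _ _)) _.
  apply: heq_trans (fmap_heq F (naturality p f)) _.
  exact: fmap_comp.
exists (@NatTrans C D (functor_comp (loc_lift hFr) (loc_functor W))
  (functor_comp (loc_functor W) F) (fun X => loc_fwd W (fmap F (p X))) enat).
move=> G eta.
pose P X : @hom D (r X) X := loc_fwd W (p X).
pose I X : @hom D X (r X) := loc_inv (Wp X).
(* As [p X] is invertible in the localization, [eta] can be taken at the resolved object and
   composed with the inverse of [p X]. *)
pose th X : @hom D (G X) (F (r X)) := (eta (r X) : @hom D _ _) \oc fmap G (I X).
have GPI X : fmap G (P X) \oc fmap G (I X) === idc _.
  apply: heq_trans (heq_sym (fmap_comp G _ _)) _.
  by apply: heq_trans (fmap_heq G (lh_inv_r (Wp X))) (fmap_id G _).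
pose q (X Y : C) (f : @hom C X Y) : @hom D X Y := loc_fwd W f.
have In (X Y : C) (f : @hom C X Y) : I Y \oc q _ _ f === q _ _ (fmap r f) \oc I X.
  apply: heq_trans (comp_congr _ (heq_sym (comp_id_r _))) _.
  apply: heq_trans (comp_congr _ (comp_congr _ (heq_sym (lh_inv_r (Wp X) : @heq D _ _ _ _)))) _.
  apply: heq_trans (comp_congr _ (comp_assoc _ _ _)) _.
  apply: heq_trans (comp_assoc _ _ _) _; apply: comp_congl.
  apply: heq_trans (comp_congr _ (lh_sym (lh_fwd_comp W f (p X)) : @heq D _ _ _ _)) _.
  apply: heq_trans (comp_congr _ (lh_fwd W (heq_sym (naturality p f)) : @heq D _ _ _ _)) _.
  apply: heq_trans (comp_congr _ (lh_fwd_comp W (p Y) (fmap r f) : @heq D _ _ _ _)) _.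
  apply: heq_trans (comp_assoc _ _ _) _.
  by apply: heq_trans (comp_congl _ (lh_inv_l (Wp Y) : @heq D _ _ _ _)) (comp_id_l _).
have thn (X Y : D) (f : hom X Y) :
    th Y \oc fmap G f === fmap (loc_lift hFr) f \oc th X.
  move: X Y f; apply: (@loc_natural D G (loc_lift hFr) th) => X Y f.
  apply: heq_trans (heq_sym (comp_assoc _ _ _)) _.
  apply: heq_trans (comp_congr _ (heq_sym (fmap_comp G _ _))) _.
  apply: heq_trans (comp_congr _ (fmap_heq G (In _ _ f))) _.
  apply: heq_trans (comp_congr _ (fmap_comp G _ _)) _.
  apply: heq_trans (comp_assoc _ _ _) _.
  apply: heq_trans (comp_congl _ (naturality eta (fmap r f))) _.
  exact: heq_sym (comp_assoc _ _ _).
have eth X : @heq D _ _ (@Defs.comp D _ _ _ (loc_fwd W (fmap F (p X))) (th X)) (eta X).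
  apply: heq_trans (comp_assoc _ _ _) _.
  apply: heq_trans (comp_congl _ (heq_sym (naturality eta (p X)))) _.
  apply: heq_trans (heq_sym (comp_assoc _ _ _)) _.
  by apply: heq_trans (comp_congr _ (GPI X)) (comp_id_r _).
exists (@NatTrans D D G (loc_lift hFr) th thn); split=> [X|th' e' X] /=.
  exact: eth.
(* At resolved objects [F (p (r X))] is invertible, which forces the component; naturality along
   [P X] then forces it at every [X]. *)
have er : th' (r X) === th (r X).
  have E : @heq D _ _ (@Defs.comp D _ _ _ (loc_fwd W (fmap F (p (r X)))) (th' (r X)))
             (@Defs.comp D _ _ _ (loc_fwd W (fmap F (p (r X)))) (th (r X))).
    apply: (@heq_trans D _ _ _ (eta (r X))); first exact: (e' (r X)).
    exact: heq_sym (eth _).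
  have cancel Y (g : @hom D Y (F (r (r X)))) :
    g === @Defs.comp D _ _ _ (loc_inv (WFp X))
            (@Defs.comp D _ _ _ (loc_fwd W (fmap F (p (r X)))) g).
    apply: heq_sym; apply: heq_trans (comp_assoc _ _ _) _.
    by apply: heq_trans (comp_congl _ (lh_inv_l _ : @heq D _ _ _ _)) (comp_id_l _).
  apply: heq_trans (cancel _ _) _; apply: heq_trans (comp_congr _ E) _.
  exact: heq_sym (cancel _ _).
have cancel (g : @hom D (G X) (F (r X))) : g === (g \oc fmap G (P X)) \oc fmap G (I X).
  apply: heq_sym; apply: heq_trans (heq_sym (comp_assoc _ _ _)) _.
  by apply: heq_trans (comp_congr _ (GPI X)) (comp_id_r _).
apply: heq_trans (cancel _) _; apply: heq_trans _ (heq_sym (cancel _)).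
apply: comp_congl; apply: heq_trans (naturality th' (P X)) _.
apply: heq_trans _ (heq_sym (thn _ _ (P X))).
exact: comp_congr.
Qed.

End LocalizationFunctors.

(** * Complexes and functorial resolutions *)

Definition mklin (A : pzRingType) (M N : lmodType A) (f : M -> N) (h : linear f) :
  {linear M -> N} := HB.pack f (GRing.isLinear.Build A M N *:%R f h).

Section QuasiIso.
Variable A : pzRingType.
Implicit Types X Y Z : complex A.

Lemma quasi_iso_comp X Y Z (g : chain_map Y Z) (f : chain_map X Y) :
  quasi_iso (g : @hom (complexes A) _ _) -> quasi_iso (f : @hom (complexes A) _ _) ->
  quasi_iso (chain_comp g f : @hom (complexes A) _ _).
Proof.
move=> hg hf n; have [ig sg] := hg n; have [if' sf] := hf n; split=> [x dx [z ez]|z dz].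
  apply: if' => //.
  have [|y ey] := ig (f _ x) _ (ex_intro _ z ez); last by exists y.
  by rewrite -cmap_diff dx linear0.
have [y [dy [z' ez]]] := sg z dz; have [x [dx [y' ey]]] := sf y dy.
exists x; split=> //; exists (z' + g _ y'); rewrite linearD -ez -cmap_diff -ey.
by rewrite linearB /= addrA subrK.
Qed.

Lemma quasi_iso_cancel_l X Y Z (g : chain_map Y Z) (f : chain_map X Y) :
  quasi_iso (g : @hom (complexes A) _ _) ->
  quasi_iso (chain_comp g f : @hom (complexes A) _ _) ->
  quasi_iso (f : @hom (complexes A) _ _).
Proof.
move=> hg hf n; have [ig sg] := hg n; have [igf sgf] := hf n; split=> [x dx [y ey]|y dy].
  by apply: igf => //; exists (g _ y); rewrite -cmap_diff ey.
have [|x [dx [z ez]]] := sgf (g _ y); first by rewrite -cmap_diff dy linear0.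
exists x; split=> //.
have [||y' ey] := ig (y - f _ x); last by exists y'.
  by rewrite linearB dy -cmap_diff dx linear0 subr0.
by exists z; rewrite -ez linearB.
Qed.

Lemma quasi_iso_cancel_r X Y Z (g : chain_map Y Z) (f : chain_map X Y) :
  quasi_iso (f : @hom (complexes A) _ _) ->
  quasi_iso (chain_comp g f : @hom (complexes A) _ _) ->
  quasi_iso (g : @hom (complexes A) _ _).
Proof.
move=> hf hgf n; have [if' sf] := hf n; have [igf sgf] := hgf n; split=> [y dy [z ez]|z dz].
  have [x [dx [y' ey]]] := sf y dy.
  have [|x' ex] := igf x dx.
    by exists (z - g _ y'); rewrite linearB ez -cmap_diff -ey linearB subKr.
  by exists (f _ x' + y'); rewrite linearD -cmap_diff ex -ey subrKC.
have [x [dx [z' ez]]] := sgf z dz.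
by exists (f _ x); split; [rewrite -cmap_diff dx linear0|exists z'].
Qed.

Lemma quasi_iso_bij X Y (f : chain_map X Y) :
  (forall n (x : X n), f n x = 0 -> x = 0) -> (forall n (y : Y n), exists x, f n x = y) ->
  quasi_iso (f : @hom (complexes A) _ _).
Proof.
move=> i s n; split=> [x dx [y ey]|y dy].
  have [x' ex] := s _ y; exists x'; apply/eqP; rewrite -subr_eq0; apply/eqP.
  by apply: (i); rewrite linearB cmap_diff ex ey subrr.
have [x ex] := s _ y; exists x; split.
  by apply: (i); rewrite cmap_diff ex.
by exists 0; rewrite ex subrr linear0.
Qed.

Lemma quasi_iso_heq X Y (f g : chain_map X Y) : (forall n, f n =1 g n) ->
  quasi_iso (f : @hom (complexes A) _ _) -> quasi_iso (g : @hom (complexes A) _ _).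
Proof.
move=> e h n; have [hi hs] := h n; split=> [x dx [y ey]|y dy].
  by apply: hi => //; exists y; rewrite ey e.
have [x [dx [y' ey]]] := hs y dy; exists x; split=> //; exists y'.
by rewrite -e.
Qed.

Definition acyclic X := forall n (x : X (n + 1)),
  diff X (n + 1) x = 0 -> exists y, diff X n y = x.

Section Cone.
Variables (X Y : complex A) (f : chain_map X Y).

Definition cone_diff n (p : prod (X (n + 1)) (Y n)) : prod (X (n + 1 + 1)) (Y (n + 1)) :=
  (- diff X _ p.1, f _ p.1 + diff Y _ p.2).

Lemma cone_diff_linear n : linear (@cone_diff n).
Proof.
move=> a [x y] [x' y']; rewrite /cone_diff /=; congr pair => /=.
  by rewrite linearP opprD scalerN.
by rewrite !linearP scalerDr addrACA.
Qed.

Lemma fg_prod (M N : lmodType A) : finitely_generated M -> finitely_generated N ->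
  finitely_generated (M * N)%type.
Proof.
move=> [p [u hu]] [q [v hv]].
exists (p + q)%N, (fun i => match split i with inl j => (u j, 0) | inr j => (0, v j) end).
move=> [x y]; have [c ->] := hu x; have [d ->] := hv y.
exists (fun i => match split i with inl j => c j | inr j => d j end).
rewrite big_split_ord (eq_bigr (fun i => (c i *: u i, 0 : N))) /=; last first.
  by move=> i _; rewrite -[lshift _ _]/(unsplit (inl i)) unsplitK; congr pair; rewrite scaler0.
rewrite [X in _ = _ + X](eq_bigr (fun i => (0 : M, d i *: v i))) /=; last first.
  by move=> i _; rewrite -[rshift _ _]/(unsplit (inr i)) unsplitK; congr pair; rewrite scaler0.
have E1 r (F : 'I_r -> (M * N)%type) : (\sum_i F i).1 = \sum_i (F i).1 by exact: big_morph.
have E2 r (F : 'I_r -> (M * N)%type) : (\sum_i F i).2 = \sum_i (F i).2 by exact: big_morph.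
apply: injective_projections; rewrite /= ?E1 ?E2 /= ?big1_eq ?addr0 ?add0r //.
Qed.

Definition cone : complex A.
Proof.
apply: (@Complex A (fun n => prod (X (n + 1)) (Y n) : lmodType A)
  (fun n => mklin (@cone_diff_linear n))).
- move=> n [x y]; rewrite /= /cone_diff /=.
  congr pair; first by rewrite linearN diff_diff !oppr0.
  by rewrite linearN cmap_diff linearD diff_diff addr0 addNr.
- by move=> n; apply: fg_prod; exact: cobj_fg.
- have [N hN] := cobj_bounded X; have [N' hN'] := cobj_bounded Y.
  exists (Num.max N N') => n; rewrite gt_max => /andP[l l'] [x y].
  rewrite (hN' _ l' y) (hN _ _ x) //.
  by apply: lt_trans l _; rewrite ltrDl.
Defined.

Lemma coneP n (p : cone n) : diff cone n p = (- diff X _ p.1, f _ p.1 + diff Y _ p.2).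
Proof. by []. Qed.

(** This reduces the preservation of quasi-isomorphisms by an additive functor to the preservation
    of acyclic complexes. *)
Lemma quasi_iso_cone : acyclic cone <-> quasi_iso (f : @hom (complexes A) _ _).
Proof.
split=> [h|h n [x y]]; last first.
  rewrite coneP => -[/= /eqP]; rewrite oppr_eq0 => /eqP dx dy.
  have [|x1 ex] := (h (n + 1)).1 x dx.
    by exists (- y); apply/eqP; rewrite linearN eq_sym -addr_eq0 dy.
  have [|x2 [dx2 [y' ey]]] := (h n).2 (y + f _ x1).
    by rewrite linearD -cmap_diff ex (addrC (diff _ _ _)).
  exists (x2 - x1, y'); rewrite /cone_diff /=; congr pair.
    by rewrite linearB dx2 ex sub0r opprK.
  by rewrite -ey linearB [LHS]addrC addrA subrK addrK.
move=> n; split; last first.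
  move=> y dy; have [|[x y'] /=] := h n (0, y).
    by rewrite /= /cone_diff /= !linear0 dy ?oppr0 add0r.
  rewrite /cone_diff /= => -[ex ey]; exists x; split; first by apply/eqP; rewrite -oppr_eq0 ex.
  by exists y'; rewrite -ey [LHS]addrAC subrr add0r.
(* The cone in degree n contains X in degree n + 1, so acyclicity is used one degree lower. Writing
   n as (n - 1) + 1 makes the dependent types agree. *)
rewrite -(subrK 1 n); move: (n - 1) => {}n x dx [y ey].
have [|[x' y'] /=] := h n (x, - y) => [|[/= ex _]].
  by rewrite /= /cone_diff /= dx linearN ey subrr ?oppr0.
exists (- x'); by rewrite linearN.
Qed.

End Cone.
End QuasiIso.

(** * Functorial cones and one step of a left resolution *)

Section ConeFunctor.
Variable A : pzRingType.
Local Notation Ch := (complexes A).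
Local Notation cm f := (f : chain_map _ _).

Section Fun.
Variables (F G : functor Ch Ch) (g : nat_trans F G).

Definition cone_map_fun (X Y : Ch) (f : hom X Y) n
    (p : cone (g X) n) : cone (g Y) n :=
  (cm (fmap F f) _ p.1, cm (fmap G f) _ p.2).

Lemma cone_map_linear X Y (f : hom X Y) n : linear (@cone_map_fun X Y f n).
Proof.
by move=> a [x y] [x' y']; rewrite /cone_map_fun /=; congr pair => /=; rewrite linearP.
Qed.

Definition cone_map (X Y : Ch) (f : hom X Y) : chain_map (cone (g X)) (cone (g Y)).
Proof.
apply: (@ChainMap _ (cone (g X)) (cone (g Y)) (fun n => mklin (@cone_map_linear X Y f n))).
move=> n [x y]; rewrite /= /cone_map_fun /cone_diff /=; congr pair.
  by rewrite linearN cmap_diff.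
have /= e := naturality g f _ x; rewrite linearD cmap_diff; congr (_ + _).
by rewrite -e.
Defined.

Definition cone_functor : functor Ch Ch.
Proof.
apply: (@Functor Ch Ch (fun X => cone (g X)) cone_map).
- move=> X Y f f' e n [x y]; rewrite /= /cone_map_fun /=; congr pair.
    exact: (fmap_heq F e).
  exact: (fmap_heq G e).
- move=> X n [x y]; rewrite /= /cone_map_fun /=; congr pair.
    exact: (fmap_id F X).
  exact: (fmap_id G X).
- move=> X Y Z f f' n [x y]; rewrite /= /cone_map_fun /=; congr pair.
    exact: (fmap_comp F f f').
  exact: (fmap_comp G f f').
Defined.

End Fun.

Section LeftStep.
Variables (Y K L X : complex A).
Variables (k : chain_map Y K) (i : chain_map K L) (p : chain_map L X).

Definition cone_proj_fun n (q : cone (chain_comp i k) n) : X n := p n q.2.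

Hypothesis p_surj : forall n (x : X n), exists l, p n l = x.
Hypothesis ker_p : forall n (l : L n), p n l = 0 -> exists z, i n z = l.
Hypothesis i_inj : forall n (z : K n), i n z = 0 -> z = 0.
Hypothesis pi0 : forall n (z : K n), p n (i n z) = 0.

Lemma cone_proj_linear n : linear (@cone_proj_fun n).
Proof. by move=> a q q'; exact: linearP. Qed.

Definition cone_proj : chain_map (cone (chain_comp i k)) X.
Proof.
apply: (@ChainMap _ (cone (chain_comp i k)) X (fun n => mklin (@cone_proj_linear n))).
move=> n [y l]; rewrite /= /cone_diff /cone_proj_fun /=.
by rewrite linearD pi0 add0r cmap_diff.
Defined.

(** For a short exact sequence K -> L -> X the cone of [i] computes X, and a quasi-isomorphism [k]
    onto K does not change the cone up to quasi-isomorphism. The chase does both at once. *)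
Lemma cone_proj_quasi_iso : quasi_iso (k : @hom Ch _ _) ->
  quasi_iso (cone_proj : @hom Ch _ _).
Proof.
move=> hk n; split=> [[y l]|x dx].
  rewrite /= /cone_diff /cone_proj_fun /= => -[/eqP]; rewrite oppr_eq0 => /eqP dy hl [x ex].
  have [l0 el0] := p_surj x.
  have [|k0 ek0] := ker_p (l := l - diff L n l0).
    by rewrite linearB -ex cmap_diff el0 subrr.
  have ky : cm k _ y = - diff K _ k0.
    apply/eqP; rewrite -addr_eq0; apply/eqP; apply: i_inj.
    by rewrite linearD cmap_diff ek0 linearB diff_diff subr0.
  have [|y1 ey1] := (hk (n + 1)).1 y dy; first by exists (- k0); rewrite linearN ky.
  have [|y2 [dy2 [k1 ek1]]] := (hk n).2 (k _ y1 + k0).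
    by rewrite linearD -cmap_diff ey1 ky addNr.
  exists (y2 - y1, l0 + i _ k1); congr pair => /=.
    by rewrite linearB dy2 ey1 sub0r opprK.
  have -> : k _ (y2 - y1) = k0 - diff K _ k1.
    by rewrite -ek1 linearB opprB [RHS]addrCA opprD [k0 + _]addrCA subrr addr0.
  by rewrite linearB linearD /= ek0 cmap_diff -[_ - _ - _]addrA -opprD subrK.
have [l el] := p_surj x.
have [|k0 ek0] := ker_p (l := diff L _ l); first by rewrite cmap_diff el.
have dk0 : diff K _ k0 = 0 by apply: i_inj; rewrite cmap_diff ek0 diff_diff.
have [y [dy [k1 ek1]]] := (hk (n + 1)).2 k0 dk0.
exists (- y, l - i _ k1); split; last first.
  by exists 0; rewrite /= /cone_proj_fun /= linearB pi0 subr0 el subrr linear0.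
rewrite /= /cone_diff /=; congr pair.
  by rewrite linearN dy !oppr0.
by rewrite linearB -cmap_diff -ek1 !linearN linearB /= ek0 opprB [_ + (_ - _)]addrC subrK addNr.
Qed.

End LeftStep.
End ConeFunctor.

(** * Shifts and one step of a right resolution *)

Section Shift.
Variable A : pzRingType.
Local Notation Ch := (complexes A).
Implicit Types X Y Z : complex A.

(** The degrees [n - 1 + 1] and [n] are equal but not convertible, so shifting down needs a
    transport along equalities of degrees. *)
Definition recast (X : int -> lmodType A) n m (e : n = m) : {linear X n -> X m} :=
  match e in _ = m' return {linear X n -> X m'} with erefl => idfun end.

Lemma recast_id (X : int -> lmodType A) n (e : n = n) (x : X n) : recast X e x = x.
Proof. by rewrite (eq_axiomK e). Qed.

Lemma recast_comp (X : int -> lmodType A) n m l (e : n = m) (e' : m = l) (e'' : n = l)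
  (x : X n) : recast X e' (recast X e x) = recast X e'' x.
Proof. by case: m / e e' => e' /=; rewrite (eq_irrelevance e' e''). Qed.

Lemma recast_diff X n m (e : n = m) (e' : n + 1 = m + 1) (x : X n) :
  diff X m (recast X e x) = recast X e' (diff X n x).
Proof. by case: m / e e' => e'; rewrite !recast_id. Qed.

Lemma recast_cmap X Y (f : chain_map X Y) n m (e : n = m) (x : X n) :
  f m (recast X e x) = recast Y e (f n x).
Proof. by case: m / e. Qed.

Definition shift_up_diff X n (x : X (n + 1)) : X (n + 1 + 1) := - diff X _ x.

Lemma shift_up_diff_linear X n : linear (@shift_up_diff X n).
Proof. by move=> a x y; rewrite /shift_up_diff linearP opprD scalerN. Qed.

Definition shift_up X : complex A.
Proof.
apply: (@Complex A (fun n => X (n + 1)) (fun n => mklin (@shift_up_diff_linear X n))).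
- by move=> n x; rewrite /= /shift_up_diff linearN diff_diff !oppr0.
- by move=> n; exact: cobj_fg.
- have [N hN] := cobj_bounded X; exists N => n l; apply: hN.
  by apply: lt_trans l _; rewrite ltrDl.
Defined.

Lemma shift_eq (n : int) : n - 1 + 1 = n + 1 - 1.
Proof. by rewrite subrK addrK. Qed.

Definition shift_down_diff X n (x : X (n - 1)) : X (n + 1 - 1) :=
  - recast X (shift_eq n) (diff X _ x).

Lemma shift_down_diff_linear X n : linear (@shift_down_diff X n).
Proof. by move=> a x y; rewrite /shift_down_diff !linearP /=. Qed.

Definition shift_down X : complex A.
Proof.
apply: (@Complex A (fun n => X (n - 1)) (fun n => mklin (@shift_down_diff_linear X n))).
- move=> n x; rewrite /= /shift_down_diff linearN (recast_diff _ (congr1 (+%R^~ 1) (shift_eq n))).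
  by rewrite diff_diff linear0 !linearN !linear0.
- by move=> n; exact: cobj_fg.
- have [N hN] := cobj_bounded X; exists (N + 1) => n l; apply: hN.
  by rewrite ltrBrDr.
Defined.

Definition shift_down_map X Y (f : chain_map X Y) : chain_map (shift_down X) (shift_down Y).
Proof.
apply: (@ChainMap _ (shift_down X) (shift_down Y) (fun n => f (n - 1))) => n x.
by rewrite /= /shift_down_diff linearN recast_cmap cmap_diff.
Defined.

Definition shift_down_functor : functor Ch Ch.
Proof.
apply: (@Functor Ch Ch shift_down shift_down_map) => // X Y f g e n x; exact: e.
Defined.

Lemma shift_down_quasi_iso X Y (f : chain_map X Y) : quasi_iso (f : @hom Ch _ _) ->
  quasi_iso (shift_down_map f : @hom Ch _ _).
Proof.
move=> h n; have [hi hs] := h (n - 1); have e := shift_eq n.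
have tr (Z : complex A) m m' (E : m = m') (z : Z m) : recast Z (esym E) (recast Z E z) = z.
  by case: m' / E.
have tr' (Z : complex A) m m' (E : m = m') (z : Z m') : recast Z E (recast Z (esym E) z) = z.
  by case: m' / E z.
have inj (Z : complex A) m m' (E : m = m') (z : Z m) : recast Z E z = 0 -> z = 0.
  by case: m' / E z.
split=> [x dx [y ey]|y dy].
  have [||x' ex] := hi (recast X (esym (shift_eq n)) x).
  - rewrite (recast_diff _ (congr1 (+%R^~ 1) (esym (shift_eq n)))).
    move/eqP: dx; rewrite /= /shift_down_diff oppr_eq0 => /eqP/inj ->.
    by rewrite linear0.
  - by exists (- y); rewrite recast_cmap -[f _ x]ey /= /shift_down_diff !linearN /= tr.
  by exists (- x'); rewrite /= /shift_down_diff !linearN /= ex tr' opprK.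
have [|x [dx [y' ey]]] := hs (recast Y (esym (shift_eq n)) y).
  rewrite (recast_diff _ (congr1 (+%R^~ 1) (esym (shift_eq n)))).
  move/eqP: dy; rewrite /= /shift_down_diff oppr_eq0 => /eqP/inj ->.
  by rewrite linear0.
exists (recast X (shift_eq n) x); split.
  rewrite /= /shift_down_diff (recast_diff _ (congr1 (+%R^~ 1) (shift_eq n))) dx.
  by rewrite !linear0 ?oppr0.
exists (- y'); rewrite /= /shift_down_diff !linearN /= opprK -ey linearB /= tr'.
by rewrite recast_cmap.
Qed.

Lemma shift_unit_eq (n : int) : n = n - 1 + 1. Proof. by rewrite subrK. Qed.

Definition shift_unit X : chain_map X (shift_down (shift_up X)).
Proof.
apply: (@ChainMap _ X (shift_down (shift_up X)) (fun n => recast X (shift_unit_eq n))).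
move=> n x; rewrite /= /shift_down_diff.
have e' m m' (E : m = m') (z : shift_up X m) (E' : m + 1 = m' + 1) :
    recast (shift_up X) E z = recast X E' z.
  by case: m' / E E' => E'; rewrite !recast_id.
rewrite (e' _ _ _ _ (congr1 (+%R^~ 1) (shift_eq n))) /= /shift_up_diff linearN opprK.
rewrite (recast_diff _ (congr1 (+%R^~ 1) (shift_unit_eq n))).
by rewrite (recast_comp _ _ (shift_unit_eq (n + 1))).
Defined.

Lemma shift_unit_quasi_iso X : quasi_iso (shift_unit X : @hom Ch _ _).
Proof.
apply: quasi_iso_bij => n /=.
  by move: (shift_unit_eq n) => e x; move: (e); rewrite -e => {}e; rewrite recast_id.
move=> y; exists (recast X (esym (shift_unit_eq n)) y).
by rewrite (recast_comp _ _ erefl).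
Qed.

Section RightStep.
Variables (Z X Q Y : complex A).
Variables (i : chain_map Z X) (q : chain_map X Q) (j : chain_map Q Y).

Definition cone_incl_fun n (z : shift_up Z n) : cone (chain_comp j q) n := (i _ z, 0).

Hypothesis q_surj : forall n (y : Q n), exists x, q n x = y.
Hypothesis ker_q : forall n (x : X n), q n x = 0 -> exists z, i n z = x.
Hypothesis i_inj : forall n (z : Z n), i n z = 0 -> z = 0.
Hypothesis qi0 : forall n (z : Z n), q n (i n z) = 0.

Lemma cone_incl_linear n : linear (@cone_incl_fun n).
Proof.
by move=> a z z'; rewrite /cone_incl_fun linearP; congr pair; rewrite /= scaler0 addr0.
Qed.

Definition cone_incl : chain_map (shift_up Z) (cone (chain_comp j q)).
Proof.
apply: (@ChainMap _ (shift_up Z) (cone (chain_comp j q))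
  (fun n => mklin (@cone_incl_linear n))).
move=> n z; rewrite /= /cone_incl_fun /cone_diff /shift_up_diff /= linearN cmap_diff.
by rewrite qi0 !linear0 addr0.
Defined.

Lemma cone_incl_quasi_iso : quasi_iso (j : @hom Ch _ _) ->
  quasi_iso (cone_incl : @hom Ch _ _).
Proof.
move=> hj n; split=> [z _ [[x y]]|[x y]].
  rewrite /= /cone_diff /cone_incl_fun /= => -[ex ey].
  have [||q0 eq0] := (hj n).1 (q _ x).
  - by rewrite -cmap_diff; apply/eqP; rewrite -oppr_eq0 -linearN ex qi0.
  - by exists (- y); apply/eqP; rewrite linearN eq_sym -addr_eq0 ey.
  have [x0 ex0] := q_surj q0.
  have [|z0 ez0] := ker_q (x := x - diff X _ x0).
    by rewrite linearB cmap_diff ex0 eq0 subrr.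
  exists z0; rewrite /shift_up_diff; apply/eqP; rewrite -subr_eq0; apply/eqP/i_inj.
  by rewrite linearB linearN cmap_diff ez0 linearB diff_diff subr0 -ex subrr.
rewrite /= /cone_diff /= => -[/eqP]; rewrite oppr_eq0 => /eqP dx hy.
have [||q0 eq0] := (hj (n + 1)).1 (q _ x).
- by rewrite -cmap_diff dx linear0.
- by exists (- y); apply/eqP; rewrite linearN eq_sym -addr_eq0 hy.
have [|q1 [dq1 [y1 ey1]]] := (hj n).2 (j _ q0 + y).
  by rewrite linearD -cmap_diff eq0.
have [x0 ex0] := q_surj q0; have [x1 ex1] := q_surj q1.
have [|z ez] := ker_q (x := x - diff X _ x0 + diff X _ x1).
  by rewrite linearD linearB !cmap_diff ex0 ex1 dq1 eq0 subrr addr0.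
exists z; split.
  apply/eqP; rewrite /= /shift_up_diff oppr_eq0; apply/eqP/i_inj.
  by rewrite cmap_diff ez linearD linearB !diff_diff dx subr0 addr0.
exists (x1 - x0, y1); rewrite /= /cone_incl_fun /cone_diff /=; congr pair => /=.
  by rewrite ez linearB /= opprD [x + _]addrA subKr opprB.
by rewrite -ey1 linearB linearB /= ex0 ex1 subr0 [RHS]addrC addrA subrK addrAC subrr add0r.
Qed.

(** The cone receives only the shift of [Z]. Shifting back raises the upper bound of the complex by
    one, which is harmless for finitely many steps. *)
Definition cocone_incl : chain_map Z (shift_down (cone (chain_comp j q))) :=
  chain_comp (shift_down_map cone_incl) (shift_unit Z).

Lemma cocone_incl_quasi_iso : quasi_iso (j : @hom Ch _ _) ->
  quasi_iso (cocone_incl : @hom Ch _ _).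
Proof.
move=> hj; apply: quasi_iso_comp; last exact: shift_unit_quasi_iso.
exact/shift_down_quasi_iso/cone_incl_quasi_iso.
Qed.

End RightStep.
End Shift.

(** * Additive functors on modules and iterated resolutions *)

Section ModuleFunctors.
Variable A : pzRingType.
Local Notation Ch := (complexes A).
Local Notation cm f := (f : chain_map _ _).

Lemma zero_linear (M N : lmodType A) : linear (fun _ : M => 0 : N).
Proof. by move=> a x y; rewrite scaler0 addr0. Qed.
Definition zlin (M N : lmodType A) := mklin (@zero_linear M N).

Lemma opp_linear (M N : lmodType A) (f : {linear M -> N}) : linear (fun x => - f x).
Proof. by move=> a x y; rewrite linearP opprD scalerN. Qed.
Definition olin (M N : lmodType A) (f : {linear M -> N}) := mklin (opp_linear f).

(** The laws take pointwise equalities as premises, so that bundled linear maps never have to be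
    proved equal as records. Additivity is what makes the functor commute with cones. *)
Record mod_functor := ModFunctor {
  mobj :> lmodType A -> lmodType A;
  mmap : forall M N : lmodType A, {linear M -> N} -> {linear mobj M -> mobj N};
  mmap_id : forall (M : lmodType A) (f : {linear M -> M}), (forall x, f x = x) ->
    forall x, mmap f x = x;
  mmap_comp : forall (M N P : lmodType A) (g : {linear N -> P}) (f : {linear M -> N})
    (h : {linear M -> P}), (forall x, h x = g (f x)) ->
    forall x, mmap h x = mmap g (mmap f x);
  mmapD : forall (M N : lmodType A) (f g h : {linear M -> N}), (forall x, h x = f x + g x) ->
    forall x, mmap h x = mmap f x + mmap g x;
  mobj_fg : forall M : lmodType A, finitely_generated M -> finitely_generated (mobj M) }.

Arguments mmap _ {M N}.

Section Lift.
Variable F : mod_functor.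

Lemma mmap_ext (M N : lmodType A) (f g : {linear M -> N}) : f =1 g -> mmap F f =1 mmap F g.
Proof.
move=> e x; rewrite (@mmap_comp F _ _ _ idfun g f e) (@mmap_id F _ idfun) //.
Qed.

Lemma mmap0 (M N : lmodType A) (f : {linear M -> N}) : (forall x, f x = 0) -> forall x, mmap F f x = 0.
Proof.
move=> f0 x; apply: (addrI (mmap F f x)); rewrite addr0.
by apply/esym/mmapD => y; rewrite f0 addr0.
Qed.

Lemma mmapN (M N : lmodType A) (f g : {linear M -> N}) : (forall x, g x = - f x) ->
  forall x, mmap F g x = - mmap F f x.
Proof.
move=> e x; apply/eqP; rewrite -addr_eq0 -(@mmapD F _ _ _ _ (zlin M N)) // => [|y].
  by rewrite (@mmap0 _ _ (zlin M N)).
by rewrite e addNr.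
Qed.

Definition lift_complex (X : complex A) : complex A.
Proof.
apply: (@Complex A (fun n => F (X n)) (fun n => mmap F (diff X n))).
- move=> n x; rewrite -(@mmap_comp F _ _ _ _ _ (zlin _ _)) => [|y]; last by rewrite diff_diff.
  exact: mmap0.
- by move=> n; apply: mobj_fg; exact: cobj_fg.
- have [N h] := cobj_bounded X; exists N => n l x.
  rewrite -(@mmap_id F _ idfun _ x) //; apply: mmap0 => y; exact: h.
Defined.

Definition lift_map (X Y : complex A) (f : chain_map X Y) :
  chain_map (lift_complex X) (lift_complex Y).
Proof.
apply: (@ChainMap _ (lift_complex X) (lift_complex Y) (fun n => mmap F (f n))) => n x.
rewrite /= -(@mmap_comp F _ _ _ _ _ (f (n + 1) \o diff X n)%FUN) //.
by apply: mmap_comp => y /=; rewrite cmap_diff.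
Defined.

Definition lift_functor : functor Ch Ch.
Proof.
apply: (@Functor Ch Ch lift_complex lift_map).
- by move=> X Y f g e n; apply: mmap_ext; exact: e.
- by move=> X n x; apply: mmap_id.
- by move=> X Y Z g f n x; apply: mmap_comp.
Defined.

(** An additive functor takes the cone of [f] to the cone of its image: [a] and [b] below are the
    mutually inverse isomorphisms, built from the injections and projections of the direct sum. *)
Lemma lift_quasi_iso (P : lmodType A -> Prop) :
  (forall M N, P M -> P N -> P (M * N)%type) ->
  (forall X : complex A, (forall n, P (X n)) -> acyclic X -> acyclic (lift_complex X)) ->
  forall (X Y : complex A) (f : chain_map X Y),
    (forall n, P (X n)) -> (forall n, P (Y n)) ->
    quasi_iso (f : @hom Ch _ _) -> quasi_iso (lift_map f : @hom Ch _ _).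
Proof.
move=> Pprod h X Y f PX PY /quasi_iso_cone ac; apply/quasi_iso_cone => n [u v] e.
have {}ac : acyclic (lift_complex (cone f)) by apply: h => // m; exact: Pprod.
pose i1 m : {linear X (m + 1) -> cone f m} :=
  mklin (f := fun x => (x, 0) : cone f m)
    (fun a x y => congr1 (pair _) (esym (etrans (addr0 _) (scaler0 _ a)))).
pose i2 m : {linear Y m -> cone f m} :=
  mklin (f := fun y => (0, y) : cone f m)
    (fun a x y => congr1 (fun z => (z, a *: x + y)) (esym (etrans (addr0 _) (scaler0 _ a)))).
pose p1 m : {linear cone f m -> X (m + 1)} :=
  mklin (f := fun w : cone f m => w.1) (fun a x y => erefl).
pose p2 m : {linear cone f m -> Y m} :=
  mklin (f := fun w : cone f m => w.2) (fun a x y => erefl).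
pose b m (w : cone (lift_map f) m) : lift_complex (cone f) m :=
  mmap F (i1 m) w.1 + mmap F (i2 m) w.2.
pose a m (w : lift_complex (cone f) m) : cone (lift_map f) m :=
  (mmap F (p1 m) w, mmap F (p2 m) w).
have ab m w : a m (b m w) = w.
  case: w => x y; rewrite /a /b /= !linearD /=; congr pair.
    rewrite -(@mmap_comp F _ _ _ _ _ idfun) // (@mmap_id F _ idfun) //.
    by rewrite -(@mmap_comp F _ _ _ _ _ (zlin _ _)) // mmap0 ?addr0.
  rewrite -(@mmap_comp F _ _ _ _ _ (zlin _ _)) // mmap0 ?add0r //.
  by rewrite -(@mmap_comp F _ _ _ _ _ idfun) // (@mmap_id F _ idfun).
have ba m w : b m (a m w) = w.
  rewrite /a /b /= -(@mmap_comp F _ _ _ _ _ (i1 m \o p1 m)%FUN) //.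
  rewrite -(@mmap_comp F _ _ _ _ _ (i2 m \o p2 m)%FUN) //.
  rewrite -(@mmapD F _ _ _ _ idfun) ?(@mmap_id F _ idfun) // => -[x y].
  by rewrite /= /i1 /i2 /=; congr pair; rewrite /= ?addr0 ?add0r.
have db m w : diff (lift_complex (cone f)) m (b m w) = b _ (diff (cone (lift_map f)) m w).
  case: w => x y; rewrite /b /= /cone_diff /= linearD /=.
  rewrite -(@mmap_comp F _ _ _ _ _ (diff (cone f) m \o i1 m)%FUN) //.
  rewrite -(@mmap_comp F _ _ _ _ _ (diff (cone f) m \o i2 m)%FUN) //.
  rewrite (@mmapD F _ _ (i1 _ \o olin (diff X _))%FUN (i2 _ \o f (m + 1))%FUN); last first.
    by move=> z; rewrite /= /cone_diff /i1 /i2 /= linear0 addr0; congr pair;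
      rewrite /= ?addr0 ?add0r.
  rewrite linearD /= -(@mmap_comp F _ _ _ _ _ (i2 _ \o f (m + 1))%FUN) //.
  rewrite -(@mmap_comp F _ _ _ _ _ (i2 _ \o diff Y m)%FUN) // addrA; congr (_ + _ + _).
    rewrite (@mmap_comp F _ _ _ (i1 _) (olin (diff X _)) (i1 _ \o olin (diff X _))%FUN) //.
    by congr (mmap F _ _); exact: mmapN.
  by apply: mmap_ext => z; rewrite /= /cone_diff /= !linear0 ?oppr0 add0r.
have [|y ey] := ac n (b _ (u, v)); first by rewrite db e /b /= !linear0 addr0.
by exists (a _ y); rewrite -[LHS]ab -db ba ey ab.
Qed.

End Lift.

Record mod_nat (F G : mod_functor) := ModNat {
  mnat :> forall M : lmodType A, {linear F M -> G M};
  mnat_nat : forall (M N : lmodType A) (f : {linear M -> N}) x,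
    mnat N (mmap F f x) = mmap G f (mnat M x) }.

Definition lift_nat_map F G (u : mod_nat F G) (X : complex A) :
  chain_map (lift_complex F X) (lift_complex G X).
Proof.
apply: (@ChainMap _ (lift_complex F X) (lift_complex G X) (fun n => u (X n))) => n x.
exact: mnat_nat.
Defined.

Definition lift_nat F G (u : mod_nat F G) : nat_trans (lift_functor F) (lift_functor G).
Proof.
by exists (lift_nat_map u : forall X : Ch, hom (lift_functor F X) (lift_functor G X)) => X Y f n x;
  exact: mnat_nat.
Defined.

Record mod_aug (F : mod_functor) := ModAug {
  maug :> forall M : lmodType A, {linear F M -> M};
  maug_nat : forall (M N : lmodType A) (f : {linear M -> N}) x,
    maug N (mmap F f x) = f (maug M x) }.

Definition lift_aug_map F (u : mod_aug F) (X : complex A) : chain_map (lift_complex F X) X.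
Proof.
apply: (@ChainMap _ (lift_complex F X) X (fun n => u (X n))) => n x.
exact: maug_nat.
Defined.

Definition lift_aug F (u : mod_aug F) : nat_trans (lift_functor F) (functor_id Ch).
Proof.
by exists (lift_aug_map u : forall X : Ch, hom (lift_functor F X) X) => X Y f n x; exact: maug_nat.
Defined.

Record mod_coaug (F : mod_functor) := ModCoaug {
  mcoaug :> forall M : lmodType A, {linear M -> F M};
  mcoaug_nat : forall (M N : lmodType A) (f : {linear M -> N}) x,
    mcoaug N (f x) = mmap F f (mcoaug M x) }.

Definition lift_coaug_map F (u : mod_coaug F) (X : complex A) : chain_map X (lift_complex F X).
Proof.
apply: (@ChainMap _ X (lift_complex F X) (fun n => u (X n))) => n x.
exact: mcoaug_nat.
Defined.

Definition lift_coaug F (u : mod_coaug F) : nat_trans (functor_id Ch) (lift_functor F).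
Proof.
by exists (lift_coaug_map u : forall X : Ch, hom X (lift_functor F X)) => X Y f n x; exact: mcoaug_nat.
Defined.

Definition mod_comp (G F : mod_functor) : mod_functor.
Proof.
exists (fun M => G (F M)) (fun M N f => mmap G (mmap F f)).
- by move=> M f e x; apply: mmap_id => y; exact: mmap_id.
- by move=> M N P g f h e x; apply: mmap_comp => y; exact: mmap_comp.
- by move=> M N f g h e x; apply: mmapD => y; exact: mmapD.
- by move=> M fg; do 2!apply: mobj_fg.
Defined.

Section LeftResolution.
Variables (K L : mod_functor) (i : mod_nat K L) (p : mod_aug L).
Hypothesis p_surj : forall (M : lmodType A) (x : M), exists l, p M l = x.
Hypothesis ker_p : forall (M : lmodType A) (l : L M), p M l = 0 -> exists z, i M z = l.
Hypothesis i_inj : forall (M : lmodType A) (z : K M), i M z = 0 -> z = 0.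
Hypothesis pi0 : forall (M : lmodType A) (z : K M), p M (i M z) = 0.

Definition left_step_nat (r : functor Ch Ch) (q : nat_trans r (functor_id Ch)) :
  nat_trans (functor_comp r (lift_functor K)) (lift_functor L).
Proof.
exists (fun X : Ch => chain_comp (lift_nat i X) (q (lift_functor K X))
         : @hom Ch (functor_comp r (lift_functor K) X) (lift_functor L X)) => X Y f n x /=.
have /= -> := naturality q (fmap (lift_functor K) f) n x.
exact: mnat_nat.
Defined.

Definition left_step_proj (r : functor Ch Ch) (q : nat_trans r (functor_id Ch)) :
  nat_trans (cone_functor (left_step_nat q)) (functor_id Ch).
Proof.
exists (fun X : Ch => cone_proj (K := lift_complex K X) (L := lift_complex L X)
   (q (lift_functor K X)) (i := lift_nat_map i X) (p := lift_aug_map p X) (fun n => @pi0 (X n))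
   : @hom Ch (cone_functor (left_step_nat q) X) X) => X Y f n [y l] /=.
exact: maug_nat.
Defined.

(** A step applies the previous resolution to the whole complex of kernels and takes one cone, so
    that no double complex and no totalization occur. *)
Fixpoint left_resolution (n : nat) :
    {r : functor Ch Ch & nat_trans r (functor_id Ch)} :=
  if n is m.+1 then existT _ _ (left_step_proj (projT2 (left_resolution m)))
  else existT _ (functor_id Ch) (nat_id (functor_id Ch)).

Lemma left_resolution_quasi_iso n X : quasi_iso (projT2 (left_resolution n) X).
Proof.
elim: n X => [|n IH] X; first by apply: quasi_iso_bij => // m y; exists y.
apply: cone_proj_quasi_iso => [m x|m l|m z|]; last exact: IH.
- exact: p_surj.
- exact: ker_p.
- exact: i_inj.
Qed.

Lemma left_resolution_terms (P : nat -> lmodType A -> Prop) :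
  (forall n (M N : lmodType A), P n M -> P n N -> P n (M * N)%type) -> (forall M : lmodType A, P 0%N M) ->
  (forall n (M : lmodType A), P n M -> P n.+1 (K M)) -> (forall n (M : lmodType A), P n (L M)) ->
  forall n (X : complex A) m, P n ((projT1 (left_resolution n) X : complex A) m).
Proof.
move=> Pprod P0 PK PL n X m.
(* The statement has to allow complexes that start at level s, because the recursion resolves [K X],
   whose terms have already gained a level. *)
suff H s : (forall l, P s (X l)) ->
    P (s + n)%N ((projT1 (left_resolution n) X : complex A) m) by exact: (H 0%N).
elim: n s X m => [|n IH] s X m PX; first by rewrite addn0.
apply: (Pprod); last exact: PL.
by rewrite addnS -addSn; apply: IH => l; apply: PK; exact: PX.
Qed.

End LeftResolution.

Section RightResolution.
Variables (N S : mod_functor) (i : mod_coaug N) (p : mod_nat N S).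
Hypothesis p_surj : forall (M : lmodType A) (x : S M), exists l, p M l = x.
Hypothesis ker_p : forall (M : lmodType A) (l : N M), p M l = 0 -> exists z, i M z = l.
Hypothesis i_inj : forall (M : lmodType A) (z : M), i M z = 0 -> z = 0.
Hypothesis pi0 : forall (M : lmodType A) (z : M), p M (i M z) = 0.

Definition right_step_nat (c : functor Ch Ch) (j : nat_trans (functor_id Ch) c) :
  nat_trans (lift_functor N) (functor_comp c (lift_functor S)).
Proof.
exists (fun X : Ch => chain_comp (j (lift_functor S X)) (lift_nat p X)
         : @hom Ch (lift_functor N X) (functor_comp c (lift_functor S) X)) => X Y f n x /=.
have /= <- := naturality j (fmap (lift_functor S) f) n (p _ x).
congr (cm (j (lift_complex S Y)) n _); exact: mnat_nat.
Defined.

Definition right_step_incl (c : functor Ch Ch) (j : nat_trans (functor_id Ch) c) :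
  nat_trans (functor_id Ch) (functor_comp (shift_down_functor A) (cone_functor (right_step_nat j))).
Proof.
exists (fun X : Ch => cocone_incl (X := lift_complex N X) (Q := lift_complex S X)
   (i := lift_coaug_map i X) (q := lift_nat_map p X) (j (lift_functor S X)) (fun n => @pi0 (X n))
   : @hom Ch X (functor_comp (shift_down_functor A) (cone_functor (right_step_nat j)) X)).
move=> X Y f n x /=; rewrite /cone_incl_fun /cone_map_fun /=; congr pair.
  by rewrite -recast_cmap mcoaug_nat.
by rewrite linear0.
Defined.

Fixpoint right_resolution (n : nat) :
    {c : functor Ch Ch & nat_trans (functor_id Ch) c} :=
  if n is m.+1 then existT _ _ (right_step_incl (projT2 (right_resolution m)))
  else existT _ (functor_id Ch) (nat_id (functor_id Ch)).

Lemma right_resolution_quasi_iso n X : quasi_iso (projT2 (right_resolution n) X).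
Proof.
elim: n X => [|n IH] X; first by apply: quasi_iso_bij => // m y; exists y.
apply: cocone_incl_quasi_iso => [m x|m l|m z|]; last exact: IH.
- exact: p_surj.
- exact: ker_p.
- exact: i_inj.
Qed.

Lemma right_resolution_terms (P : nat -> lmodType A -> Prop) :
  (forall n (M N : lmodType A), P n M -> P n N -> P n (M * N)%type) -> (forall M : lmodType A, P 0%N M) ->
  (forall n (M : lmodType A), P n M -> P n.+1 (S M)) -> (forall n (M : lmodType A), P n (N M)) ->
  forall n (X : complex A) m, P n ((projT1 (right_resolution n) X : complex A) m).
Proof.
move=> Pprod P0 PS PN n X m.
suff H s : (forall l, P s (X l)) ->
    P (s + n)%N ((projT1 (right_resolution n) X : complex A) m) by exact: (H 0%N).
elim: n s X m => [|n IH] s X m PX; first by rewrite addn0.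
apply: (Pprod); first exact: PN.
by rewrite addnS -addSn; apply: IH => l; apply: PS; exact: PX.
Qed.

End RightResolution.

End ModuleFunctors.
Arguments mmap {A} _ {M N}.

(** * Hom, kernel and cokernel functors *)

Section HomOver.
Variables (A : pzRingType) (B : bimodule A) (S : A -> Prop).

Section Module.
Variable M : lmodType A.

(** The set [S] of scalars covers two cases: all of [A] gives Hom over [A], and the image of the
    power series gives Hom_R. In both the left action comes from the right action on [B]. *)
Record hom_over := HomOver {
  hfun :> B -> M;
  hfunD : forall x y, hfun (x + y) = hfun x + hfun y;
  hfunZ : forall a x, S a -> hfun (a *: x) = a *: hfun x }.
Implicit Types g h : hom_over.

Lemma hom_overP g h : (forall x, g x = h x) -> g = h.
Proof.
case: g h => [g gD gZ] [h hD hZ] /= /funext e; subst h.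
by congr HomOver; apply: Prop_irrelevance.
Qed.

HB.instance Definition _ := gen_eqMixin hom_over.
HB.instance Definition _ := gen_choiceMixin hom_over.

Definition ho_zero : hom_over.
Proof.
by exists (fun=> 0) => [x y|a x _]; rewrite ?addr0 ?scaler0.
Defined.

Definition ho_opp h : hom_over.
Proof.
by exists (fun x => - h x) => [x y|a x sa]; rewrite ?hfunD ?opprD // hfunZ ?scalerN.
Defined.

Definition ho_add g h : hom_over.
Proof.
exists (fun x => g x + h x) => [x y|a x sa]; first by rewrite !hfunD addrACA.
by rewrite !hfunZ // scalerDr.
Defined.

Definition ho_scale (a : A) h : hom_over.
Proof.
exists (fun x => h (ract x a)) => [x y|b x sb]; first by rewrite ractDl hfunD.
by rewrite -lractA hfunZ.
Defined.

Lemma ho_addA : associative ho_add.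
Proof. by move=> f g h; apply: hom_overP => x; exact: addrA. Qed.
Lemma ho_addC : commutative ho_add.
Proof. by move=> f g; apply: hom_overP => x; exact: addrC. Qed.
Lemma ho_add0 : left_id ho_zero ho_add.
Proof. by move=> f; apply: hom_overP => x; exact: add0r. Qed.
Lemma ho_addN : left_inverse ho_zero ho_opp ho_add.
Proof. by move=> f; apply: hom_overP => x; exact: addNr. Qed.

HB.instance Definition _ := GRing.isZmodule.Build hom_over
  ho_addA ho_addC ho_add0 ho_addN.

Lemma ho_scaleA a b h : ho_scale a (ho_scale b h) = ho_scale (a * b) h.
Proof. by apply: hom_overP => x /=; rewrite ractA. Qed.
Lemma ho_scale1 : left_id 1 ho_scale.
Proof. by move=> h; apply: hom_overP => x /=; rewrite ract1. Qed.
Lemma ho_scaleDr : right_distributive ho_scale +%R.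
Proof. by move=> a g h; apply: hom_overP. Qed.
Lemma ho_scaleDl h : {morph ho_scale^~ h : a b / a + b}.
Proof. by move=> a b; apply: hom_overP => x /=; rewrite ractDr hfunD. Qed.

HB.instance Definition _ := GRing.Zmodule_isLmodule.Build A hom_over
  ho_scaleA ho_scale1 ho_scaleDr ho_scaleDl.

Lemma hfun0 h : h 0 = 0.
Proof. by apply: (addrI (h 0)); rewrite -hfunD !addr0. Qed.
Lemma hfunN h x : h (- x) = - h x.
Proof. by apply/eqP; rewrite -addr_eq0 -hfunD addNr hfun0. Qed.
Lemma hfunB h x y : h (x - y) = h x - h y.
Proof. by rewrite hfunD hfunN. Qed.
Lemma hfun_sum (I : Type) (r : seq I) (P : pred I) (F : I -> B) h :
  h (\sum_(i <- r | P i) F i) = \sum_(i <- r | P i) h (F i).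
Proof. by apply: big_morph; [exact: hfunD|exact: hfun0]. Qed.

Lemma ho_scaleE a h x : (a *: h) x = h (ract x a). Proof. by []. Qed.
Lemma ho_addE g h x : (g + h) x = g x + h x. Proof. by []. Qed.
Lemma ho_zeroE x : (0 : hom_over) x = 0. Proof. by []. Qed.

End Module.

Section Map.
Variables (M N : lmodType A) (f : {linear M -> N}).

Definition ho_map_fun (h : hom_over M) : hom_over N.
Proof.
exists (fun x => f (h x)) => [x y|a x sa]; first by rewrite hfunD linearD.
by rewrite hfunZ // linearZ.
Defined.

Lemma ho_map_linear : linear ho_map_fun.
Proof. by move=> a g h; apply: hom_overP => x; exact: linearD. Qed.

Definition ho_map := mklin ho_map_linear.
End Map.

Definition hom_functor
  (fg : forall M, finitely_generated M -> finitely_generated (hom_over M)) :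
  mod_functor A.
Proof.
apply: (@ModFunctor A (fun M => hom_over M) ho_map) => //.
- by move=> M f e h; apply: hom_overP => x; exact: e.
- by move=> M N P g f h e x; apply: hom_overP => y; exact: e.
- by move=> M N f g h e x; apply: hom_overP => y; exact: e.
Defined.

End HomOver.

Section Kernel.
Variables (A : pzRingType) (M N : lmodType A) (f : {linear M -> N}).

Record ker_mod := KerMod { kval :> M; kvalP : f kval = 0 }.

Lemma kval_inj : injective kval.
Proof.
by case=> x hx [y hy] /= e; subst y; congr KerMod; apply: Prop_irrelevance.
Qed.

HB.instance Definition _ := gen_eqMixin ker_mod.
HB.instance Definition _ := gen_choiceMixin ker_mod.

Definition ke_zero := KerMod (linear0 f).
Definition ke_opp (x : ker_mod) : ker_mod.
Proof. by exists (- kval x); rewrite linearN kvalP oppr0. Defined.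
Definition ke_add (x y : ker_mod) : ker_mod.
Proof. by exists (kval x + kval y); rewrite linearD !kvalP addr0. Defined.
Definition ke_scale (a : A) (x : ker_mod) : ker_mod.
Proof. by exists (a *: kval x); rewrite linearZ /= kvalP scaler0. Defined.

Lemma ke_addA : associative ke_add.
Proof. by move=> x y z; apply: kval_inj; exact: addrA. Qed.
Lemma ke_addC : commutative ke_add.
Proof. by move=> x y; apply: kval_inj; exact: addrC. Qed.
Lemma ke_add0 : left_id ke_zero ke_add.
Proof. by move=> x; apply: kval_inj; exact: add0r. Qed.
Lemma ke_addN : left_inverse ke_zero ke_opp ke_add.
Proof. by move=> x; apply: kval_inj; exact: addNr. Qed.

HB.instance Definition _ := GRing.isZmodule.Build ker_mod
  ke_addA ke_addC ke_add0 ke_addN.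

Lemma ke_scaleA a b x : ke_scale a (ke_scale b x) = ke_scale (a * b) x.
Proof. by apply: kval_inj; exact: scalerA. Qed.
Lemma ke_scale1 : left_id 1 ke_scale.
Proof. by move=> x; apply: kval_inj; exact: scale1r. Qed.
Lemma ke_scaleDr : right_distributive ke_scale +%R.
Proof. by move=> a x y; apply: kval_inj; exact: scalerDr. Qed.
Lemma ke_scaleDl x : {morph ke_scale^~ x : a b / a + b}.
Proof. by move=> a b; apply: kval_inj; exact: scalerDl. Qed.

HB.instance Definition _ := GRing.Zmodule_isLmodule.Build A ker_mod
  ke_scaleA ke_scale1 ke_scaleDr ke_scaleDl.

Lemma kval_linear : linear kval. Proof. by []. Qed.
Definition ker_incl := mklin kval_linear.
End Kernel.

Section KernelFunctor.
Variables (A : pzRingType) (L : mod_functor A) (p : mod_aug L).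
Hypothesis fg : forall M : lmodType A, finitely_generated M -> finitely_generated (ker_mod (p M)).

Definition ker_map_fun (M N : lmodType A) (f : {linear M -> N}) (x : ker_mod (p M)) :
  ker_mod (p N).
Proof. by exists (mmap L f (kval x)); rewrite maug_nat kvalP linear0. Defined.

Lemma ker_map_linear (M N : lmodType A) (f : {linear M -> N}) : linear (ker_map_fun f).
Proof. by move=> a x y; apply: kval_inj; exact: linearP. Qed.

Definition ker_functor : mod_functor A.
Proof.
apply: (@ModFunctor A (fun M => ker_mod (p M)) (fun M N f => mklin (ker_map_linear f))) => //.
- by move=> M f e x; apply: kval_inj; exact: mmap_id.
- by move=> M N P g f h e x; apply: kval_inj; exact: mmap_comp.
- by move=> M N f g h e x; apply: kval_inj; exact: mmapD.
Defined.

Definition ker_nat : mod_nat ker_functor L.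
Proof. by exists (fun M => ker_incl (p M)). Defined.

End KernelFunctor.

Section Cokernel.
Variables (A : pzRingType) (N : mod_functor A) (i : mod_coaug N).
Variable rho : forall M : lmodType A, N M -> M.
Hypothesis rhoD : forall (M : lmodType A) (x y : N M), rho (x + y) = rho x + rho y.
Hypothesis rhoK : forall (M : lmodType A) (x : M), rho (i M x) = x.
Hypothesis rho_nat : forall (M M' : lmodType A) (f : {linear M -> M'}) x,
  rho (mmap N f x) = f (rho x).

Let rho0 (M : lmodType A) : rho (0 : N M) = 0.
Proof. by apply: (addrI (rho (0 : N M))); rewrite -rhoD !addr0. Qed.
Let rhoN (M : lmodType A) (x : N M) : rho (- x) = - rho x.
Proof. by apply/eqP; rewrite -addr_eq0 -rhoD addNr rho0. Qed.
Let rhoB (M : lmodType A) (x y : N M) : rho (x - y) = rho x - rho y.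
Proof. by rewrite rhoD rhoN. Qed.

(* The cokernel of [i], carried by the kernel of the additive retraction [rho]. *)
Section Module.
Variable M : lmodType A.

Record coker_mod := CokerMod { cval : N M; cvalP : rho cval = 0 }.

Lemma cval_inj : injective cval.
Proof.
by case=> x hx [y hy] /= e; subst y; congr CokerMod; apply: Prop_irrelevance.
Qed.

HB.instance Definition _ := gen_eqMixin coker_mod.
HB.instance Definition _ := gen_choiceMixin coker_mod.

Definition coker_class (x : N M) : coker_mod.
Proof. by exists (x - i M (rho x)); rewrite rhoB rhoK subrr. Defined.

Definition co_zero := CokerMod (rho0 M).
Definition co_opp (x : coker_mod) : coker_mod.
Proof. by exists (- cval x); rewrite rhoN cvalP oppr0. Defined.
Definition co_add (x y : coker_mod) : coker_mod.
Proof. by exists (cval x + cval y); rewrite rhoD !cvalP addr0. Defined.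
(** The kernel of the additive map [rho] need not be a submodule, so a multiple is brought back into
    it modulo the image of [i]. *)
Definition co_scale (a : A) (x : coker_mod) : coker_mod := coker_class (a *: cval x).

Lemma co_addA : associative co_add.
Proof. by move=> x y z; apply: cval_inj; exact: addrA. Qed.
Lemma co_addC : commutative co_add.
Proof. by move=> x y; apply: cval_inj; exact: addrC. Qed.
Lemma co_add0 : left_id co_zero co_add.
Proof. by move=> x; apply: cval_inj; exact: add0r. Qed.
Lemma co_addN : left_inverse co_zero co_opp co_add.
Proof. by move=> x; apply: cval_inj; exact: addNr. Qed.

HB.instance Definition _ := GRing.isZmodule.Build coker_mod
  co_addA co_addC co_add0 co_addN.

Lemma co_scaleA a b x : co_scale a (co_scale b x) = co_scale (a * b) x.
Proof.
apply: cval_inj; rewrite /= scalerBr scalerA rhoB linearB /= -linearZ rhoK.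
by rewrite opprB addrA subrK.
Qed.
Lemma co_scale1 : left_id 1 co_scale.
Proof. by move=> x; apply: cval_inj; rewrite /= scale1r cvalP linear0 subr0. Qed.
Lemma co_scaleDr : right_distributive co_scale +%R.
Proof.
by move=> a x y; apply: cval_inj; rewrite /= scalerDr rhoD linearD opprD addrACA.
Qed.
Lemma co_scaleDl x : {morph co_scale^~ x : a b / a + b}.
Proof.
by move=> a b; apply: cval_inj; rewrite /= scalerDl rhoD linearD opprD addrACA.
Qed.

HB.instance Definition _ := GRing.Zmodule_isLmodule.Build A coker_mod
  co_scaleA co_scale1 co_scaleDr co_scaleDl.

Lemma coker_class_linear : linear coker_class.
Proof.
move=> a x y; apply: cval_inj; rewrite /= rhoD linearD opprD addrACA; congr (_ + _).
by rewrite scalerBr rhoB -linearZ rhoK linearB opprB addrA subrK.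
Qed.

Definition coker_proj := mklin coker_class_linear.
End Module.

Section Map.
Variables (M M' : lmodType A) (f : {linear M -> M'}).

Definition coker_map_fun (x : coker_mod M) : coker_mod M'.
Proof. by exists (mmap N f (cval x)); rewrite rho_nat cvalP linear0. Defined.

Lemma coker_map_linear : linear coker_map_fun.
Proof.
move=> a x y; apply: cval_inj.
by rewrite /= linearD linearB linearZ /= -mcoaug_nat -rho_nat linearZ.
Qed.
End Map.

Hypothesis fg : forall M : lmodType A, finitely_generated M -> finitely_generated (N M).

Definition coker_functor : mod_functor A.
Proof.
apply: (@ModFunctor A (fun M => coker_mod M) (fun M N f => mklin (coker_map_linear f))).
- by move=> M f e x; apply: cval_inj; exact: mmap_id.
- by move=> M N' P g f h e x; apply: cval_inj; exact: mmap_comp.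
- by move=> M N' f g h e x; apply: cval_inj; exact: mmapD.
move=> M /fg[n [g hg]]; exists n, (fun j => coker_proj M (g j)) => x.
have [c ec] := hg (cval x); exists c.
have -> : x = coker_proj M (cval x).
  by apply: cval_inj; rewrite /= cvalP linear0 subr0.
rewrite ec linear_sum; apply: eq_bigr => j _; exact: linearZ.
Defined.

Definition coker_nat : mod_nat N coker_functor.
Proof.
exists (fun M => coker_proj M) => M M' f x; apply: cval_inj.
by rewrite /= rho_nat mcoaug_nat linearB.
Defined.

End Cokernel.

(** * The completed algebra in path coordinates *)

Section Combinatorics.
Variable Q : gentle_order_quiver.
Local Notation S := (@sigma Q).
Implicit Types (a b c d : Q1 Q) (i : Q0 Q).

Lemma tgt_sigma a : tgt a = src (S a).
Proof. by have := sigmaP a (S a); rewrite eqxx => /andP[/eqP->]. Qed.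

Lemma zrelE d c : zrel d c = (src d == src (S c)) && (d != S c).
Proof.
have := sigmaP c d; rewrite tgt_sigma (eq_sym (S c)).
case z: (zrel d c); last by case: eqP => //= _; case: eqP.
by rewrite (zrel_comp z) tgt_sigma eqxx => /= <-.
Qed.

Lemma vertex_cases i :
  (i \in transition Q /\ exists2 a, src a = i & forall b, src b = i -> b = a) \/
  (i \notin transition Q /\ exists a b, [/\ a != b, src a = i, src b = i &
     forall c, src c = i -> c = a \/ c = b]).
Proof.
have tr : i \in transition Q -> exists2 a, src a = i & forall b, src b = i -> b = a.
  rewrite inE => /existsP[a' /existsP[a /and3P[_ /eqP E _]]].
  have h b : (src b == i) = (b == a).
    by have := congr1 (fun X : {set _} => b \in X) E; rewrite !inE.
  by exists a => [|b /eqP]; [apply/eqP; rewrite h|rewrite h => /eqP].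
have [ti|ti] := boolP (i \in transition Q); [by left; split; last exact: tr|right].
split=> //; have := goq_vertices i; rewrite in_setU (negbTE ti) inE.
move=> /existsP[a1 /existsP[a2 /existsP[b1 /existsP[b2 /and5P[_ nb _ /eqP E _]]]]].
have h b : (src b == i) = (b == b1) || (b == b2).
  by have := congr1 (fun X : {set _} => b \in X) E; rewrite !inE.
exists b1, b2; split=> // [||c /eqP]; try by apply/eqP; rewrite h eqxx ?orbT.
by rewrite h => /orP[] /eqP; [left|right].
Qed.

Lemma out_arrow i : exists a, src a = i.
Proof. by case: (vertex_cases i) => [[_ [a e _]]|[_ [a [b [_ e _ _]]]]]; exists a. Qed.

(** At a transition vertex there is no second arrow and the default value is [a] itself. Thus
    [partner] is an involution of all arrows whose fixed points are the arrows starting at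
    transition vertices. *)
Definition partner a : Q1 Q := odflt a [pick b | (src b == src a) && (b != a)].

Lemma src_partner a : src (partner a) = src a.
Proof. by rewrite /partner; case: pickP => //= b /andP[/eqP]. Qed.

Lemma partner_cases a b : src b = src a -> b = a \/ b = partner a.
Proof.
move=> e; have [->|ne] := eqVneq b a; [by left|right].
rewrite /partner; case: pickP => [c /andP[/eqP ec nc]|/(_ b)] /=; last by rewrite e eqxx ne.
case: (vertex_cases (src a)) => [[_ [a' _ h]]|[_ [x [y [nxy _ _ h]]]]].
  by rewrite (h b e) (h a erefl) eqxx in ne.
move: ne nc; case: (h a erefl) => ->; case: (h b e) => ->; case: (h c ec) => ->;
  by rewrite ?eqxx.
Qed.

Lemma partner_eq a : (partner a == a) = (src a \in transition Q).
Proof.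
case: (vertex_cases (src a)) => [[ti [a' _ h]]|[ti [x [y [nxy ex ey h]]]]].
  by rewrite ti (h a erefl) (h (partner a')) ?eqxx // src_partner -(h a erefl).
rewrite (negbTE ti) /partner; case: pickP => [c /andP[_ /negbTE]//|no].
have := no x; have := no y; rewrite ex ey eqxx /=.
by case: (h a erefl) => ->; rewrite eqxx //= ?nxy // eq_sym nxy.
Qed.

Lemma partnerK : involutive partner.
Proof.
move=> a; case: (@partner_cases (partner a) a); rewrite ?src_partner // => e.
by rewrite -[in LHS]e -e.
Qed.

(* [nxt] follows forbidden paths and also runs through transition vertices.  So it is
   a permutation of the arrows, and kappa is its first return map to the arrows that
   start at transition vertices. *)
Definition nxt a : Q1 Q := partner (S a).

Lemma nxt_inj : injective nxt.
Proof. by move=> a b /(inv_inj partnerK)/sigma_inj. Qed.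

Lemma src_nxt a : src (nxt a) = tgt a.
Proof. by rewrite src_partner tgt_sigma. Qed.

Lemma zrel_nxt d c : zrel d c = (d == nxt c) && (src d \notin transition Q).
Proof.
rewrite zrelE; apply/andP/andP => [[/eqP e n]|[/eqP->]]; last first.
  rewrite /nxt src_partner -partner_eq => n; split=> //.
have [en|ed] := partner_cases e; first by rewrite en eqxx in n.
by rewrite ed eqxx src_partner -partner_eq -ed.
Qed.

Lemma zrel_ex c : tgt c \notin transition Q -> zrel (nxt c) c.
Proof. by rewrite zrel_nxt eqxx src_nxt. Qed.

Definition prv : Q1 Q -> Q1 Q := finv nxt.

Lemma prvK c : nxt (prv c) = c. Proof. exact: f_finv nxt_inj c. Qed.
Lemma nxtK c : prv (nxt c) = c. Proof. exact: finv_f nxt_inj c. Qed.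

Lemma tgt_prv c : tgt (prv c) = src c.
Proof. by rewrite -src_nxt prvK. Qed.

Lemma zrel_prv c : src c \notin transition Q -> zrel c (prv c).
Proof. by move=> h; rewrite -{1}(prvK c) zrel_ex ?tgt_prv. Qed.

Lemma trans_in c d : tgt c \in transition Q -> tgt d = tgt c -> c = d.
Proof.
move=> h e; apply: nxt_inj.
case: (vertex_cases (tgt c)) => [[_ [a _ ha]]|[/negP//]].
by rewrite (ha (nxt c)) ?src_nxt // (ha (nxt d)) ?src_nxt.
Qed.

Lemma trans_out c d : src c \in transition Q -> src d = src c -> c = d.
Proof.
move=> h e; case: (vertex_cases (src c)) => [[_ [a _ ha]]|[/negP//]].
by rewrite (ha c) // (ha d).
Qed.

Definition ord a := order S a.

Lemma ord_gt0 a : (0 < ord a)%N. Proof. exact: order_gt0. Qed.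

Lemma ord_iter n a : ord (iter n S a) = ord a.
Proof.
rewrite /ord -[RHS]size_orbit.
apply: (order_cycle (cycle_orbit (@sigma_inj Q) a) (orbit_uniq _ _)).
by rewrite -fconnect_orbit fconnect_iter.
Qed.

Lemma iter_ord m a : iter (m * ord a) S a = a.
Proof.
elim: m => // m IH; rewrite mulSn iterD IH; exact: iter_order (@sigma_inj Q) a.
Qed.

End Combinatorics.

Section PathCoefficients.
Variables (k : fieldType) (Q : gentle_order_quiver).
Local Notation L := (completed_alg k Q).
Local Notation S := (@sigma Q).
Implicit Types (a b c d : Q1 Q) (i : Q0 Q) (f g : L).

(* The permitted paths of length n > 0 correspond to their first arrows a; for n = 0
   the trivial path at [src a] is meant, so two arrows give the same coefficient. *)
Definition pc f a n : k := coef f (src a) (traject S a n).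
Arguments pc f a n%_N.

Lemma permitted_traject a n : permitted (src a) (traject S a n).
Proof. by case: n => // n; rewrite trajectS permittedE eqxx fpath_traject. Qed.

Lemma path_end_traject a n : path_end (src a) (traject S a n) = src (iter n S a).
Proof.
case: n => // n.
by rewrite /path_end trajectS /= last_map last_traject tgt_sigma -iterS.
Qed.

Lemma permittedP i s : permitted i s -> exists a, src a = i /\ s = traject S a (size s).
Proof.
case: s => [_|a s]; first by have [a <-] := out_arrow i; exists a.
rewrite permittedE => /andP[/eqP <- fp]; exists a; split=> //.
by have /fpathP[n ->] := fp; rewrite /= size_traject -trajectS.
Qed.

Lemma pcP f g : (forall a n, pc f a n = pc g a n) -> f = g.
Proof. by move=> e; apply: algP => i s /permittedP[a [<- ->]]; exact: e. Qed.

Lemma pc_src0 f a b : src a = src b -> pc f a 0 = pc f b 0.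
Proof. by rewrite /pc /= => ->. Qed.

(** A trivial path takes its coefficient from an arbitrary arrow that starts at its vertex; hence
    the compatibility required in [pc_of_pc]. *)
Definition of_pc (u : Q1 Q -> nat -> k) : L := mk_alg (fun i s =>
  if s is a :: _ then u a (size s)
  else if [pick a | src a == i] is Some a then u a 0%N else 0).

Lemma pc_of_pc u : (forall a b, src a = src b -> u a 0%N = u b 0%N) ->
  forall a n, pc (of_pc u) a n = u a n.
Proof.
move=> h a n; rewrite /pc mk_algE ?permitted_traject //.
case: n => [|n] /=; last by rewrite size_traject.
by case: pickP => [b /eqP/h//|/(_ a)]; rewrite eqxx.
Qed.

Lemma pcD f g a n : pc (f + g) a n = pc f a n + pc g a n.
Proof. exact: alg_coefD. Qed.
Lemma pc0 a n : pc 0 a n = 0.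
Proof. by rewrite /pc /coef /=; case: ifP. Qed.
Lemma pcN f a n : pc (- f) a n = - pc f a n.
Proof. by apply/eqP; rewrite -addr_eq0 -pcD addNr pc0. Qed.
Lemma pcB f g a n : pc (f - g) a n = pc f a n - pc g a n.
Proof. by rewrite pcD pcN. Qed.
Lemma pc_sum (I : Type) (r : seq I) (P : pred I) (F : I -> L) a n :
  pc (\sum_(i <- r | P i) F i) a n = \sum_(i <- r | P i) pc (F i) a n.
Proof. by apply: (big_morph (fun f => pc f a n)) => [f g|]; [exact: pcD|exact: pc0]. Qed.
Lemma pcZ (x : k) f a n : pc (x *: f) a n = x * pc f a n.
Proof. exact: alg_coefZ. Qed.
Lemma pc1 a n : pc 1 a n = (n == 0)%N%:R.
Proof. by rewrite /pc alg_coef1 -size_eq0 size_traject. Qed.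

Lemma drop_traject a n j : (j <= n)%N -> drop j (traject S a n) = traject S (iter j S a) (n - j).
Proof.
move=> le; rewrite -{1}(subnKC le) trajectD drop_cat size_traject.
by rewrite ltnn subnn drop0.
Qed.

Lemma pcM f g a n :
  pc (f * g) a n = \sum_(j < n.+1) pc f (iter j S a) (n - j) * pc g a j.
Proof.
rewrite /pc alg_coefM ?permitted_traject // size_traject big_mkord.
apply: eq_bigr => -[j /= lt] _; rewrite ltnS in lt.
by rewrite take_traject // path_end_traject drop_traject.
Qed.

Lemma pcM0 f g a : pc (f * g) a 0 = pc f a 0 * pc g a 0.
Proof. by rewrite pcM big_ord_recl big_ord0 addr0. Qed.

Lemma pc_idem i a n : pc (idem k i) a n = ((src a == i) && (n == 0)%N)%:R.
Proof. by rewrite /pc mk_algE ?permitted_traject // -size_eq0 size_traject. Qed.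

Lemma pc_arrow c a n : pc (arrow k c) a n = ((a == c) && (n == 1)%N)%:R.
Proof.
rewrite /pc mk_algE ?permitted_traject //; congr (_%:R).
case: n => [|[|n]] /=; rewrite ?andbF ?andbT //; last by rewrite eqseq_cons /= !andbF.
rewrite eqseq_cons eqxx andbT; case: (a =P c) => [->|_]; last by rewrite andbF.
by rewrite eqxx.
Qed.

Lemma pc_idemM i f a n : pc (idem k i * f) a n = (src (iter n S a) == i)%:R * pc f a n.
Proof.
rewrite pcM big_ord_recr /= subnn pc_idem eqxx andbT big1 ?add0r // => -[j /= lt] _.
by rewrite pc_idem subn_eq0 leqNgt lt andbF mul0r.
Qed.

Lemma pc_Midem i f a n : pc (f * idem k i) a n = (src a == i)%:R * pc f a n.
Proof.
rewrite pcM big_ord_recl /= subn0 pc_idem eqxx andbT mulrC big1 ?addr0 // => j _.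
by rewrite pc_idem andbF mulr0.
Qed.

Lemma pc_arrowM0 c f a : pc (arrow k c * f) a 0 = 0.
Proof. by rewrite pcM0 pc_arrow andbF mul0r. Qed.

Lemma pc_arrowM c f a n : pc (arrow k c * f) a n.+1 = (iter n S a == c)%:R * pc f a n.
Proof.
rewrite pcM big_ord_recr /= subnn pc_arrow andbF mul0r addr0.
rewrite big_ord_recr /= subSnn pc_arrow andbT big1 ?add0r // => -[j /= lt] _.
by rewrite pc_arrow eqn_leq (leqNgt _ 1) ltn_subRL addn1 ltnS lt andbF mul0r.
Qed.

Lemma pc_Marrow0 c f a : pc (f * arrow k c) a 0 = 0.
Proof. by rewrite pcM0 pc_arrow andbF mulr0. Qed.

Lemma pc_Marrow c f a n : pc (f * arrow k c) a n.+1 = (a == c)%:R * pc f (S c) n.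
Proof.
rewrite pcM big_ord_recl /= pc_arrow andbF mulr0 add0r.
rewrite big_ord_recl /= pc_arrow andbT subn1 /= big1 ?addr0 => [|j _].
  by case: eqP => [->|_]; rewrite ?mulr1 ?mul1r // mulr0 mul0r.
by rewrite pc_arrow andbF mulr0.
Qed.

Lemma idem_sum : \sum_i idem k i = 1 :> L.
Proof.
apply: pcP => a n; rewrite pc_sum pc1 (bigD1 (src a)) //= pc_idem eqxx /=.
by rewrite big1 ?addr0 // => i ne; rewrite pc_idem eq_sym (negbTE ne).
Qed.

Lemma idemM i j : idem k i * idem k j = (i == j)%:R *: idem k i :> L.
Proof.
apply: pcP => a n; rewrite pc_idemM pcZ !pc_idem.
case: n => [|n]; last by rewrite !andbF !mulr0.
rewrite !andbT /= -!natrM !mulnb; congr (_%:R); congr nat_of_bool.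
by case: (src a =P i) => [->|]; rewrite ?andbT ?andbF.
Qed.

Lemma idem_idem i : idem k i * idem k i = idem k i :> L.
Proof. by rewrite idemM eqxx scale1r. Qed.

Lemma arrow_src c : arrow k c * idem k (src c) = arrow k c :> L.
Proof.
apply: pcP => a n; rewrite pc_Midem pc_arrow.
by case: (a =P c) => [->|_]; rewrite ?eqxx ?mul1r ?mulr0.
Qed.

Lemma arrow_tgt c : idem k (tgt c) * arrow k c = arrow k c :> L.
Proof.
apply: pcP => a n; rewrite pc_idemM pc_arrow.
case: (a =P c) => [->|_]; last by rewrite mulr0.
by case: n => [|[|n]] /=; rewrite ?mulr0 // tgt_sigma eqxx mulr1.
Qed.

Lemma zrel_arrow d c : zrel d c -> arrow k d * arrow k c = 0 :> L.
Proof.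
rewrite zrelE => /andP[_ n]; apply: pcP => a [|m]; rewrite pc0; first by rewrite pc_Marrow0.
by rewrite pc_Marrow pc_arrow [_ == d]eq_sym (negbTE n) mulr0.
Qed.

(** Cycles that are not composable without a zero relation multiply to zero, so the m-th power only
    contains the m-fold turns of the permitted cycles, each once. *)
Lemma pc_cycle_sumX m a n : pc (cycle_sum k Q ^+ m) a n = (n == (m * ord a)%N)%:R.
Proof.
have E b l : pc (cycle_sum k Q) b l = (l == ord b)%:R.
  rewrite /pc coef_cycle_sum; case: l => [|l].
    by case: (ord b) (ord_gt0 b).
  by rewrite trajectS permitted_cycleE -?trajectS ?permitted_traject // size_traject eq_sym.
elim: m n => [|m IH] n; first by rewrite expr0 pc1 mul0n.
rewrite exprSr pcM mulSn; have [le|lt] := leqP (ord a) n.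
  rewrite (bigD1 (Ordinal (le : (ord a < n.+1)%N))) //= E eqxx mulr1.
  rewrite big1 ?addr0 => [|j ne]; last first.
    by rewrite E (negbTE (_ : nat_of_ord j != ord a)) ?mulr0.
  have -> : iter (ord a) S a = a by rewrite -[ord a]mul1n iter_ord.
  by rewrite IH -(eqn_add2l (ord a)) subnKC.
rewrite big1 => [|[j /= lj] _].
  by case: eqP lt => // ->; rewrite ltnNge leq_addr.
by rewrite E; case: eqP => [e|]; rewrite ?mulr0 //; move: lj; rewrite e ltnS leqNgt lt.
Qed.

Lemma pc_order_map r a n :
  pc (order_map Q r) a n = if (ord a %| n)%N then pcoef r (n %/ ord a)%N else 0.
Proof.
rewrite /pc mk_algE ?permitted_traject // size_traject big_mkord.
transitivity (\sum_(m < n.+1) pcoef r m * (n == m * ord a)%N%:R).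
  by apply: eq_bigr => m _; rewrite -pc_cycle_sumX.
case: ifP => [/dvdnP[q e]|nd].
  have lq : (q < n.+1)%N by rewrite ltnS e leq_pmulr // ord_gt0.
  rewrite (bigD1 (Ordinal lq)) //= big1 ?addr0 => [|m ne].
    by rewrite e eqxx mulr1 mulnK ?ord_gt0.
  by rewrite [X in X == _]e eqn_pmul2r ?ord_gt0 // eq_sym (negbTE (_ : nat_of_ord m != q)) ?mulr0.
rewrite big1 // => m _; case: eqP => [e|]; rewrite ?mulr0 //.
by rewrite e dvdn_mull // in nd.
Qed.

Lemma sum_multiples o (F : nat -> k) n : (0 < o)%N ->
  \sum_(j < n.+1) (if (o %| j)%N then F (j %/ o)%N else 0) = \sum_(m < (n %/ o).+1) F m.
Proof.
move=> o0; elim: n => [|n IH]; first by rewrite big_ord1 dvdn0 div0n big_ord1.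
rewrite big_ord_recr /= IH divnS //; case: (o %| n.+1)%N => /=; last by rewrite addr0 add0n.
by rewrite !add1n [RHS]big_ord_recr.
Qed.

Lemma pc_order_mapM r f a n : pc (order_map Q r * f) a n =
  \sum_(m < (n %/ ord a).+1) pcoef r m * pc f a (n - m * ord a).
Proof.
rewrite order_map_central pcM -(sum_multiples (fun m => pcoef r m * pc f a (n - m * ord a))) ?ord_gt0 //.
apply: eq_bigr => j _; rewrite pc_order_map; case: ifP => [/dvdnP[q e]|_]; last by rewrite mulr0.
by rewrite e mulnK ?ord_gt0 // iter_ord mulrC.
Qed.

Lemma order_mapD r r' : order_map Q (r + r') = order_map Q r + order_map Q r' :> L.
Proof.
by apply: pcP => a n; rewrite pcD !pc_order_map; case: ifP => //; rewrite addr0.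
Qed.

Lemma order_map1 : order_map Q 1 = 1 :> L.
Proof.
apply: pcP => a n; rewrite pc_order_map pc1 /=; case: ifP => [/dvdnP[q ->]|].
  by rewrite mulnK ?ord_gt0 // muln_eq0 (negbTE (lt0n_neq0 (ord_gt0 a))) orbF.
by case: n => //; rewrite dvdn0.
Qed.

Lemma order_mapM r r' : order_map Q (r * r') = order_map Q r * order_map Q r' :> L.
Proof.
apply: pcP => a n; rewrite pc_order_mapM pc_order_map; case: ifP => [/dvdnP[q ->]|nd].
  rewrite mulnK ?ord_gt0 //=; apply: eq_bigr => m _.
  by rewrite pc_order_map -mulnBl dvdn_mull // mulnK // ord_gt0.
rewrite big1 // => m _; rewrite pc_order_map dvdn_subl ?dvdn_mull ?nd ?mulr0 //.
by rewrite -leq_divRL ?ord_gt0 // -ltnS.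
Qed.

Lemma order_map0 : order_map Q 0 = 0 :> L.
Proof. by apply: (addrI (order_map Q 0)); rewrite -order_mapD !addr0. Qed.
Lemma order_mapN r : order_map Q (- r) = - order_map Q r :> L.
Proof. by apply/eqP; rewrite -addr_eq0 -order_mapD addNr order_map0. Qed.

End PathCoefficients.

(** * Division by arrows, annihilators, and membership in I(X) *)

Section Division.
Variables (k : fieldType) (Q : gentle_order_quiver).
Local Notation L := (completed_alg k Q).
Local Notation S := (@sigma Q).
Implicit Types (a b c d : Q1 Q) (i : Q0 Q) (f g y : L).

(* [rdiv c f * arrow k c] is the part of [f] supported on paths starting with [c]. *)
Definition rdiv c f : L := of_pc (fun a n =>
  if n is m.+1 then (a == S c)%:R * pc f c n.+1 else (src a == tgt c)%:R * pc f c 1).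

Lemma pc_rdiv c f a n : pc (rdiv c f) a n =
  if n is m.+1 then (a == S c)%:R * pc f c n.+1 else (src a == tgt c)%:R * pc f c 1.
Proof. by rewrite pc_of_pc // => a1 b1 ->. Qed.

Lemma pc_rdiv_sigma c f n : pc (rdiv c f) (S c) n = pc f c n.+1.
Proof. by rewrite pc_rdiv; case: n => [|n]; rewrite -?tgt_sigma eqxx mul1r. Qed.

Lemma rdivD c f g : rdiv c (f + g) = rdiv c f + rdiv c g.
Proof. by apply: pcP => a [|n]; rewrite pcD !pc_rdiv pcD mulrDr. Qed.

Lemma rdiv_idem c f : rdiv c f * idem k (tgt c) = rdiv c f.
Proof.
apply: pcP => a n; rewrite pc_Midem pc_rdiv; case: n => [|n].
  by rewrite mulrA -natrM mulnb andbb.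
case: (a =P S c) => [->|_]; last by rewrite !mul0r mulr0.
by rewrite tgt_sigma eqxx mul1r.
Qed.

Lemma pc_rdivK0 c f a : pc (rdiv c f * arrow k c) a 0 = 0.
Proof. exact: pc_Marrow0. Qed.

Lemma pc_rdivK c f a n : pc (rdiv c f * arrow k c) a n.+1 = (a == c)%:R * pc f c n.+1.
Proof. by rewrite pc_Marrow pc_rdiv_sigma. Qed.

(** Mirror image of [rdiv]: it strips the last arrow [c] from the paths of [f] that end with [c]. *)
Definition ldiv c f : L := of_pc (fun a n =>
  if n is m.+1 then (iter n S a == c)%:R * pc f a n.+1 else (src a == src c)%:R * pc f c 1).

Lemma pc_ldiv c f a n : pc (ldiv c f) a n =
  if n is m.+1 then (iter n S a == c)%:R * pc f a n.+1 else (src a == src c)%:R * pc f c 1.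
Proof. by rewrite pc_of_pc // => a1 b1 ->. Qed.

Lemma pc_ldivK0 c f a : pc (arrow k c * ldiv c f) a 0 = 0.
Proof. exact: pc_arrowM0. Qed.

Lemma pc_ldivK c f a n :
  pc (arrow k c * ldiv c f) a n.+1 = (iter n S a == c)%:R * pc f a n.+1.
Proof.
rewrite pc_arrowM pc_ldiv; case: n => [|n] /=; last by rewrite mulrA -natrM mulnb andbb.
by case: (a =P c) => [->|_]; rewrite ?mul0r // eqxx !mul1r.
Qed.

Lemma ldivD c f g : ldiv c (f + g) = ldiv c f + ldiv c g.
Proof. by apply: pcP => a [|n]; rewrite pcD !pc_ldiv !pcD mulrDr. Qed.

Lemma idem_ldiv c f : idem k (src c) * ldiv c f = ldiv c f.
Proof.
apply: pcP => a n; rewrite pc_idemM pc_ldiv; case: n => [|n] /=.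
  by rewrite mulrA -natrM mulnb andbb.
by case: (S (iter n S a) =P c) => [->|_]; rewrite ?mul0r ?mulr0 // eqxx mul1r.
Qed.

(** Right multiplication by [c] keeps the coefficients of the trivial path and of the paths that
    begin with [S c]. If these vanish, only paths beginning with the other arrow, [nxt c],
    remain. *)
Lemma ann_right y c : y * idem k (tgt c) = y -> y * arrow k c = 0 ->
  y = rdiv (nxt c) y * arrow k (nxt c).
Proof.
move=> ye yc.
have y0 n : pc y (S c) n = 0.
  by have := pc_Marrow c y c n; rewrite yc pc0 eqxx mul1r.
have ya a n : src a != tgt c -> pc y a n = 0.
  by move=> na; rewrite -ye pc_Midem (negbTE na) mul0r.
apply: pcP => a n; case: (src a =P tgt c) => [e|/eqP ne]; last first.
  rewrite ya //; case: n => [|n]; rewrite ?pc_rdivK0 ?pc_rdivK //.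
  by case: (a =P nxt c) ne => [->|_]; rewrite ?mul0r // src_nxt eqxx.
case: n => [|n]; first by rewrite pc_rdivK0 (@pc_src0 _ _ _ _ (S c)) ?y0 // -tgt_sigma.
rewrite pc_rdivK /nxt; case: (a =P partner (S c)) => [->|ne]; first by rewrite mul1r.
case: (@partner_cases _ (S c) a) => [||//]; first by rewrite -tgt_sigma.
by move->; rewrite y0 mul0r.
Qed.

Lemma ann_left y c : idem k (src c) * y = y -> arrow k c * y = 0 ->
  y = arrow k (prv c) * ldiv (prv c) y.
Proof.
move=> ye yc.
have y0 a n : iter n S a = c -> pc y a n = 0.
  by move=> e; have := pc_arrowM c y a n; rewrite yc pc0 e eqxx mul1r.
have ya a n : src (iter n S a) != src c -> pc y a n = 0.
  by move=> na; rewrite -ye pc_idemM (negbTE na) mul0r.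
apply: pcP => a n; case: (src (iter n S a) =P src c) => [e|/eqP ne]; last first.
  rewrite ya //; case: n ne => [|n] /= ne; rewrite ?pc_ldivK0 ?pc_ldivK //.
  by case: (iter n S a =P prv c) ne => [->|_]; rewrite ?mul0r // -tgt_sigma tgt_prv eqxx.
case: n e => [|n] /= e; first by rewrite pc_ldivK0 (@pc_src0 _ _ _ _ c) // (y0 c 0).
rewrite pc_ldivK; case: (iter n S a =P prv c) => [_|ne]; first by rewrite mul1r.
case: (partner_cases e) => [/(y0 a n.+1)->|ep]; first by rewrite mul0r.
by case: ne; rewrite -(nxtK (iter n S a)) /nxt ep partnerK.
Qed.

Section Membership.
Variable X : {set Q0 Q}.

Lemma ideal_memP f :
  ideal_generated (ideal_gens X) f <-> (forall a, src a \in X -> pc f a 0 = 0).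
Proof.
split=> [|h].
  elim=> {f} [f [[i nX ->]|[c cX ->]]||f g _ hf _ hg|f g _ hg|f g _ hf] a aX.
  - by rewrite pc_idem andbT; case: eqP nX => // <-; rewrite aX.
  - by rewrite pc_arrow andbF.
  - exact: pc0.
  - by rewrite pcD hf // hg // addr0.
  - by rewrite pcM0 hg // mulr0.
  - by rewrite pcM0 hf // mul0r.
have -> : f = \sum_(i | i \notin X) f * idem k i
    + \sum_(a | src a \in X) rdiv a f * arrow k a.
  apply: pcP => a n; rewrite pcD !pc_sum.
  under eq_bigr => i _ do rewrite pc_Midem.
  have [aX|aX] := boolP (src a \in X).
    rewrite big1 ?add0r => [|i iX]; last first.
      by case: (src a =P i) iX => [<-|_]; rewrite ?mul0r // aX.
    case: n => [|n]; first by rewrite h // big1 // => c _; exact: pc_rdivK0.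
    rewrite (bigD1 a) //= pc_rdivK eqxx mul1r big1 ?addr0 // => c /andP[_ ne].
    by rewrite pc_rdivK eq_sym (negbTE ne) mul0r.
  rewrite (bigD1 (src a)) //= eqxx mul1r big1 => [|i /andP[_ ne]]; last first.
    by rewrite eq_sym (negbTE ne) mul0r.
  rewrite addr0 big1 ?addr0 // => c cX.
  case: n => [|n]; rewrite ?pc_rdivK0 ?pc_rdivK //.
  by case: (a =P c) cX => [<-|_]; rewrite ?mul0r // (negbTE aX).
have sum_ideal (I : finType) (P : pred I) (F : I -> L) :
    (forall s, P s -> ideal_generated (ideal_gens X) (F s)) ->
    ideal_generated (ideal_gens X) (\sum_(s | P s) F s).
  move=> hF; elim/big_ind: _; [exact: ideal_zero|by move=> x y; exact: ideal_add|exact: hF].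
by apply: ideal_add; apply: sum_ideal => s sX; apply: ideal_mull; apply: ideal_gen;
  [left|right]; exists s.
Qed.

Definition ideal_el f (h : forall a, src a \in X -> pc f a 0 = 0) :
  gentle_ideal k X := IdealElt ((ideal_memP f).2 h).

Lemma ideal_el0 (x : gentle_ideal k X) a : src a \in X -> pc (ival x) a 0 = 0.
Proof. exact: (ideal_memP (ival x)).1 (ivalP x) a. Qed.

Lemma gentle_ideal_decomp (x : gentle_ideal k X) : ival x =
  \sum_i (if i \in X then 0 else ival x * idem k i)
    + \sum_a (if src a \in X then rdiv a (ival x) * arrow k a else 0).
Proof.
apply: pcP => a n; rewrite pcD !pc_sum (bigD1 (src a)) //= big1 ?addr0 => [|i ne]; last first.
  by case: ifP => _; rewrite ?pc0 // pc_Midem eq_sym (negbTE ne) mul0r.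
have [aX|aX] := boolP (src a \in X); last first.
  rewrite pc_Midem eqxx mul1r big1 ?addr0 // => c _; case: ifP => cX; last exact: pc0.
  case: n => [|n]; rewrite ?pc_rdivK0 ?pc_rdivK //.
  by case: (a =P c) cX => [<-|_]; rewrite ?mul0r // (negbTE aX).
rewrite pc0 add0r; case: n => [|n].
  rewrite ideal_el0 // big1 // => c _; case: ifP => _; rewrite ?pc0 //; exact: pc_rdivK0.
rewrite (bigD1 a) //= aX pc_rdivK eqxx mul1r big1 ?addr0 // => c ne.
by case: ifP => _; rewrite ?pc0 // pc_rdivK eq_sym (negbTE ne) mul0r.
Qed.

Lemma arrow_in c a : src a \in X -> pc (arrow k c) a 0 = 0.
Proof. by rewrite pc_arrow andbF. Qed.

Definition ideal_arrow c : gentle_ideal k X := ideal_el (@arrow_in c).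

Lemma idem_in i (iX : i \notin X) a : src a \in X -> pc (idem k i) a 0 = 0.
Proof. by rewrite pc_idem andbT => aX; case: eqP iX => // <-; rewrite aX. Qed.

Definition ideal_idem i (iX : i \notin X) : gentle_ideal k X := ideal_el (idem_in iX).

Lemma gentle_ideal_fg : finitely_generated (gentle_ideal k X).
Proof.
pose I := (Q0 Q + Q1 Q)%type.
pose ev : 'I_#|{: I}| -> I := enum_val.
(* The scalar turns the idempotents at vertices of X into zero, so that the generators can be
   indexed by all vertices. *)
have gen_in i a : src a \in X -> pc ((i \notin X)%:R *: idem k i) a 0 = 0.
  by move=> aX; rewrite pcZ pc_idem; case: eqP => [<-|_]; rewrite ?aX ?mul0r ?mulr0.
pose gen (s : I) : gentle_ideal k X := match s with
  | inl i => ideal_el (gen_in i)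
  | inr a => ideal_arrow a end.
exists #|{: I}|, (fun l => gen (ev l)) => x.
pose c (s : I) : L := match s with
  | inl i => if i \in X then 0 else ival x
  | inr a => if src a \in X then rdiv a (ival x) else 0 end.
exists (fun l => c (ev l)).
have -> : \sum_l c (ev l) *: gen (ev l) = \sum_s c s *: gen s.
  by rewrite [RHS](reindex ev) //; apply/onW_bij; exact: enum_val_bij.
apply: ival_inj; rewrite {1}gentle_ideal_decomp.
have -> : ival (\sum_s c s *: gen s) = \sum_s c s * ival (gen s) by exact: big_morph.
rewrite big_sumType /=; congr (_ + _); apply: eq_bigr => i _.
  by case: ifP => iX; rewrite ?mul0r //= ?iX scale1r.
by case: ifP; rewrite ?mul0r.
Qed.

End Membership.
End Division.

(** * Tensor products with the ideals I(X) *)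

Section TensorLift.
Variables (A : pzRingType) (B : bimodule A) (M : lmodType A).

Lemma pure_sum (I : Type) (r : seq I) (P : pred I) (F : I -> M) (b : B) :
  pure b (\sum_(i <- r | P i) F i) = \sum_(i <- r | P i) pure b (F i).
Proof. by apply: big_morph; [exact: pureDr|exact: pure0r]. Qed.

Lemma tensor_sum_pure (z : tensor B M) : exists s : seq (B * M), z = \sum_(p <- s) pure p.1 p.2.
Proof. by exists (repr z); rewrite -formal_sum formal_repr. Qed.

(* A functional that is balanced only up to multiples of [u] is well defined on
   the tensor product modulo [u M]. *)
Lemma tensor_rel_functional (phi : B -> A) (u : A) :
  (forall x y, phi (x + y) = phi x + phi y) ->
  (forall x a, exists t, phi (ract x a) = phi x * a + u * t) ->
  forall s t : seq (B * M), tensor_rel s t -> exists w,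
    \sum_(p <- s) phi p.1 *: p.2 - \sum_(p <- t) phi p.1 *: p.2 = u *: w.
Proof.
move=> phiD phiA s t.
have phi0 : phi 0 = 0 by apply: (addrI (phi 0)); rewrite -phiD !addr0.
elim=> {s t} [s|s t _ [w e]|s t v _ [w e] _ [w' e']|s s' t t' _ [w e] _ [w' e']|s t|m|b b' m|b m m'|b a m].
- by exists 0; rewrite subrr scaler0.
- by exists (- w); rewrite scalerN -e opprB.
- by exists (w + w'); rewrite scalerDr -e -e' addrA subrK.
- by exists (w + w'); rewrite scalerDr -e -e' !big_cat /= opprD addrACA.
- by exists 0; rewrite !big_cat /= [X in _ - X]addrC subrr scaler0.
- by exists 0; rewrite big_seq1 big_nil phi0 scale0r subrr scaler0.
- by exists 0; rewrite !big_cons !big_nil /= phiD scalerDl !addr0 subrr scaler0.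
- by exists 0; rewrite !big_cons !big_nil /= scalerDr !addr0 subrr scaler0.
have [t et] := phiA b a; exists (t *: m).
by rewrite !big_seq1 /= et scalerDl !scalerA addrAC subrr add0r.
Qed.

Lemma pure_functional (phi : B -> A) (u : A) (b : B) (m : M) :
  (forall x y, phi (x + y) = phi x + phi y) ->
  (forall x a, exists t, phi (ract x a) = phi x * a + u * t) ->
  pure b m = 0 -> exists w, phi b *: m = u *: w.
Proof.
move=> phiD phiA /formalP/(tensor_rel_functional phiD phiA)[w].
by rewrite big_seq1 big_nil subr0; exists w.
Qed.

Section Lift.
Variables (N : lmodType A) (beta : B -> M -> N).
Hypothesis betaDl : forall x y m, beta (x + y) m = beta x m + beta y m.
Hypothesis betaDr : forall x m m', beta x (m + m') = beta x m + beta x m'.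
Hypothesis beta_bal : forall x a m, beta (ract x a) m = beta x (a *: m).
Hypothesis betaZ : forall a x m, beta (a *: x) m = a *: beta x m.

Definition tensor_lift_fun (z : tensor B M) : N := \sum_(p <- repr z) beta p.1 p.2.

Lemma tensor_lift_formal s : tensor_lift_fun (formal s) = \sum_(p <- s) beta p.1 p.2.
Proof.
have beta0 m : beta 0 m = 0 by apply: (addrI (beta 0 m)); rewrite -betaDl !addr0.
rewrite /tensor_lift_fun; have := repr_formal s; move: (repr _) => t.
elim=> {s t} [s|s t _ h|s t v _ h _ h'|s s' t t' _ h _ h'|s t|m|b b' m|b m m'|b a m] //.
- by rewrite h h'.
- by rewrite !big_cat /= h h'.
- by rewrite !big_cat /= addrC.
- by rewrite big_seq1 big_nil beta0.
- by rewrite !big_cons !big_nil /= betaDl !addr0.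
- by rewrite !big_cons !big_nil /= betaDr !addr0.
- by rewrite !big_seq1 /= beta_bal.
Qed.

Lemma tensor_lift_linear : linear tensor_lift_fun.
Proof.
move=> a x y; rewrite -(formal_repr x) -(formal_repr y) [a *: _]ts_scaleE -formal_cat.
rewrite !tensor_lift_formal big_cat big_map /=; congr (_ + _).
by rewrite scaler_sumr; apply: eq_bigr => p _; rewrite betaZ.
Qed.

Definition tensor_lift : {linear tensor B M -> N} := mklin tensor_lift_linear.

Lemma tensor_lift_pure b m : tensor_lift (pure b m) = beta b m.
Proof. by rewrite [LHS]tensor_lift_formal big_seq1. Qed.

End Lift.
End TensorLift.

Section TensorFunctor.
Variables (A : pzRingType) (B : bimodule A) (Bfg : finitely_generated B).

Definition tensor_mod : mod_functor A.
Proof.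
apply: (@ModFunctor A (fun M => tensor B M) (fun M N f => tensor_map f : {linear _ -> _})).
- move=> M f e; apply: (@tensor_ext _ _ _ _ (tensor_map f) idfun) => b m.
  by rewrite /= tensor_map_pure e.
- move=> M N P g f h e.
  apply: (@tensor_ext _ _ _ _ (tensor_map h) (tensor_map g \o tensor_map f)%FUN) => b m.
  by rewrite /= !tensor_map_pure e.
- move=> M N f g h e z; have [s ->] := tensor_sum_pure z; rewrite !linear_sum -big_split /=.
  by apply: eq_bigr => p _; rewrite /= !tensor_map_pure e pureDr.
- by move=> M; exact: tensor_finitely_generated.
Defined.

Definition tensor_lift_nat : nat_trans (tensor_functor Bfg) (lift_functor tensor_mod).
Proof.
unshelve eexists.
  move=> X; apply: (@ChainMap _ (tensor_complex Bfg X) (lift_complex tensor_mod X)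
    (fun n => idfun : {linear tensor B (X n) -> tensor B (X n)})) => n x; exact: erefl.
by move=> X Y f n x.
Defined.

End TensorFunctor.

(** * Thread-exact modules and the adjunction between tensoring with I(X) and Hom(I(X), -) *)

Section Threads.
Variables (k : fieldType) (Q : gentle_order_quiver).
Local Notation L := (completed_alg k Q).
Local Notation S := (@sigma Q).
Local Notation tr := (transition Q).
Local Notation ar := (@arrow k Q).
Local Notation e_ := (@idem k Q).
Implicit Types (a b c d : Q1 Q) (i v : Q0 Q) (f g y : L).

(* The arrows annihilating c from the right and from the left; 0 if there is none. *)
Definition parr c : L := if src c \in tr then 0 else ar (prv c).
Definition narr c : L := if tgt c \in tr then 0 else ar (nxt c).

Lemma arrow_parr c : ar c * parr c = 0.
Proof.
by rewrite /parr; case: ifPn => [_|/zrel_prv z]; rewrite ?mulr0 // zrel_arrow.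
Qed.

Lemma narr_arrow c : narr c * ar c = 0.
Proof.
by rewrite /narr; case: ifPn => [_|/zrel_ex z]; rewrite ?mul0r // zrel_arrow.
Qed.

Lemma narr_prv c : src c \notin tr -> narr (prv c) = ar c.
Proof. by rewrite /narr tgt_prv prvK => /negbTE->. Qed.

Lemma parr_nxt c : tgt c \notin tr -> parr (nxt c) = ar c.
Proof. by rewrite /parr src_nxt nxtK => /negbTE->. Qed.

Lemma partner_tr c : src c \in tr -> partner c = c.
Proof. by rewrite -partner_eq => /eqP. Qed.

Lemma ann_right_narr y c : y * e_ (tgt c) = y -> y * ar c = 0 -> exists y', y = y' * narr c.
Proof.
move=> ye yc; have := ann_right ye yc; rewrite /narr; case: ifPn => [t e|_ e]; last by eexists; exact: e.
exists 0; rewrite mul0r e; apply: pcP => a n; rewrite pc0.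
case: n => [|n]; rewrite ?pc_rdivK0 ?pc_rdivK // /nxt partner_tr -?tgt_sigma //.
by have := pc_Marrow c y c n.+1; rewrite yc pc0 eqxx mul1r => <-; rewrite mulr0.
Qed.

Lemma ann_left_parr y c : e_ (src c) * y = y -> ar c * y = 0 -> exists y', y = parr c * y'.
Proof.
move=> ye yc; have := ann_left ye yc; rewrite /parr; case: ifPn => [t e|_ e]; last by eexists; exact: e.
exists 0; rewrite mul0r e; apply: pcP => a n; rewrite pc0.
case: n => [|n]; rewrite ?pc_ldivK0 ?pc_ldivK //; case: eqP => [p|_]; last by rewrite mul0r.
have es : iter n.+1 S a = c.
  by rewrite /= p -[RHS](prvK c) /nxt partner_tr // -tgt_sigma tgt_prv.
by have := pc_arrowM c y a n.+1; rewrite yc pc0 es eqxx !mul1r => <-.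
Qed.

Lemma ann_right_act (M : lmodType L) (n : M) y c :
  narr c *: n = 0 -> e_ (tgt c) *: n = n -> y * ar c = 0 -> y *: n = 0.
Proof.
move=> dn en yc; have [||y' ey] := @ann_right_narr (y * e_ (tgt c)) c.
- by rewrite -mulrA idem_idem.
- by rewrite -mulrA arrow_tgt.
by rewrite -en scalerA ey -scalerA dn scaler0.
Qed.

Lemma idem_decomp (M : lmodType L) (m : M) : m = \sum_v e_ v *: m.
Proof. by rewrite -scaler_suml idem_sum scale1r. Qed.

Lemma idemZK (M : lmodType L) (m : M) v : e_ v *: (e_ v *: m) = e_ v *: m.
Proof. by rewrite scalerA idem_idem. Qed.

Lemma arrow_idemZ (M : lmodType L) (m : M) c : ar c *: (e_ (src c) *: m) = ar c *: m.
Proof. by rewrite scalerA arrow_src. Qed.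

Lemma idem_arrowZ (M : lmodType L) (m : M) c : e_ (tgt c) *: (ar c *: m) = ar c *: m.
Proof. by rewrite scalerA arrow_tgt. Qed.

Lemma in_arrow i : exists c, tgt c = i.
Proof. by have [a <-] := out_arrow i; exists (prv a); rewrite tgt_prv. Qed.

Section Ideal.
Variable X : {set Q0 Q}.
Hypothesis X_tr : forall i, i \in X -> i \in tr.
Local Notation I := (gentle_ideal k X).
Local Notation T := (tensor I).
Local Notation arX c := (ideal_arrow k X c).

Lemma notin_tr i : i \notin tr -> i \notin X. Proof. exact/contraNN/X_tr. Qed.

Lemma arX_arrow c (h : src c \notin X) : arX c = ar c *: ideal_idem k h.
Proof. by apply: ival_inj; rewrite /= arrow_src. Qed.

Lemma arX_idem c (h : tgt c \notin X) : arX c = ract (ideal_idem k h) (ar c).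
Proof. by apply: ival_inj; rewrite /= arrow_tgt. Qed.

Lemma idem_ract v (h : v \notin X) (x : I) : ract x (e_ v) = ival x *: ideal_idem k h.
Proof. exact: ival_inj. Qed.

(** A vertex of X is a transition vertex, so [c] is the only arrow leaving it; since [x] has no
    constant term there, all its paths from this vertex begin with [c]. *)
Lemma arrow_ract c (x : I) : src c \in X -> ract x (e_ (src c)) = rdiv c (ival x) *: arX c.
Proof.
move=> cX; apply: ival_inj => /=; apply: pcP => a n; rewrite pc_Midem.
case: n => [|n]; rewrite ?pc_rdivK0 ?pc_rdivK //.
  by case: eqP => [e|_]; rewrite ?mul0r // ideal_el0 ?mulr0 // e.
case: (a =P c) => [->|ne]; first by rewrite eqxx.
by case: eqP => [e|_]; rewrite ?mul0r //; case: ne; apply/esym/trans_out => //; exact: X_tr.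
Qed.

Lemma idemZ_ideal v (h : v \notin X) (x : I) : e_ v *: x = ract (ideal_idem k h) (ival x).
Proof. exact: ival_inj. Qed.

Lemma arrow_ldiv c (x : I) : tgt c \in X -> ar c * ldiv c (ival x) = e_ (tgt c) * ival x.
Proof.
move=> cX; apply: pcP => a n; rewrite pc_idemM.
case: n => [|n] /=; rewrite ?pc_ldivK0 ?pc_ldivK //.
  by case: eqP => [e|_]; rewrite ?mul0r // ideal_el0 ?mulr0 // e.
rewrite -tgt_sigma; case: (iter n S a =P c) => [->|ne]; first by rewrite eqxx.
by case: eqP => [e|_]; rewrite ?mul0r //; case: ne; apply/esym/trans_in => //; exact: X_tr.
Qed.

Lemma idemZ_arrow c (x : I) : tgt c \in X -> e_ (tgt c) *: x = ract (arX c) (ldiv c (ival x)).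
Proof. by move=> cX; apply: ival_inj; rewrite /= arrow_ldiv. Qed.

Section Tensor.
Variable M : lmodType L.

Lemma tensor_idem v (h : v \notin X) (z : T M) :
  exists2 m, e_ v *: m = m & e_ v *: z = pure (ideal_idem k h) m.
Proof.
have [s ->] := tensor_sum_pure z.
exists (e_ v *: \sum_(p <- s) ival p.1 *: p.2); first exact: idemZK.
rewrite -pure_balanced [ract _ _](_ : _ = ideal_idem k h); last first.
  by apply: ival_inj; rewrite /= idem_idem.
rewrite pure_sum scaler_sumr; apply: eq_bigr => p _.
by rewrite -pureZ (idemZ_ideal h) pure_balanced.
Qed.

Lemma tensor_arrow c (z : T M) : tgt c \in X ->
  exists2 m, e_ (src c) *: m = m & e_ (tgt c) *: z = pure (arX c) m.
Proof.
move=> cX; have [s ->] := tensor_sum_pure z.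
exists (e_ (src c) *: \sum_(p <- s) ldiv c (ival p.1) *: p.2); first exact: idemZK.
rewrite -pure_balanced [ract _ _](_ : _ = arX c); last first.
  by apply: ival_inj; rewrite /= arrow_src.
rewrite pure_sum scaler_sumr; apply: eq_bigr => p _.
by rewrite -pureZ (idemZ_arrow _ cX) pure_balanced.
Qed.

Lemma pure_idem_eq0 v (h : v \notin X) (m : M) : pure (ideal_idem k h) m = 0 -> e_ v *: m = 0.
Proof.
move=> e; have [||w] := @pure_functional _ I M (fun x => e_ v * ival x) 0 _ _ _ _ e.
- by move=> x y; rewrite -mulrDr.
- by move=> x a; exists 0; rewrite mul0r addr0 /= mulrA.
by rewrite /= idem_idem scale0r.
Qed.

Lemma pure_arrow_eq0 c (m : M) : tgt c \in X -> e_ (src c) *: m = m ->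
  pure (arX c) m = 0 -> exists w, m = parr c *: w.
Proof.
move=> cX em e; have [||w] := @pure_functional _ I M (fun x => ldiv c (ival x)) (parr c) _ _ _ _ e.
- by move=> x y; rewrite -ldivD.
- move=> x a.
  have [||t et] := @ann_left_parr (ldiv c (ival x * a) - ldiv c (ival x) * a) c.
  + by rewrite mulrBr mulrA !idem_ldiv.
  + rewrite mulrBr mulrA (arrow_ldiv x cX) -mulrA.
    by rewrite (arrow_ldiv (ract x a) cX) subrr.
  by exists t; rewrite -et addrC subrK.
move=> ew; have [||y ey] := @ann_left_parr (ldiv c (ar c) - e_ (src c)) c.
- by rewrite mulrBr idem_ldiv idem_idem.
- by rewrite mulrBr (arrow_ldiv (arX c) cX) /= arrow_tgt arrow_src subrr.
exists (w - y *: m); rewrite scalerBr -ew scalerA -ey scalerBl em.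
by rewrite opprB addrC subrK.
Qed.

End Tensor.

Local Notation H := (hom_over I (fun=> True)).

Section Hom.
Variable N : lmodType L.

Lemma hom_idemE v (h : v \notin X) (phi : H N) x :
  e_ v *: phi = phi -> phi x = ival x *: phi (ideal_idem k h).
Proof.
move=> <-; rewrite !ho_scaleE (idem_ract h) hfunZ //; congr (_ *: phi _).
by apply: ival_inj; rewrite /= idem_idem.
Qed.

Lemma hom_arrowE c (phi : H N) x : src c \in X ->
  e_ (src c) *: phi = phi -> phi x = rdiv c (ival x) *: phi (arX c).
Proof.
move=> cX e; rewrite -{1}e ho_scaleE (arrow_ract _ cX) hfunZ //.
Qed.

Definition hom_mul (n : N) : H N.
Proof.
by exists (fun x => ival x *: n) => [x y|a x _]; rewrite ?scalerDl ?scalerA.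
Defined.

Lemma rdiv_mul_act c (n : N) y : narr c *: n = 0 -> e_ (tgt c) *: n = n ->
  rdiv c (y * ar c) *: n = y *: n.
Proof.
move=> dn en; apply/eqP; rewrite -subr_eq0 -scalerBl; apply/eqP/(ann_right_act dn en).
rewrite mulrBl; apply: pcP => a [|m]; rewrite pcB pc0 ?pc_rdivK0 ?pc_rdivK ?pc_Marrow0 ?subrr //.
by rewrite !pc_Marrow eqxx mul1r subrr.
Qed.

(** At a start of a thread, I(X) consists of the left multiples of [c], and a quotient by [c] is
    determined up to the left annihilator of [c], which is generated by [narr c] and kills [n]. *)
Definition hom_div c (n : N) (cX : src c \in X) (dn : narr c *: n = 0)
  (en : e_ (tgt c) *: n = n) : H N.
Proof.
exists (fun x => rdiv c (ival x) *: n) => [x y|a x _]; first by rewrite rdivD scalerDl.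
rewrite scalerA; apply/eqP; rewrite -subr_eq0 -scalerBl; apply/eqP/(ann_right_act dn en).
have E (z : I) : rdiv c (ival z) * ar c = ival z * e_ (src c).
  by have := congr1 (@ival _ _) (arrow_ract z cX).
by rewrite mulrBl -mulrA !E /= mulrA subrr.
Defined.

End Hom.

Variable F : pred (Q1 Q).

(* [F] is the set of arrows lying on the forbidden threads that join vertices of X. *)
Record thread_set := ThreadSet {
  thread_src : forall c, F c -> src c \notin X -> src c \notin tr /\ F (prv c);
  thread_tgt : forall c, F c -> tgt c \notin X -> tgt c \notin tr /\ F (nxt c);
  thread_out : forall c, src c \in X -> F c;
  thread_in : forall c, tgt c \in X -> F c;
  thread_rank : Q1 Q -> nat;
  thread_rankP : forall c, F c -> src c \notin X -> (thread_rank (prv c) < thread_rank c)%N;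
  thread_corank : Q1 Q -> nat;
  thread_corankP : forall c, F c -> tgt c \notin X ->
    (thread_corank (nxt c) < thread_corank c)%N }.

(* Exactness of multiplication by consecutive arrows of the threads at their inner
   vertices: this is what I(X) (x) - needs to behave like an exact functor. *)
Definition left_exact (M : lmodType L) : Prop := forall c, F c -> tgt c \notin tr ->
  forall m : M, e_ (src c) *: m = m -> ar c *: m = 0 -> exists w, m = parr c *: w.

Definition right_exact (N : lmodType L) : Prop := forall c, F c -> src c \notin tr ->
  forall n : N, e_ (tgt c) *: n = n -> narr c *: n = 0 -> exists w, n = ar c *: w.

Hypothesis th : thread_set.

Lemma pure_thread_eq0 (M : lmodType L) c (m : M) : left_exact M -> F c ->
  e_ (src c) *: m = m -> pure (arX c) m = 0 -> exists w, m = parr c *: w.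
Proof.
move=> hM Fc em e; have [cX|cX] := boolP (tgt c \in X); first exact: pure_arrow_eq0.
have [ct _] := thread_tgt th Fc cX; apply: hM => //.
rewrite -[LHS]idem_arrowZ; apply: (pure_idem_eq0 (h := cX)).
by rewrite -pure_balanced -arX_idem.
Qed.

Lemma tensor_thread_image (M : lmodType L) c (z : T M) : left_exact M -> F c ->
  e_ (tgt c) *: z = z -> narr c *: z = 0 ->
  exists2 m, e_ (src c) *: m = m & z = pure (arX c) m.
Proof.
move=> hM Fc ez dz; have [cX|cX] := boolP (tgt c \in X).
  by have [m em e] := tensor_arrow z cX; exists m => //; rewrite -ez.
have [ct Fd] := thread_tgt th Fc cX.
have [m em e] := tensor_idem cX z; rewrite ez in e.
move: dz; rewrite /narr (negbTE ct) e -pureZ.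
have sd : src (nxt c) \notin X by rewrite src_nxt.
rewrite [_ *: _](_ : _ = arX (nxt c)); last first.
  by apply: ival_inj; rewrite /= -[in e_ _]src_nxt arrow_src.
move=> /(pure_thread_eq0 hM Fd)[|w ew]; first by rewrite src_nxt.
exists (e_ (src c) *: w); first exact: idemZK.
rewrite ew parr_nxt // -arrow_idemZ -pure_balanced -arX_idem //.
Qed.

(** Tensoring puts a cokernel at the end of each thread and thereby makes the thread exact there;
    exactness towards the starts of the threads turns into exactness towards their ends. *)
Lemma tensor_right_exact (M : lmodType L) : left_exact M -> right_exact (T M).
Proof.
move=> hM c Fc sc z ez dz; have [m em ->] := tensor_thread_image hM Fc ez dz.
by exists (pure (ideal_idem k (notin_tr sc)) m); rewrite -pureZ -arX_arrow.
Qed.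

Lemma hom_thread_ker (N : lmodType L) c (phi : H N) : right_exact N -> F c ->
  e_ (src c) *: phi = phi -> phi (arX c) = 0 -> exists psi, phi = parr c *: psi.
Proof.
move=> hN Fc ephi e; have [cX|cX] := boolP (src c \in X).
  by exists 0; rewrite scaler0; apply: hom_overP => x; rewrite (hom_arrowE _ cX) // e scaler0.
have [sc Fb] := thread_src th Fc cX; set b := prv c in Fb.
set n := phi (ideal_idem k cX).
have cn : ar c *: n = 0 by rewrite -hfunZ // -arX_arrow.
have en : e_ (tgt b) *: n = n.
  by rewrite tgt_prv -hfunZ //; congr (phi _); apply: ival_inj; rewrite /= idem_idem.
have dn : narr b *: n = 0 by rewrite narr_prv.
have phiE x : phi x = ival x *: n by rewrite (hom_idemE cX).
rewrite /parr (negbTE sc) -/b; have [bX|bX] := boolP (src b \in X).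
  exists (hom_div bX dn en); apply: hom_overP => x.
  by rewrite phiE ho_scaleE /= rdiv_mul_act.
have [sb _] := thread_src th Fb bX.
have [w ew] := hN b Fb sb n en dn; exists (hom_mul w); apply: hom_overP => x.
by rewrite phiE ho_scaleE /= ew scalerA.
Qed.

(** Dually, Hom puts a kernel at the start of each thread, so the first arrow becomes injective and
    the next position exact. *)
Lemma hom_left_exact (N : lmodType L) : right_exact N -> left_exact (H N).
Proof.
move=> hN c Fc tc phi ephi cphi; apply: hom_thread_ker => //.
by rewrite (arX_idem (notin_tr tc)) -ho_scaleE cphi.
Qed.

Definition unit_fun (M : lmodType L) (m : M) : H (T M).
Proof.
by exists (fun x => pure x m) => [x y|a x _]; [exact: pureDl|exact: pureZ].
Defined.

Lemma unit_linear (M : lmodType L) : linear (@unit_fun M).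
Proof.
by move=> a m m'; apply: hom_overP => x; rewrite ho_addE ho_scaleE /= pureDr pure_balanced.
Qed.

Lemma unit_inj (M : lmodType L) (m : M) : left_exact M -> unit_fun m = 0 -> m = 0.
Proof.
move=> hM e; have e' (x : I) : pure x m = 0 by have := congr1 (fun h : H (T M) => h x) e.
rewrite [m]idem_decomp big1 // => v _; have [vX|vX] := boolP (v \in X); last first.
  exact: (pure_idem_eq0 (e' (ideal_idem k vX))).
have [c ec] := out_arrow v; rewrite -ec in vX *.
have [||w ->] := @pure_thread_eq0 M c (e_ (src c) *: m) hM (thread_out th vX).
- exact: idemZK.
- rewrite -pure_balanced [ract _ _](_ : _ = arX c) //.
  by apply: ival_inj; rewrite /= arrow_src.
(* A thread starts at [src c], so no arrow precedes [c] and [parr c] is zero. *)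
by rewrite /parr X_tr // scale0r.
Qed.

Lemma unit_surj (M : lmodType L) (phi : H (T M)) : left_exact M -> exists m, unit_fun m = phi.
Proof.
move=> hM; suff h v : exists m : M, unit_fun m = e_ v *: phi.
  have [m em] := choice h; exists (\sum_v m v).
  have -> : unit_fun (\sum_v m v) = \sum_v unit_fun (m v).
    apply: (big_morph (@unit_fun M)) => [x y|].
      by have := unit_linear 1 x y; rewrite !scale1r.
    by apply: hom_overP => x; rewrite /= pure0r.
  by rewrite [phi]idem_decomp; apply: eq_bigr => v _.
have [vX|vX] := boolP (v \in X); last first.
  have [m em ez] := tensor_idem vX ((e_ v *: phi) (ideal_idem k vX)).
  exists m; apply: hom_overP => x.
  rewrite [RHS](hom_idemE vX _ (idemZK phi v)) [LHS]/= -{1}em -pure_balanced.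
  rewrite (idem_ract vX) pureZ -ez -hfunZ //; congr (_ *: hfun _ _).
  by apply: ival_inj; rewrite /= idem_idem.
have [c ec] := out_arrow v; rewrite -ec in vX *; set psi := e_ (src c) *: phi.
have [||m em ez] := @tensor_thread_image M c (psi (arX c)) hM (thread_out th vX).
- by rewrite -hfunZ //; congr (hfun _ _); apply: ival_inj; rewrite /= arrow_tgt.
- rewrite -hfunZ // [_ *: _](_ : _ = 0) ?hfun0 //.
  by apply: ival_inj; rewrite /= narr_arrow.
exists m; apply: hom_overP => x.
rewrite [RHS](hom_arrowE _ vX (idemZK phi _)) ez -pureZ -(arrow_ract _ vX).
by rewrite pure_balanced em.
Qed.

Definition counit (N : lmodType L) : {linear T (H N) -> N}.
Proof.
apply: (@tensor_lift _ _ _ _ (fun (x : I) (phi : H N) => phi x)).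
- by move=> x y phi; exact: hfunD.
- by move=> x phi psi.
- by move=> x a phi.
- by move=> a x phi; exact: hfunZ.
Defined.

Lemma counit_pure (N : lmodType L) x (phi : H N) : counit N (pure x phi) = phi x.
Proof. exact: tensor_lift_pure. Qed.

Lemma counit_surj (N : lmodType L) (n : N) : right_exact N -> exists z, counit N z = n.
Proof.
move=> hN; suff h v : exists z, counit N z = e_ v *: n.
  have [z ez] := choice h; exists (\sum_v z v).
  by rewrite linear_sum [n]idem_decomp; apply: eq_bigr.
have [vX|vX] := boolP (v \in X); last first.
  by exists (pure (ideal_idem k vX) (hom_mul n)); rewrite counit_pure.
have [c ec] := in_arrow v; rewrite -ec in vX *.
have dn : narr c *: (e_ (tgt c) *: n) = 0 by rewrite /narr X_tr // scale0r.
have en := idemZK n (tgt c).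
have [cX|cX] := boolP (src c \in X).
  exists (pure (arX c) (hom_div cX dn en)); rewrite counit_pure /= -[ar c]mul1r.
  by rewrite rdiv_mul_act // scale1r.
have [sc _] := thread_src th (thread_in th vX) cX.
have [w ->] := hN c (thread_in th vX) sc _ en dn.
by exists (pure (arX c) (hom_mul w)); rewrite counit_pure.
Qed.

Lemma counit_inj (N : lmodType L) (z : T (H N)) : right_exact N -> counit N z = 0 -> z = 0.
Proof.
move=> hN e; rewrite [z]idem_decomp big1 // => v _.
have e' : counit N (e_ v *: z) = 0 by rewrite linearZ_LR e scaler0.
have [vX|vX] := boolP (v \in X); last first.
  have [phi ephi ez] := tensor_idem vX z; rewrite ez; move: e'; rewrite ez counit_pure => e'.
  rewrite (_ : phi = 0) ?pure0r //; apply: hom_overP => x.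
  by rewrite (hom_idemE vX) // e' scaler0.
have [c ec] := in_arrow v; rewrite -ec in vX e' *.
have [phi ephi ez] := tensor_arrow z vX; rewrite ez; move: e'; rewrite ez counit_pure => e'.
have [psi ->] := hom_thread_ker hN (thread_in th vX) ephi e'.
rewrite -pure_balanced [ract _ _](_ : _ = 0) ?pure0l //.
by apply: ival_inj; rewrite /= arrow_parr.
Qed.

(** The images of an inner arrow of a thread form an acyclic complex. The obstruction to lifting
    lies in the image of the preceding arrow, whose rank is smaller; at the start of the thread it
    vanishes by injectivity. *)
Lemma image_acyclic (C : complex L) : (forall n, left_exact (C n)) -> acyclic C ->
  forall c, F c -> tgt c \notin tr -> forall n (m : C (n + 1)),
    diff C _ (ar c *: m) = 0 -> exists m', diff C n (ar c *: m') = ar c *: m.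
Proof.
move=> hC aC c; have [r le] := ubnP (thread_rank th c); elim: r c le => // r IH c le Fc tc n m dm.
set m1 := e_ (src c) *: m.
have dm1 : ar c *: diff C _ m1 = 0 by rewrite -linearZ /= arrow_idemZ dm.
have [|w ew] := hC _ c Fc tc (diff C _ m1) _ dm1.
  by rewrite -linearZ /= idemZK.
suff [w0 ew0] : exists w0, diff C _ (parr c *: w0) = parr c *: w.
  have [|m' em'] := aC n (m1 - parr c *: w0); first by rewrite linearB ew0 ew subrr.
  exists m'; rewrite linearZ /= em' scalerBr [X in _ - X]scalerA arrow_parr scale0r subr0.
  exact: arrow_idemZ.
rewrite /parr; case: ifPn => [_|sc]; first by exists 0; rewrite !scale0r linear0.
have [_ Fb] := thread_src th Fc (notin_tr sc).
apply: IH => //.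
- by apply: leq_trans (thread_rankP th Fc (notin_tr sc)) _.
- by rewrite tgt_prv.
by move: ew; rewrite /parr (negbTE sc) => <-; exact: diff_diff.
Qed.

(** At the end of a thread the tensor product is the cokernel of [parr c]. It is acyclic because the
    complex and, by [image_acyclic], the images of [parr c] are. *)
Lemma tensor_acyclic (Xfg : finitely_generated I) (C : complex L) :
  (forall n, left_exact (C n)) -> acyclic C -> acyclic (lift_complex (tensor_mod Xfg) C).
Proof.
move=> hC aC n z dz.
suff h v : exists u, diff (lift_complex (tensor_mod Xfg) C) n u = e_ v *: z.
  have [y ey] := choice h; exists (\sum_v y v).
  by rewrite linear_sum [z]idem_decomp; apply: eq_bigr.
have {}dz : diff (lift_complex (tensor_mod Xfg) C) _ (e_ v *: z) = 0.
  by rewrite linearZ_LR dz scaler0.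
have [vX|vX] := boolP (v \in X); last first.
  have [m em ez] := tensor_idem vX z; rewrite ez.
  move: dz; rewrite [_ *: _]ez /= tensor_map_pure => /pure_idem_eq0.
  rewrite -linearZ /= em => dm; have [y ey] := aC n m dm.
  by exists (pure (ideal_idem k vX) y); rewrite /= tensor_map_pure ey.
have [c ec] := in_arrow v; rewrite -ec in vX dz *.
have [m em ez] := tensor_arrow z vX; rewrite [_ *: _]ez.
move: dz; rewrite [_ *: _]ez /= tensor_map_pure => /(pure_arrow_eq0 vX)[|w ew].
  by rewrite -linearZ /= em.
suff [w0 ew0] : exists w0, diff C _ (parr c *: w0) = parr c *: w.
  have [|m' em'] := aC n (m - parr c *: w0); first by rewrite linearB ew0 ew subrr.
  exists (pure (arX c) m'); rewrite /= tensor_map_pure em' -[in RHS](subrK (parr c *: w0) m).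
  rewrite [RHS]pureDr -(pure_balanced (arX c) (parr c) w0) [ract _ _](_ : _ = 0) ?pure0l ?addr0 //.
  by apply: ival_inj; rewrite /= arrow_parr.
move: ew; rewrite /parr; case: ifPn => [_ _|sc ew]; first by exists 0; rewrite !scale0r linear0.
have [_ Fb] := thread_src th (thread_in th vX) (notin_tr sc).
apply: image_acyclic => //; first by rewrite tgt_prv.
by rewrite -ew; exact: diff_diff.
Qed.

(** Dual descent towards the end of the thread. A preimage of [m] is corrected by a boundary: its
    product with the next arrow [d] is a cocycle in a kernel of smaller corank, hence a boundary
    there, and right exactness writes that bounding element as a multiple of [d]. *)
Lemma kernel_acyclic (C : complex L) : (forall n, right_exact (C n)) -> acyclic C ->
  forall c, F c -> forall n (m : C (n + 1)),
    e_ (tgt c) *: m = m -> narr c *: m = 0 -> diff C _ m = 0 ->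
    exists m', [/\ e_ (tgt c) *: m' = m', narr c *: m' = 0 & diff C n m' = m].
Proof.
move=> hC aC c; have [r le] := ubnP (thread_corank th c).
elim: r c le => // r IH c le Fc n; rewrite -(subrK 1 n); move: (n - 1) => {}n m em nm dm.
have [m0 em0] := aC _ m dm; set m1 := e_ (tgt c) *: m0.
have em1 : diff C _ m1 = m by rewrite linearZ /= em0.
have [tc|tc] := boolP (tgt c \in tr).
  by exists m1; split=> //; [exact: idemZK|rewrite /narr tc scale0r].
have [_ Fd] := thread_tgt th Fc (notin_tr tc); set d := nxt c in Fd.
have nc : narr c = ar d by rewrite /narr (negbTE tc).
have sd : src d \notin tr by rewrite src_nxt.
rewrite nc in nm *.
have [||||w [ew nw dw]] := IH d _ Fd n (ar d *: m1).
- by apply: leq_trans (thread_corankP th Fc (notin_tr tc)) _.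
- exact: idem_arrowZ.
- by rewrite scalerA narr_arrow scale0r.
- by rewrite linearZ /= em1.
have [u eu] := hC _ d Fd sd w ew nw.
exists (m1 - diff C _ (e_ (tgt c) *: u)); split.
- by rewrite scalerBr idemZK -linearZ /= idemZK.
- have ue : ar d *: (e_ (tgt c) *: u) = ar d *: u by rewrite -src_nxt arrow_idemZ.
  by rewrite scalerBr -linearZ_LR ue -eu dw subrr.
- by rewrite linearB diff_diff subr0.
Qed.

Lemma hom_acyclic (Hfg : forall M, finitely_generated M -> finitely_generated (H M))
    (C : complex L) : (forall n, right_exact (C n)) -> acyclic C ->
  acyclic (lift_complex (hom_functor Hfg) C).
Proof.
move=> hC aC n phi dphi.
suff h v : exists psi, diff (lift_complex (hom_functor Hfg) C) n psi = e_ v *: phi.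
  have [y ey] := choice h; exists (\sum_v y v).
  by rewrite linear_sum [phi]idem_decomp; apply: eq_bigr.
have {}dphi x : diff C _ ((phi : H (C (n + 1))) x) = 0.
  by have := congr1 (fun h : H (C (n + 1 + 1)) => h x) dphi.
set phi' := e_ v *: phi; have ephi : e_ v *: phi' = phi' by exact: idemZK.
have [vX|vX] := boolP (v \in X); last first.
  have [m em] := aC n _ (dphi (ract (ideal_idem k vX) (e_ v))).
  exists (hom_mul (e_ v *: m)); apply: hom_overP => x.
  rewrite (hom_idemE vX _ ephi) /= linearZ /= linearZ /= em; congr (_ *: _).
  by rewrite -hfunZ //; congr (hfun _ _); apply: ival_inj; rewrite /= !idem_idem.
have [c ec] := out_arrow v; rewrite -ec in vX ephi *.
have [|||m [em nm dm]] := @kernel_acyclic C hC aC c (thread_out th vX) n ((phi' : H _) (arX c)).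
- by rewrite -hfunZ //; congr (hfun _ _); apply: ival_inj; rewrite /= arrow_tgt.
- rewrite -hfunZ // [_ *: _](_ : _ = 0) ?hfun0 //.
  by apply: ival_inj; rewrite /= narr_arrow.
- exact: dphi.
exists (hom_div vX nm em); apply: hom_overP => x.
rewrite [RHS](hom_arrowE x vX ephi).
by rewrite /= linearZ /= dm.
Qed.

End Ideal.
End Threads.

(** * Finiteness over the power series *)

Section PowerSeriesDivision.
Variable k : fieldType.
Local Notation R := (power_series k).
Implicit Types r s : R.

Lemma pcoefM r s n : pcoef (r * s) n = \sum_(i < n.+1) pcoef r i * pcoef s (n - i).
Proof. by []. Qed.

(** Over a field a power series of order e divides every series of order at least e. *)
Lemma power_series_divide r r0 e : pcoef r0 e != 0 ->
  (forall j, (j < e)%N -> pcoef r0 j = 0) -> (forall j, (j < e)%N -> pcoef r j = 0) ->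
  exists s, r = s * r0.
Proof.
move=> r0e r0lt rlt.
(* [q n] lists the first n coefficients of the quotient; the next one is solved from the coefficient
   of degree n + e. *)
pose fix q (n : nat) : seq k := if n is m.+1 then
  rcons (q m) ((pcoef r (m + e) - \sum_(i < m) (q m)`_i * pcoef r0 (m + e - i)) / pcoef r0 e)
  else [::].
have size_q n : size (q n) = n by elim: n => //= n IH; rewrite size_rcons IH.
have nth_q n i : (i < n)%N -> (q n)`_i = (q i.+1)`_i.
  elim: n => // n IH; rewrite ltnS leq_eqVlt => /orP[/eqP->//|lt].
  by rewrite -IH //= nth_rcons size_q lt.
exists (PowerSeries (fun n => (q n.+1)`_n)); apply: pseriesP => n; rewrite pcoefM.
have [lt|le] := ltnP n e.
  by rewrite rlt // big1 // => i _; rewrite r0lt ?mulr0 // (leq_ltn_trans (leq_subr _ _)).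
rewrite -(subnK le); move: (n - e)%N => {le}m.
rewrite (bigID (fun i : 'I__ => (i < m.+1)%N)) /= [X in _ = _ + X]big1 ?addr0; last first.
  by move=> [i /= b]; rewrite -leqNgt => lt; rewrite (r0lt (m + e - i)%N) ?mulr0 //; lia.
rewrite -(big_ord_widen (m + e).+1 (fun i => (q i.+1)`_i * pcoef r0 (m + e - i))); last first.
  by rewrite ltnS leq_addr.
rewrite big_ord_recr /= nth_rcons size_q ltnn eqxx addKn mulfVK //.
rewrite [X in X + _](eq_bigr (fun i : 'I_m => (q m)`_i * pcoef r0 (m + e - i))) ?subrKC //.
by move=> i _; rewrite (nth_q m i (ltn_ord i)).
Qed.

Definition ps_shift e : R := PowerSeries (fun n => (n == e)%:R).

Lemma pcoef_eq0 r : (forall n, pcoef r n = 0) -> r = 0.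
Proof. by move=> h; apply: pseriesP. Qed.

End PowerSeriesDivision.

Section Noetherian.
Variables (k : fieldType) (Q : gentle_order_quiver).
Local Notation L := (completed_alg k Q).
Local Notation R := (power_series k).
Local Notation om := (@order_map k Q).

Definition rspan (M : lmodType L) n (g : 'I_n -> M) (x : M) : Prop :=
  exists r : 'I_n -> R, x = \sum_i om (r i) *: g i.

Definition rfg (M : lmodType L) : Prop := exists n (g : 'I_n -> M), forall x, rspan g x.

Lemma rfg_fg M : rfg M -> finitely_generated M.
Proof.
by move=> [n [g h]]; exists n, g => x; have [r ->] := h x; exists (fun i => om (r i)).
Qed.

(** The power series ring is noetherian, in elementary form. The possible coefficients of elements
    of [W] at the first generator form an ideal, generated by one of least order e; subtracting a
    multiple of a witness [w0] leaves an element of the span of the other generators. *)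
Lemma rspan_submodule (M : lmodType L) n (g : 'I_n -> M) (W : M -> Prop) :
  (forall x y, W x -> W y -> W (x + y)) -> (forall r x, W x -> W (om r *: x)) ->
  (forall x, W x -> rspan g x) ->
  exists m (h : 'I_m -> M), (forall j, W (h j)) /\ forall x, W x -> rspan h x.
Proof.
elim: n g W => [|n IH] g W WD WZ Wg.
  exists 0%N, g; split=> // -[] //.
have WB x y : W x -> W y -> W (x - y).
  move=> wx wy; apply: WD => //; rewrite -scaleN1r -[1](order_map1 k Q) -order_mapN.
  exact: WZ.
pose g' i := g (lift ord0 i).
pose J (r : R) (w : M) := W w /\ rspan g' (w - om r *: g ord0).
have [nz|z] := pselect (exists e r w, J r w /\ pcoef r e != 0); last first.
  apply: (IH g') => // x wx; have [r er] := Wg x wx.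
  exists (fun i => r (lift ord0 i)).
  rewrite er big_ord_recl (_ : r ord0 = 0) ?order_map0 ?scale0r ?add0r //.
  apply: pcoef_eq0 => e; apply/eqP/negP => /negP ne; apply: z; exists e, (r ord0), x.
  split=> //; split=> //; exists (fun i => r (lift ord0 i)).
  by rewrite er big_ord_recl addrAC subrr add0r.
have nz' : exists e, `[< exists r w, J r w /\ pcoef r e != 0 >].
  by have [e h] := nz; exists e; apply/asboolP.
have [e /asboolP[r0 [w0 [[Ww0 s0] r0e]]] emin] := ex_minnP nz'.
have Jlt r w j : J r w -> (j < e)%N -> pcoef r j = 0.
  move=> h lt; apply/eqP/negP => /negP ne.
  have : (e <= j)%N by apply: emin; apply/asboolP; exists r, w.
  by rewrite leqNgt lt.
have J0 : J r0 w0 by [].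
pose W' x := W x /\ rspan g' x.
have [|||m [h [Wh hs]]] := IH g' W' => [x y [wx [r er]] [wy [s es]]|r x [wx [s es]]|x []//|].
- split; first exact: WD.
  exists (fun i => r i + s i); rewrite er es -big_split /=.
  by apply: eq_bigr => i _; rewrite order_mapD scalerDl.
- split; first exact: WZ.
  exists (fun i => r * s i); rewrite es scaler_sumr.
  by apply: eq_bigr => i _; rewrite scalerA order_mapM.
exists m.+1, (fun j => if unlift ord0 j is Some j' then h j' else w0); split.
  by move=> j; case: unliftP => [j' _|_] //; case: (Wh j').
move=> x wx; have [r er] := Wg x wx.
have Jx : J (r ord0) x.
  split=> //; exists (fun i => r (lift ord0 i)).
  by rewrite er big_ord_recl addrAC subrr add0r.
have [|||s es] := @power_series_divide _ (r ord0) r0 e => //.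
- by move=> j; exact: Jlt J0.
- by move=> j; exact: Jlt Jx.
have [|t et] := hs (x - om s *: w0).
  split; first by apply: WB => //; exact: WZ.
  have [_ [u eu]] := Jx; have [v ev] := s0.
  exists (fun i => u i - s * v i).
  rewrite (eq_bigr (fun i => om (u i) *: g' i - om s *: (om (v i) *: g' i))); last first.
    by move=> i _; rewrite order_mapD order_mapN order_mapM scalerBl scalerA.
  rewrite sumrB -scaler_sumr -eu -ev scalerBr scalerA -order_mapM -es.
  by rewrite opprB [RHS]addrAC -addrA addrAC -!addrA addNKr.
exists (fun j => if unlift ord0 j is Some j' then t j' else s).
rewrite big_ord_recl /= unlift_none; under eq_bigr => i _ do rewrite liftK.
by rewrite -et subrKC.
Qed.

Lemma rfg_inj (M N : lmodType L) (j : N -> M) : rfg M ->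
  (forall x y, j (x + y) = j x + j y) -> (forall r x, j (om r *: x) = om r *: j x) ->
  injective j -> rfg N.
Proof.
move=> [n [g hg]] jD jZ ji.
have [||m [h [hW hs]]] := @rspan_submodule M n g (fun x => exists y, x = j y) _ _ (fun x _ => hg x).
- by move=> _ _ [x ->] [y ->]; exists (x + y).
- by move=> r _ [x ->]; exists (om r *: x).
have [h' eh] := choice hW; exists m, h' => x.
have [r er] := hs _ (ex_intro _ x erefl); exists r; apply: ji; rewrite er.
have j0 : j 0 = 0 by apply: (addrI (j 0)); rewrite -jD !addr0.
by rewrite (big_morph j jD j0); apply: eq_bigr => i _; rewrite jZ eh.
Qed.

(** The path of length m + 1 that begins with [a]; trivial paths are left to the idempotents, which
    are not indexed by arrows. *)
Definition path_el (a : Q1 Q) (m : nat) : L :=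
  of_pc (fun a' l => ((a' == a) && (l == m.+1)%N)%:R).

Lemma pc_path_el a m a' l : pc (path_el a m) a' l = ((a' == a) && (l == m.+1)%N)%:R.
Proof. by rewrite pc_of_pc // => b c _; rewrite !andbF. Qed.

(** A nontrivial path is a power of a cycle and a path of length between 1 and [ord a]. The cycles
    have different lengths, so [m] runs up to the number of arrows and the coefficients with m >=
    [ord a] are set to zero. *)
Lemma order_expansion (f : L) : exists (r : Q0 Q -> R) (r' : Q1 Q -> nat -> R),
  f = \sum_i om (r i) * idem k i +
      \sum_a \sum_(m < #|{: Q1 Q}|)
        om (if (m < ord a)%N then r' a m else 0) * path_el a m.
Proof.
set N := #|{: Q1 Q}|.
exists (fun i => PowerSeries (fun n => if n is 0%N then coef f i [::] else 0)).
exists (fun a m => PowerSeries (fun n => pc f a (n * ord a + m).+1)).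
apply: pcP => a l; rewrite pcD !pc_sum.
rewrite (bigD1 (src a)) //= big1 ?addr0 => [|i ne]; last first.
  by rewrite pc_Midem eq_sym (negbTE ne) mul0r.
rewrite pc_Midem eqxx mul1r pc_order_map.
rewrite (bigD1 a) //= [X in _ + (_ + X)]big1 ?addr0 => [|b ne]; last first.
  rewrite pc_sum big1 // => m _; rewrite pc_order_mapM big1 // => q _.
  by rewrite pc_path_el eq_sym (negbTE ne) mulr0.
rewrite pc_sum; pose r m := PowerSeries (fun n => pc f a (n * ord a + m).+1).
have E (m : 'I_N) : pc (om (if (m < ord a)%N then r m else 0) * path_el a m) a l =
    if (m < ord a)%N && (l == (l.-1 %/ ord a * ord a + m).+1) then pc f a l else 0.
  case: ifP => lm /=; last by rewrite order_map0 mul0r pc0.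
  rewrite pc_order_mapM; case: ifP => [/eqP el|no].
    have lq : (l.-1 %/ ord a < (l %/ ord a).+1)%N by rewrite ltnS leq_div2r // leq_pred.
    have e1 : (l - l.-1 %/ ord a * ord a)%N = m.+1 by rewrite {1}el -addnS addKn.
    rewrite (bigD1 (Ordinal lq)) //= pc_path_el eqxx /= e1 eqxx mulr1 -el big1 ?addr0 // => q ne.
    rewrite pc_path_el eqxx /=.
    case: eqP => [eq|_]; last by rewrite mulr0.
    case/eqP: ne; apply: val_inj => /=.
    have leq : (q * ord a <= l)%N by rewrite -leq_divRL ?ord_gt0 // -ltnS.
    have -> : l.-1 = (q * ord a + m)%N by lia.
    by rewrite divnMDl ?ord_gt0 // (divn_small lm) addn0.
  rewrite big1 // => q _; rewrite pc_path_el eqxx /=.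
  case: eqP => [eq|_]; last by rewrite mulr0.
  have leq : (q * ord a <= l)%N by rewrite -leq_divRL ?ord_gt0 // -ltnS.
  move: no; have -> : l.-1 = (q * ord a + m)%N by lia.
  rewrite divnMDl ?ord_gt0 // (divn_small lm) addn0 => /eqP; lia.
rewrite [X in _ = _ + X](eq_bigr _ (fun (m : 'I_N) _ => E m)).
case: l {E} => [|l] /=.
  rewrite dvdn0 div0n /= big1 ?addr0 // => m _; case: ifP => // /andP[_ /eqP//].
have -> : (if (ord a %| l.+1)%N then match (l.+1 %/ ord a)%N with
    | 0%N => coef f (src a) [::] | _.+1 => 0 end else 0) = 0 :> k.
  case: ifP => // /dvdnP[q e]; rewrite e mulnK ?ord_gt0 //.
  by case: q e.
have lo : (l %% ord a < ord a)%N by rewrite ltn_mod ord_gt0.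
have lN : (l %% ord a < N)%N.
  by apply: leq_trans lo _; rewrite /N cardT -cardE; exact: max_card.
rewrite add0r (bigD1 (Ordinal lN)) //= lo -divn_eq eqxx /= big1 ?addr0 // => m ne.
case: ifP => // /andP[lm /eqP[el]]; case/eqP: ne; apply: val_inj => /=.
by rewrite el modnMDl modn_small.
Qed.

Lemma order_generation : exists n (g : 'I_n -> L),
  forall f, exists r : 'I_n -> R, f = \sum_i om (r i) * g i.
Proof.
pose N := #|{: Q1 Q}|; pose T := (Q0 Q + Q1 Q * 'I_N)%type.
pose ev : 'I_#|{: T}| -> T := enum_val.
pose g (t : T) : L := match t with inl i => idem k i | inr (a, m) => path_el a m end.
exists #|{: T}|, (fun l => g (ev l)) => f.
have [r [r' ->]] := order_expansion f.
pose c (t : T) : R := match t with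
  | inl i => r i | inr (a, m) => if (m < ord a)%N then r' a m else 0 end.
exists (fun l => c (ev l)).
transitivity (\sum_t om (c t) * g t); last first.
  by rewrite (reindex ev) //; apply/onW_bij; exact: enum_val_bij.
rewrite big_sumType /=; congr (_ + _).
by rewrite pair_bigA /=; apply: eq_bigr => -[a m].
Qed.

Lemma order_map_shift_inj e (f : L) : om (ps_shift k e) * f = 0 -> f = 0.
Proof.
move=> h; apply: pcP => a n; rewrite pc0.
have := pc_order_mapM (ps_shift k e) f a (n + e * ord a); rewrite h pc0.
have le : (e < ((n + e * ord a) %/ ord a).+1)%N by rewrite ltnS leq_divRL ?ord_gt0 // leq_addl.
rewrite (bigD1 (Ordinal le)) //= eqxx mul1r addnK big1 ?addr0 // => m ne.
by rewrite /= (negbTE (_ : nat_of_ord m != e)) ?mul0r.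
Qed.

Definition order_basis n (g : 'I_n -> L) : Prop :=
  (forall f, exists r : 'I_n -> R, f = \sum_i om (r i) * g i) /\
  (forall r : 'I_n -> R, \sum_i om (r i) * g i = 0 -> forall i, r i = 0).

(* A generating family of minimal size is independent: a relation can be divided by
   a power of x until one of its coefficients is a unit. *)
Lemma order_free : exists n (g : 'I_n -> L), order_basis g.
Proof.
pose P n := `[< exists g : 'I_n -> L, forall f, exists r : 'I_n -> R, f = \sum_i om (r i) * g i >].
have exP : exists n, P n.
  by have [n [g h]] := order_generation; exists n; apply/asboolP; exists g.
have [n /asboolP[g gen] nmin] := ex_minnP exP; exists n, g; split=> // r rel.
case/pselect: (exists e i, pcoef (r i) e != 0) => [nz|z] i; last first.
  apply: pcoef_eq0 => e; apply/eqP/negP => /negP ne; by apply: z; exists e, i.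
have nz' : exists e, `[< exists i, pcoef (r i) e != 0 >].
  by have [e h] := nz; exists e; apply/asboolP.
have [e /asboolP[i0 ri0] emin] := ex_minnP nz'.
have low j d : (d < e)%N -> pcoef (r j) d = 0.
  move=> lt; apply/eqP/negP => /negP ne.
  have : (e <= d)%N by apply: emin; apply/asboolP; exists j.
  by rewrite leqNgt lt.
have div j : exists s, r j = s * ps_shift k e.
  apply: (@power_series_divide _ _ _ e) => [|d lt|d]; rewrite /= ?eqxx ?oner_eq0 //.
    by rewrite (ltn_eqF lt).
  exact: low.
have [s es] := choice div.
have rel' : \sum_j om (s j) * g j = 0.
  apply: (@order_map_shift_inj e); rewrite big_distrr /= -[RHS]rel; apply: eq_bigr => j _.
  by rewrite mulrA -order_mapM mulrC -es.
have s0 : pcoef (s i0) 0 != 0.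
  move: ri0; rewrite es pcoefM (bigD1 ord0) //= subn0 eqxx mulr1 big1 ?addr0 // => j ne.
  rewrite (_ : (e - j == e)%N = false) ?mulr0 //; apply/negbTE/negP => /eqP ej.
  by case: j ne ej => -[|j] //= lt _; lia.
have [u eu] : exists u, 1 = u * s i0 by apply: (@power_series_divide _ _ _ 0).
have [n' en] : exists n', n = n'.+1 by exists n.-1; rewrite prednK // (leq_ltn_trans _ (ltn_ord i0)).
subst n; rename n' into n.
suff : P n by move/nmin; rewrite ltnn.
apply/asboolP; exists (fun j => g (lift i0 j)) => f; have [c ->] := gen f.
exists (fun j => c (lift i0 j) - c i0 * u * s (lift i0 j)).
have eg : g i0 = - \sum_j om (u * s (lift i0 j)) * g (lift i0 j).
  have := congr1 (fun z => om u * z) rel'; rewrite mulr0 (bigD1_ord i0) //= mulrDr.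
  rewrite mulrA -order_mapM -eu order_map1 mul1r => /eqP; rewrite addr_eq0 => /eqP->.
  by rewrite big_distrr /=; congr (- _); apply: eq_bigr => j _; rewrite order_mapM mulrA.
rewrite (bigD1_ord i0) //= [X in om _ * X + _]eg mulrN big_distrr /= addrC -sumrB.
by apply: eq_bigr => j _; rewrite order_mapD order_mapN mulrBl -mulrA !order_mapM !mulrA.
Qed.

Lemma fg_rfg (M : lmodType L) : finitely_generated M -> rfg M.
Proof.
move=> [p [u hu]]; have [q [g hg]] := order_generation.
pose T := ('I_p * 'I_q)%type; pose ev : 'I_#|{: T}| -> T := enum_val.
exists #|{: T}|, (fun l => g (ev l).2 *: u (ev l).1) => x.
have [c ->] := hu x; have [r er] := choice (fun i => hg (c i)).
exists (fun l => r (ev l).1 (ev l).2).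
transitivity (\sum_t om (r t.1 t.2) *: (g t.2 *: u t.1)); last first.
  by rewrite (reindex ev) //; apply/onW_bij; exact: enum_val_bij.
rewrite -(pair_bigA _ (fun i j => om (r i j) *: (g j *: u i))) /=.
apply: eq_bigr => i _; rewrite er scaler_suml; apply: eq_bigr => j _.
by rewrite scalerA.
Qed.

Lemma rfg_ffun (M : lmodType L) n : rfg M -> rfg {ffun 'I_n -> M}.
Proof.
move=> [p [u hu]]; pose T := ('I_n * 'I_p)%type; pose ev : 'I_#|{: T}| -> T := enum_val.
pose g (t : T) : {ffun 'I_n -> M} := [ffun i => if i == t.1 then u t.2 else 0].
exists #|{: T}|, (fun l => g (ev l)) => x.
have [r er] := choice (fun i => hu (x i)).
exists (fun l => r (ev l).1 (ev l).2).
transitivity (\sum_t om (r t.1 t.2) *: g t); last first.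
  by rewrite (reindex ev) //; apply/onW_bij; exact: enum_val_bij.
apply/ffunP => i; rewrite sum_ffunE.
rewrite -(pair_bigA _ (fun j l => (om (r j l) *: g (j, l)) i)) /=.
rewrite (bigD1 i) //= [X in _ + X]big1 ?addr0 => [|j ne].
  by rewrite er; apply: eq_bigr => l _; rewrite !ffunE /= eqxx.
by apply: big1 => l _; rewrite !ffunE /= eq_sym (negbTE ne) scaler0.
Qed.

Definition order_scalars (s : L) : Prop := exists r, s = om r.

(** Evaluation at generators of [V] over the power series embeds the Hom module into a finite power
    of [M], and submodules are finitely generated. *)
Lemma rfg_hom (V : bimodule L) (Sc : L -> Prop) (M : lmodType L) : rfg V ->
  (forall r, Sc (om r)) -> (forall r (v : V), ract v (om r) = om r *: v) ->
  finitely_generated M -> rfg (hom_over V Sc M).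
Proof.
move=> [n [g hg]] So Vc /fg_rfg fM.
apply: (@rfg_inj {ffun 'I_n -> M} (hom_over V Sc M)
  (fun h => [ffun i => h (g i)] : {ffun 'I_n -> M})).
- exact: rfg_ffun.
- by move=> h h'; apply/ffunP => i; rewrite !ffunE.
- by move=> r h; apply/ffunP => i; rewrite !ffunE ho_scaleE Vc hfunZ.
move=> h h' /ffunP e; apply: hom_overP => x; have [r ->] := hg x.
rewrite !hfun_sum; apply: eq_bigr => i _; rewrite !hfunZ //.
by have := e i; rewrite !ffunE => ->.
Qed.

Lemma rfg_gentle_ideal (X : {set Q0 Q}) : rfg (gentle_ideal k X).
Proof. exact/fg_rfg/gentle_ideal_fg. Qed.

Lemma gentle_ideal_central (X : {set Q0 Q}) r (v : gentle_ideal k X) :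
  ract v (om r) = om r *: v.
Proof. by apply: ival_inj; rewrite /= order_map_central. Qed.

Lemma fg_hom_ideal (X : {set Q0 Q}) (Sc : L -> Prop) (M : lmodType L) :
  (forall r, Sc (om r)) -> finitely_generated M ->
  finitely_generated (hom_over (gentle_ideal k X) Sc M).
Proof.
move=> So fM; apply/rfg_fg/rfg_hom => //; [exact: rfg_gentle_ideal|exact: gentle_ideal_central].
Qed.

Lemma fg_ker (M N : lmodType L) (f : {linear M -> N}) :
  finitely_generated M -> finitely_generated (ker_mod f).
Proof.
by move=> /fg_rfg fM; apply/rfg_fg/(@rfg_inj _ _ (@kval _ _ _ f)) => // x y; exact: kval_inj.
Qed.

End Noetherian.

(** * The modules Hom_R(I(Y), M), and exactness gained by kernels and cokernels *)

Section Induced.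
Variables (k : fieldType) (Q : gentle_order_quiver).
Local Notation L := (completed_alg k Q).
Local Notation R := (power_series k).
Local Notation tr := (transition Q).
Local Notation ar := (@arrow k Q).
Local Notation e_ := (@idem k Q).
Local Notation om := (@order_map k Q).
Local Notation Rs := (@order_scalars k Q).
Implicit Types (a b c d : Q1 Q) (i v : Q0 Q) (f g : L).

(* At a crossing vertex, [Lambda e / Lambda c] is torsion-free; [c_retract c f * c] is
   the image of [f] under an R-linear retraction of [Lambda e] onto [Lambda c]. *)
Definition c_theta c f : R := PowerSeries (fun q =>
  if src c \in tr then 0 else pc f (partner c) (q * ord (partner c))).

Definition c_retract c f : L := rdiv c (f - om (c_theta c f)).

Lemma c_thetaD c f g : c_theta c (f + g) = c_theta c f + c_theta c g.
Proof. by apply: pseriesP => q /=; case: ifP; rewrite ?addr0 // pcD. Qed.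

Lemma c_thetaZ c r f : c_theta c (om r * f) = r * c_theta c f.
Proof.
apply: pseriesP => q; rewrite pcoefM /=; case: ifP => _.
  by rewrite big1 // => i _; rewrite mulr0.
rewrite pc_order_mapM mulnK ?ord_gt0 //; apply: eq_bigr => m _.
by rewrite mulnBl.
Qed.

Lemma c_retractD c f g : c_retract c (f + g) = c_retract c f + c_retract c g.
Proof. by rewrite /c_retract -[RHS]rdivD; congr rdiv; rewrite c_thetaD order_mapD opprD addrACA. Qed.

Lemma c_retract_idem c f : c_retract c f * e_ (tgt c) = c_retract c f.
Proof. exact: rdiv_idem. Qed.

(** The factor [ar c] matters: the constant term of the quotient, multiplied by [om r], also
    produces cycles that begin with the other arrow at [tgt c], and these are killed by [c]. *)
Lemma c_retractZ c r f : (src c \in tr -> pc f c 0 = 0) ->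
  c_retract c (om r * f) * ar c = om r * c_retract c f * ar c.
Proof.
move=> f0; rewrite /c_retract c_thetaZ order_mapM -mulrBr -mulrA; set g := f - _.
have g0 : pc g c 0 = 0.
  rewrite pcB pc_order_map dvdn0 div0n /=; case: ifPn => [/f0->|_]; first by rewrite subr0.
  by rewrite mul0n (@pc_src0 _ _ _ c (partner c)) ?src_partner // subrr.
apply: pcP => a n; rewrite pc_order_mapM; case: n => [|n].
  by rewrite div0n big_ord1 mul0n subn0 !pc_rdivK0 mulr0.
rewrite pc_rdivK pc_order_mapM; case: (a =P c) => [->|ne].
  rewrite mul1r; apply: eq_bigr => m _; congr (_ * _).
  by case: (n.+1 - _)%N => [|l]; rewrite ?pc_rdivK0 ?pc_rdivK // eqxx mul1r.
rewrite mul0r big1 // => m _; case: (n.+1 - _)%N => [|l]; rewrite ?pc_rdivK0 ?mulr0 //.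
by rewrite pc_rdivK; case: eqP => // _; rewrite mul0r mulr0.
Qed.

Lemma c_retract_arrow c f : c_retract c (f * ar c) * ar c = f * ar c.
Proof.
have t0 : c_theta c (f * ar c) = 0.
  apply: pcoef_eq0 => q /=; case: ifPn => // ct.
  case: (q * _)%N => [|m]; rewrite ?pc_Marrow0 ?pc_Marrow //.
  by rewrite partner_eq (negbTE ct) mul0r.
rewrite /c_retract t0 order_map0 subr0; apply: pcP => a [|n]; rewrite ?pc_rdivK0 ?pc_Marrow0 //.
by rewrite pc_rdivK !pc_Marrow eqxx mul1r.
Qed.

Section Extension.
Variables (Y : {set Q0 Q}) (c : Q1 Q).
Hypothesis srcY : src c \in tr -> src c \in Y.
Hypothesis tgtY : tgt c \notin Y.
Local Notation V := (gentle_ideal k Y).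

Lemma c_retract_in f a : src a \in Y -> pc (c_retract c f) a 0 = 0.
Proof. by rewrite pc_rdiv; case: eqP tgtY => [->|_ _ _]; rewrite ?mul0r // => /negbTE->. Qed.

Definition c_retract_el f : V := ideal_el (c_retract_in f).

(** By [hann], [h] factors through right multiplication by [c]. The left multiples of [c] split off
    over the power series, so the factor extends by composition with [c_retract]. The quotients stay
    in [V] because [tgt c] is not in [Y]. *)
Lemma hom_extend (M : lmodType L) (h : hom_over V Rs M) :
  (forall x : V, ival x * e_ (tgt c) = ival x -> ival x * ar c = 0 -> h x = 0) ->
  e_ (tgt c) *: h = h -> exists w : hom_over V Rs M, h = ar c *: w.
Proof.
move=> hann eh.
have eqh (x y : V) : ival x * e_ (tgt c) = ival x -> ival y * e_ (tgt c) = ival y ->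
    ival x * ar c = ival y * ar c -> h x = h y.
  move=> ex ey exy; apply/eqP; rewrite -subr_eq0 -hfunB; apply/eqP/hann => /=.
    by rewrite mulrBl ex ey.
  by rewrite mulrBl exy subrr.
unshelve eexists.
  exists (fun x : V => h (c_retract_el (ival x))) => [x y|s x [r ->]].
    by rewrite -hfunD; congr (hfun _ _); apply: ival_inj; rewrite /= c_retractD.
  have -> : om r *: h (c_retract_el (ival x)) = h (om r *: c_retract_el (ival x)).
    by rewrite hfunZ //; exists r.
  apply: eqh => /=; rewrite ?c_retract_idem -?mulrA ?c_retract_idem //.
  by rewrite mulrA c_retractZ // => /srcY cY; exact: ideal_el0.
apply: hom_overP => x; rewrite ho_scaleE /= -{1}eh ho_scaleE; apply: eqh => /=.
- by rewrite -mulrA idem_idem.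
- by rewrite c_retract_idem.
by rewrite c_retract_arrow -mulrA arrow_tgt.
Qed.

End Extension.

Lemma hom_order_fg (Y : {set Q0 Q}) (M : lmodType L) : finitely_generated M ->
  finitely_generated (hom_over (gentle_ideal k Y) Rs M).
Proof. by apply: fg_hom_ideal => r; exists r. Qed.

Definition induced (Y : {set Q0 Q}) : mod_functor L := hom_functor (@hom_order_fg Y).

(** A function killed by [c] vanishes on I c. If [c] starts at a transition vertex, I c is all of I
    at that vertex; otherwise it is the left annihilator of [prv c] in I at that vertex, and
    [hom_extend] applies. *)
Lemma induced_left_exact (F : pred (Q1 Q)) (M : lmodType L) :
  left_exact F (induced (transition Q) M).
Proof.
move=> c _ tc h eh ch.
have kill (x : gentle_ideal k (transition Q)) : h (rdiv c (ival x) *: ideal_arrow k _ c) = 0.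
  have rin a : src a \in transition Q -> pc (rdiv c (ival x)) a 0 = 0.
    by move=> at_; rewrite pc_rdiv; case: eqP tc => [<-|_]; rewrite ?mul0r // at_.
  have := congr1 (fun h' : hom_over _ _ _ => h' (ideal_el rin)) ch.
  rewrite ho_scaleE ho_zeroE => <-; congr (hfun _ _); exact: ival_inj.
rewrite /parr; case: ifPn => [sc|sc].
  exists 0; rewrite scaler0; apply: hom_overP => x; rewrite -{1}eh ho_scaleE.
  rewrite ho_zeroE -(kill x); congr (hfun _ _); apply: ival_inj => /=; apply: pcP => a n.
  rewrite pc_Midem; case: n => [|n]; rewrite ?pc_rdivK0 ?pc_rdivK //.
    by case: eqP => [e|_]; rewrite ?mul0r // ideal_el0 ?mulr0 // e.
  case: (a =P c) => [->|ne]; first by rewrite eqxx.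
  by case: eqP => [e|_]; rewrite ?mul0r //; case: ne; apply/esym/trans_out.
have tb : tgt (prv c) = src c := tgt_prv c.
have [||||w ew] := @hom_extend (transition Q) (prv c) _ _ M h; last by exists w.
- by [].
- by rewrite tb.
- move=> x ex xc; have := ann_right ex xc; rewrite prvK => e.
  by rewrite -(kill x); congr (hfun _ _); apply: ival_inj.
- by rewrite tb.
Qed.

Lemma coinduced_right_exact (F : pred (Q1 Q)) (M : lmodType L) :
  right_exact F (induced set0 M).
Proof.
move=> c _ sc h eh dh.
apply: hom_extend => //; first by rewrite (negbTE sc).
- by rewrite inE.
move=> x ex xc; have [y ey] := ann_right_narr ex xc.
have yin a : src a \in set0 -> pc y a 0 = 0 by rewrite inE.
have := congr1 (fun h' : hom_over _ _ _ => h' (ideal_el yin)) dh.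
rewrite ho_scaleE ho_zeroE => <-; congr (hfun _ _); exact: ival_inj.
Qed.

Definition one_el : gentle_ideal k (@set0 (Q0 Q)).
Proof. by apply: (@ideal_el _ _ _ 1) => a; rewrite inE. Defined.

Definition coind_fun (M : lmodType L) (m : M) : induced set0 M.
Proof.
by exists (fun x : gentle_ideal k (@set0 (Q0 Q)) => ival x *: m) => [x y|s x _]; rewrite ?scalerDl ?scalerA.
Defined.

Lemma coind_linear (M : lmodType L) : linear (@coind_fun M).
Proof.
by move=> s m m'; apply: hom_overP => x; rewrite ho_addE ho_scaleE /= scalerDr scalerA.
Qed.

Definition coind_unit : mod_coaug (induced set0).
Proof.
exists (fun M => mklin (@coind_linear M)) => M N f m; apply: hom_overP => x /=.
by rewrite linearZ.
Defined.

Definition coind_retr (M : lmodType L) (h : induced set0 M) : M := (h : hom_over _ _ _) one_el.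

Lemma coind_retrD (M : lmodType L) (g h : induced set0 M) :
  coind_retr (g + h) = coind_retr g + coind_retr h.
Proof. by []. Qed.

Lemma coind_retrK (M : lmodType L) (m : M) : coind_retr (coind_unit M m) = m.
Proof. exact: scale1r. Qed.

Lemma coind_retr_nat (M N : lmodType L) (f : {linear M -> N}) h :
  coind_retr (mmap (induced set0) f h) = f (coind_retr h).
Proof. by []. Qed.

Lemma left_exact_prod (F : pred (Q1 Q)) (M N : lmodType L) :
  left_exact F M -> left_exact F N -> left_exact F (M * N)%type.
Proof.
move=> hM hN c Fc tc [m n] [em en] [cm cn].
have [u ->] := hM c Fc tc m em cm; have [v ->] := hN c Fc tc n en cn.
by exists (u, v).
Qed.

Lemma right_exact_prod (F : pred (Q1 Q)) (M N : lmodType L) :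
  right_exact F M -> right_exact F N -> right_exact F (M * N)%type.
Proof.
move=> hM hN c Fc tc [m n] [em en] [cm cn].
have [u ->] := hM c Fc tc m em cm; have [v ->] := hN c Fc tc n en cn.
by exists (u, v).
Qed.

Section Filtration.
Variables (X : {set Q0 Q}) (F : pred (Q1 Q)) (th : thread_set X F).
Hypothesis X_tr : forall i, i \in X -> i \in tr.

Definition left_upto n : lmodType L -> Prop :=
  left_exact (fun c => F c && (thread_rank th c < n)%N).

Definition right_upto n : lmodType L -> Prop :=
  right_exact (fun c => F c && (thread_corank th c < n)%N).

(** In [M] the element is [prv c] times some w, whose image in [N] is killed by [prv c]. Exactness
    of [N] at the preceding arrow, of smaller rank, allows w to be corrected into the kernel. *)
Lemma left_upto_ker n (M N : lmodType L) (p : {linear M -> N}) :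
  (forall y, exists x, p x = y) -> left_exact F M -> left_upto n N ->
  left_upto n.+1 (ker_mod p).
Proof.
move=> ps hM hN c /andP[Fc rc] tc [x px] ex cx.
have {}ex : e_ (src c) *: x = x by have := congr1 (@kval _ _ _ p) ex.
have {}cx : ar c *: x = 0 by have := congr1 (@kval _ _ _ p) cx.
have [w ew] := hM c Fc tc x ex cx.
move: ew; rewrite /parr; case: ifPn => [_ ew|sc ew].
  by exists 0; apply: kval_inj; rewrite scale0r /= ew scale0r.
have [_ Fb] := thread_src th Fc (notin_tr X_tr sc).
set b := prv c in ew Fb; have tb : tgt b = src c := tgt_prv c.
have [||||v ev] := hN b _ _ (p (e_ (src b) *: w)).
- rewrite Fb; apply: leq_trans (thread_rankP th Fc (notin_tr X_tr sc)) _.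
  by rewrite -ltnS.
- by rewrite tb.
- by rewrite -linearZ_LR idemZK.
- by rewrite -linearZ_LR arrow_idemZ -ew px.
have [v' ev'] := ps v.
have k0 : p (e_ (src b) *: w - parr k b *: v') = 0.
  by rewrite linearB linearZ_LR [X in _ - X]linearZ_LR ev' -ev linearZ_LR subrr.
exists (KerMod k0); apply: kval_inj => /=.
by rewrite scalerBr arrow_idemZ scalerA arrow_parr scale0r subr0.
Qed.

Lemma right_upto_coker n (M N P : lmodType L) (j : {linear M -> N}) (p : {linear N -> P}) :
  (forall y, exists x, p x = y) -> (forall y, p y = 0 -> exists x, j x = y) ->
  (forall x, p (j x) = 0) -> (forall x, j x = 0 -> x = 0) ->
  right_exact F N -> right_upto n M -> right_upto n.+1 P.
Proof.
move=> ps kp pj ji hN hM c /andP[Fc rc] sc y ey dy.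
have [x0 ex0] := ps y; set x := e_ (tgt c) *: x0.
have ex : e_ (tgt c) *: x = x by exact: idemZK.
have px : p x = y by rewrite linearZ_LR ex0.
suff [z [ez nz pz]] : exists z, [/\ e_ (tgt c) *: z = z, narr k c *: z = 0 & p z = y].
  by have [w ew] := hN c Fc sc z ez nz; exists (p w); rewrite -pz ew linearZ_LR.
have [tc|tc] := boolP (tgt c \in tr); first by exists x; rewrite /narr tc scale0r.
have [_ Fd] := thread_tgt th Fc (notin_tr X_tr tc); set d := nxt c in Fd.
have sd : src d = tgt c := src_nxt c.
have nc : narr k c = ar d by rewrite /narr (negbTE tc).
have [|a0 ea0] := kp (ar d *: x); first by rewrite linearZ_LR px -nc.
have [||||a ea] := hM d _ _ (e_ (tgt d) *: a0).
- rewrite Fd; apply: leq_trans (thread_corankP th Fc (notin_tr X_tr tc)) _.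
  by rewrite -ltnS.
- by rewrite sd.
- exact: idemZK.
- apply: ji; rewrite !linearZ_LR ea0 idem_arrowZ scalerA narr_arrow scale0r //.
exists (x - j (e_ (tgt c) *: a)); split.
- by rewrite scalerBr ex -linearZ_LR idemZK.
- rewrite nc scalerBr -linearZ_LR -sd arrow_idemZ -ea linearZ_LR ea0 idem_arrowZ.
  by rewrite subrr.
- by rewrite linearB pj subr0.
Qed.

End Filtration.
End Induced.

(** * The trace form *)

Section Trace.
Variables (k : fieldType) (Q : gentle_order_quiver).
Local Notation L := (completed_alg k Q).
Local Notation R := (power_series k).
Local Notation S := (@sigma Q).
Local Notation tr := (transition Q).
Local Notation e_ := (@idem k Q).
Local Notation om := (@order_map k Q).
Local Notation Pa := (@path_el k Q).
Local Notation It := (gentle_ideal k (transition Q)).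
Implicit Types (a b c d : Q1 Q) (i v : Q0 Q) (f g : L).

Variable sg : Q1 Q -> k.
Hypothesis sg2 : forall a, sg a * sg a = 1.
Hypothesis sg_opp : forall a b, a != b -> src a = src b -> sg a + sg b = 0.

(* Summing the coefficients of the powers of the permitted cycles.  The signs make the
   sum over trivial paths vanish, so that tau is linear over the power series. *)
Definition tau f : R := PowerSeries (fun q => \sum_a sg a * pc f a (q.+1 * ord a)).

Lemma tauD f g : tau (f + g) = tau f + tau g.
Proof.
by apply: pseriesP => q /=; rewrite -big_split; apply: eq_bigr => a _; rewrite pcD mulrDr.
Qed.

Lemma sum_sg_const (h : Q1 Q -> k) :
  (forall a b, src a = src b -> h a = h b) -> (forall a, src a \in tr -> h a = 0) ->
  \sum_a sg a * h a = 0.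
Proof.
move=> hsrc htr; rewrite (partition_big (@src Q) xpredT) //= big1 // => i _.
case: (vertex_cases i) => [[ti [a e _]]|[_ [a [b [nab ea eb hab]]]]].
  by rewrite big1 // => c /eqP ec; rewrite htr ?mulr0 ?ec.
rewrite (bigD1 a) ?ea //= (bigD1 b) ?eb ?eqxx 1?eq_sym //= big1 ?addr0; last first.
  move=> c /andP[/andP[/eqP ec na] nb].
  by case: (hab c ec) => e; [rewrite e eqxx in na|rewrite e eqxx in nb].
by rewrite (hsrc a b) ?ea ?eb // -mulrDl sg_opp ?mul0r // ea eb.
Qed.

Lemma tauZ r f : (forall a, src a \in tr -> pc f a 0 = 0) -> tau (om r * f) = r * tau f.
Proof.
move=> f0; apply: pseriesP => q; rewrite pcoefM /=.
transitivity (\sum_a \sum_(m < q.+2) sg a * (pcoef r m * pc f a ((q.+1 - m) * ord a))).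
  apply: eq_bigr => a _; rewrite pc_order_mapM mulnK ?ord_gt0 // big_distrr /=.
  by apply: eq_bigr => m _; rewrite mulnBl.
(* The index m = q + 1 has no counterpart in [r * tau f], since [tau] starts with the first powers
   of the cycles; it collects the constant terms, which cancel. *)
have z : \sum_a sg a * (pcoef r q.+1 * pc f a ((q.+1 - q.+1) * ord a)) = 0.
  rewrite (eq_bigr (fun a => pcoef r q.+1 * (sg a * pc f a 0))); last first.
    by move=> a _; rewrite subnn mul0n mulrCA.
  by rewrite -big_distrr /= sum_sg_const ?mulr0 // => a b; exact: pc_src0.
rewrite exchange_big big_ord_recr /= z addr0.
apply: eq_bigr => m _; rewrite big_distrr /=; apply: eq_bigr => a _.
by rewrite mulrCA subSn // -ltnS.
Qed.

(** The factors sgn(sigma(b)) sgn(b) of the arrows b along a path telescope to the signs at its two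
    ends. *)
Definition twist f : L := of_pc (fun a n => sg (iter n S a) * sg a * pc f a n).

Lemma pc_twist f a n : pc (twist f) a n = sg (iter n S a) * sg a * pc f a n.
Proof.
by rewrite pc_of_pc // => b c e; rewrite /= !sg2 !mul1r; exact: pc_src0.
Qed.

(** The two sides pair the same closed paths, cut at different arrows. Rotating a closed path moves
    its first arrow along [S], and the resulting change of sign is the one in [twist]. *)
Lemma tau_twist f g : tau (twist g * f) = tau (f * g).
Proof.
have iter_inj j : injective (iter j S) by elim: j => [|j IH] a b //= /sigma_inj/IH.
apply: pseriesP => q /=; pose N a := (q.+1 * ord a)%N; pose M := (\max_a (N a).+1)%N.
(* The range of j depends on a; a common bound M lets the two sums be exchanged and, for fixed j,
   the arrows be permuted by the j-th power of [S]. *)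
have widen (F : Q1 Q -> nat -> k) : \sum_a \sum_(j < (N a).+1) F a j =
    \sum_(j < M) \sum_a (if (j < (N a).+1)%N then F a j else 0).
  rewrite exchange_big /=; apply: eq_bigr => a _.
  by rewrite (big_ord_widen M) ?big_mkcond //; exact: (leq_bigmax a).
transitivity (\sum_a \sum_(j < (N a).+1)
    sg (iter (N a - j) S a) * (pc g (iter (N a - j) S a) j * pc f a (N a - j))).
  apply: eq_bigr => a _; rewrite pcM big_distrr /= (reindex_inj rev_ord_inj) /=.
  apply: eq_bigr => j _; rewrite subSS pc_twist subKn ?leq_ord //.
  by rewrite -iterD subnKC ?leq_ord // iter_ord !mulrA sg2 mul1r.
transitivity (\sum_a \sum_(j < (N a).+1) sg a * (pc f (iter j S a) (N a - j) * pc g a j)).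
  rewrite (widen (fun a j => sg (iter (N a - j) S a) * (pc g (iter (N a - j) S a) j * pc f a (N a - j)))).
  rewrite (widen (fun a j => sg a * (pc f (iter j S a) (N a - j) * pc g a j))); apply: eq_bigr => j _.
  rewrite (reindex_inj (iter_inj j)) /=; apply: eq_bigr => a _.
  rewrite /N ord_iter; case: ifP => // lt; rewrite -iterD subnK ?leq_ord // iter_ord.
  by rewrite (mulrC (pc g _ _)).
by apply: eq_bigr => a _; rewrite pcM big_distrr.
Qed.

Lemma It_mul (y : It) f a : src a \in tr -> pc (ival y * f) a 0 = 0.
Proof. by move=> at_; rewrite pcM0 ideal_el0 // mul0r. Qed.

Definition Theta (y : It) : dual_alg k Q.
Proof.
exists (fun z => tau (ival y * z)) => [z z'|r z]; first by rewrite mulrDr tauD.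
rewrite mulrA -order_map_central -mulrA tauZ // => a; exact: It_mul.
Defined.

Lemma ThetaD y y' : Theta (y + y') = Theta y + Theta y'.
Proof. by apply: dualP => z; rewrite /= mulrDl tauD. Qed.

Lemma Theta_ract y f : Theta (ract y f) = ract (Theta y : omega k Q) f.
Proof. by apply: dualP => z; rewrite /= mulrA. Qed.

Lemma Theta_twist y f : Theta (twist f *: y) = f *: Theta y.
Proof. by apply: dualP => z; rewrite /= -mulrA tau_twist mulrA. Qed.

Lemma tau_path f b m q : (m < ord b)%N ->
  pcoef (tau (f * Pa b m)) q = sg b * pc f (iter m.+1 S b) (q.+1 * ord b - m.+1).
Proof.
move=> lm; rewrite /= (bigD1 b) //= [X in _ + X]big1 ?addr0 => [|a ne].
  congr (_ * _); rewrite pcM.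
  have lt : (m.+1 < (q.+1 * ord b).+1)%N by rewrite ltnS (leq_trans lm) // leq_pmull.
  rewrite (bigD1 (Ordinal lt)) //= pc_path_el !eqxx mulr1 big1 ?addr0 // => j nj.
  by rewrite pc_path_el (negbTE (_ : nat_of_ord j != m.+1)) ?andbF ?mulr0.
by rewrite pcM big1 ?mulr0 // => j _; rewrite pc_path_el (negbTE ne) mulr0.
Qed.

(* The path that completes the path of length n from a to a power of the cycle of a. *)
Definition comp_start n a := iter n S a.
Definition comp_len n a := (ord a - n %% ord a).-1.

Lemma comp_lenS n a : (comp_len n a).+1 = (ord a - n %% ord a)%N.
Proof. by rewrite prednK // subn_gt0 ltn_mod ord_gt0. Qed.

Lemma comp_len_lt n a : (comp_len n a < ord (comp_start n a))%N.
Proof. by rewrite comp_lenS ord_iter leq_subr. Qed.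

Lemma tau_comp f a n :
  pcoef (tau (f * Pa (comp_start n a) (comp_len n a))) (n %/ ord a) =
  sg (iter n S a) * pc f a n.
Proof.
rewrite tau_path ?comp_len_lt // ord_iter comp_lenS; have := ltn_pmod n (ord_gt0 a).
move=> lt; rewrite -iterD.
have -> : (ord a - n %% ord a + n = (n %/ ord a).+1 * ord a)%N.
  by rewrite {2}(divn_eq n (ord a)) mulSn; lia.
rewrite iter_ord; congr (_ * pc f a _).
by rewrite {3}(divn_eq n (ord a)) mulSn; lia.
Qed.

(** Pairing with the path that completes a given path to a power of its cycle isolates a single
    coefficient. *)
Lemma Theta_inj : injective Theta.
Proof.
move=> y y' e; apply: ival_inj; apply: pcP => a n.
have E z : tau (ival y * z) = tau (ival y' * z).
  exact: (congr1 (fun h : dual_alg k Q => h z) e).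
have := tau_comp (ival y) a n; rewrite E tau_comp => /(congr1 ( *%R (sg (iter n S a)))).
by rewrite !mulrA !sg2 !mul1r.
Qed.

(** Multiplication by x is injective on power series, so this determines an element of the dual at
    an idempotent from its values on the cycles through that vertex. *)
Lemma cycle_idem_sum i : om (ps_shift k 1) * e_ i = \sum_(a | src a == i) Pa a (ord a).-1.
Proof.
apply: pcP => a n; rewrite pc_Midem pc_order_map pc_sum big_mkcond (bigD1 a) //=.
rewrite big1 ?addr0 => [|b ne]; last first.
  by case: ifP => // _; rewrite pc_path_el eq_sym (negbTE ne).
rewrite pc_path_el eqxx /= prednK ?ord_gt0 //; case: eqP => _; rewrite ?mul0r // mul1r.
case: ifP => [/dvdnP[q ->]|nd].
  by rewrite mulnK ?ord_gt0 // -{2}[ord a]mul1n eqn_pmul2r ?ord_gt0.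
by case: eqP nd => // ->; rewrite dvdnn.
Qed.

Lemma ps_shift_mul (r : R) n : pcoef (ps_shift k 1 * r) n.+1 = pcoef r n.
Proof.
rewrite pcoefM (bigD1 (inord 1)) //= inordK // eqxx mul1r subn1 big1 ?addr0 // => j ne.
rewrite (_ : (j == 1 :> nat) = false) ?mul0r //; apply: contraNF ne => /eqP e.
by apply/eqP/val_inj; rewrite /= inordK.
Qed.

Lemma ps_shift_mul0 (r : R) : pcoef (ps_shift k 1 * r) 0 = 0.
Proof. by rewrite pcoefM big_ord1 mul0r. Qed.

Lemma dual0 (phi : dual_alg k Q) : phi 0 = 0.
Proof. by apply: (addrI (phi 0)); rewrite -dual_add !addr0. Qed.

Lemma dual_sum (phi : dual_alg k Q) (I : Type) (r : seq I) (P : pred I) (F : I -> L) :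
  phi (\sum_(i <- r | P i) F i) = \sum_(i <- r | P i) phi (F i).
Proof. by apply: big_morph; [exact: dual_add|exact: dual0]. Qed.

Lemma pcoef_sum (I : Type) (s : seq I) (P : pred I) (F : I -> R) n :
  pcoef (\sum_(i <- s | P i) F i) n = \sum_(i <- s | P i) pcoef (F i) n.
Proof. by apply: (big_morph (fun r => pcoef r n)). Qed.

(** The coefficients of [y] are read off from [phi] on completing paths. It remains to see that they
    agree for the trivial paths and vanish at transition vertices. *)
Lemma Theta_surj (phi : dual_alg k Q) : exists y, Theta y = phi.
Proof.
pose u a n := sg (iter n S a) *
  pcoef (phi (Pa (comp_start n a) (comp_len n a))) (n %/ ord a).
have u0 a : u a 0%N = sg a * pcoef (phi (Pa a (ord a).-1)) 0.
  by rewrite /u /comp_start /comp_len /= mod0n subn0 div0n.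
(* The cycles at i add up to x times the idempotent, on which [phi] has no constant coefficient. At
   a crossing vertex this makes the two values opposite, as the signs are; at a transition vertex it
   makes the only value zero. *)
have rel i : \sum_(a | src a == i) pcoef (phi (Pa a (ord a).-1)) 0 = 0.
  by rewrite -pcoef_sum -dual_sum -cycle_idem_sum dual_lin ps_shift_mul0.
have usrc a b : src a = src b -> u a 0%N = u b 0%N.
  move=> e; have [->//|ne] := eqVneq a b.
  have := rel (src a); rewrite (bigD1 a) //= (bigD1 b) /=; last by rewrite e eqxx eq_sym.
  rewrite big1 ?addr0 => [|c /andP[/andP[/eqP ec na] nb]]; last first.
    have [ca|cp] := partner_cases ec; first by rewrite ca eqxx in na.
    have [ba|bp] := partner_cases (esym e); first by rewrite ba eqxx in ne.
    by rewrite cp bp eqxx in nb.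
  move/eqP; rewrite addr_eq0 => /eqP ea; rewrite !u0 ea.
  by rewrite mulrN -mulNr; congr (_ * _); apply/esym/eqP; rewrite -addr_eq0 addrC sg_opp.
have utr a : src a \in tr -> u a 0%N = 0.
  move=> at_; have := rel (src a); rewrite (bigD1 a) //= big1 ?addr0 => [e|b /andP[/eqP eb ne]].
    by rewrite u0 e mulr0.
  by rewrite -(trans_out at_ eb) eqxx in ne.
have yin a : src a \in tr -> pc (of_pc u) a 0 = 0 by move=> at_; rewrite pc_of_pc // utr.
exists (ideal_el yin); apply: dualP.
have onP b m : (m < ord b)%N -> Theta (ideal_el yin) (Pa b m) = phi (Pa b m).
  move=> lm; apply: pseriesP => q; change (pcoef (tau (of_pc u * Pa b m)) q = pcoef (phi (Pa b m)) q).
  rewrite tau_path // pc_of_pc // /u.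
  set N := (q.+1 * ord b - m.+1)%N.
  have leN : (m.+1 <= q.+1 * ord b)%N by rewrite (leq_trans lm) // leq_pmull.
  have eN : N = (q * ord b + (ord b - m.+1))%N by rewrite /N mulSn; lia.
  have lb : (ord b - m.+1 < ord b)%N by have := ord_gt0 b; lia.
  have -> : comp_start N (iter m.+1 S b) = b by rewrite /comp_start -iterD subnK // iter_ord.
  have -> : comp_len N (iter m.+1 S b) = m.
    rewrite /comp_len ord_iter eN modnMDl modn_small // subKn //.
  rewrite -iterD subnK // iter_ord ord_iter eN divnMDl ?ord_gt0 // divn_small // addn0.
  by rewrite mulrA sg2 mul1r.
have onE i : Theta (ideal_el yin) (e_ i) = phi (e_ i).
  apply: pseriesP => q; rewrite -[LHS]ps_shift_mul -[RHS]ps_shift_mul -!dual_lin.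
  rewrite cycle_idem_sum !dual_sum; congr (pcoef _ _); apply: eq_bigr => a _.
  by apply: onP; rewrite prednK ?ord_gt0.
move=> z; have [r [r' ->]] := order_expansion z.
rewrite !dual_add !dual_sum; congr (_ + _); apply: eq_bigr => i _.
  by rewrite !dual_lin onE.
rewrite !dual_sum; apply: eq_bigr => m _; rewrite !dual_lin; case: ifP => lm; last by rewrite !mul0r.
by rewrite onP.
Qed.

End Trace.

(** * The involution *)

Section TwistModule.
Variables (A : pzRingType) (xi : {rmorphism A -> A}).
Hypothesis xiK : involutive xi.

Section Module.
Variable M : lmodType A.

(** The dummy argument keeps the ring morphism in the type, so that the twisted action can be its
    canonical structure. *)
Definition twist_mod (_ : {rmorphism A -> A}) : Type := M.
Local Notation T := (twist_mod xi).
HB.instance Definition _ := GRing.Zmodule.on T.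

Definition tm_scale (a : A) (x : T) : T := (xi a *: (x : M) : M).

Lemma tm_scaleA a b x : tm_scale a (tm_scale b x) = tm_scale (a * b) x.
Proof. by rewrite /tm_scale rmorphM scalerA. Qed.
Lemma tm_scale1 : left_id 1 tm_scale.
Proof. by move=> x; rewrite /tm_scale rmorph1 scale1r. Qed.
Lemma tm_scaleDr : right_distributive tm_scale +%R.
Proof. by move=> a x y; exact: scalerDr. Qed.
Lemma tm_scaleDl x : {morph tm_scale^~ x : a b / a + b}.
Proof. by move=> a b; rewrite /tm_scale rmorphD; exact: scalerDl. Qed.

HB.instance Definition _ := GRing.Zmodule_isLmodule.Build A T
  tm_scaleA tm_scale1 tm_scaleDr tm_scaleDl.

Lemma tm_scaleE (a : A) (x : T) : a *: x = (xi a *: (x : M) : M) :> T. Proof. by []. Qed.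

Lemma tm_fg : finitely_generated M -> finitely_generated T.
Proof.
move=> [n [g hg]]; exists n, g => x; have [c ->] := hg x.
by exists (fun i => xi (c i)); apply: eq_bigr => i _; rewrite tm_scaleE xiK.
Qed.
End Module.

Lemma tm_map_linear (M N : lmodType A) (f : {linear M -> N}) :
  linear (f : twist_mod M xi -> twist_mod N xi).
Proof. by move=> a x y; rewrite !tm_scaleE; exact: linearP. Qed.

Definition twist_functor : mod_functor A.
Proof.
apply: (@ModFunctor A (fun M => twist_mod M xi) (fun M N f => mklin (tm_map_linear f))) => //.
exact: tm_fg.
Defined.

Definition twist_tensor (M : lmodType A) :
  {linear tensor (twist_bimodule xi) M -> twist_mod M xi}.
Proof.
apply: (@tensor_lift A (twist_bimodule xi) M (twist_mod M xi)
  (fun (x : twist_bimodule xi) (m : M) => ((x : A) *: m : M))).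
- by move=> x y m; exact: (@scalerDl A M m (x : A) (y : A)).
- by move=> x m m'; exact: (@scalerDr A M (x : A) m m').
- by move=> x a m; exact: (esym (@scalerA A M (x : A) a m)).
- by move=> a x m; exact: (esym (@scalerA A M (xi a) (x : A) m)).
Defined.

Lemma twist_tensor_pure (M : lmodType A) (x : A) (m : M) :
  twist_tensor M (pure (x : twist_bimodule xi) m) = x *: m.
Proof. exact: tensor_lift_pure. Qed.

Lemma twist_tensor_surj (M : lmodType A) (m : twist_mod M xi) : exists z, twist_tensor M z = m.
Proof.
exists (pure ((1 : A) : twist_bimodule xi) (m : M) : tensor (twist_bimodule xi) M).
by rewrite twist_tensor_pure scale1r.
Qed.

Lemma twist_tensor_inj (M : lmodType A) (z : tensor (twist_bimodule xi) M) : twist_tensor M z = 0 -> z = 0.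
Proof.
move=> e; suff -> : z = pure ((1 : A) : twist_bimodule xi) (twist_tensor M z : M) by rewrite e pure0r.
have [s {e}->] := tensor_sum_pure z; rewrite linear_sum.
have -> : pure ((1 : A) : twist_bimodule xi) (\sum_(p <- s) twist_tensor M (pure p.1 p.2) : M) =
    \sum_(p <- s) pure ((1 : A) : twist_bimodule xi) (twist_tensor M (pure p.1 p.2) : M) :> tensor (twist_bimodule xi) M.
  exact: pure_sum.
apply: eq_bigr => p _; rewrite twist_tensor_pure -pure_balanced; congr pure.
exact/esym/mul1r.
Qed.

Definition twist_tensor_nat (fg : finitely_generated (twist_bimodule xi)) :
  mod_nat (tensor_mod fg) twist_functor.
Proof.
exists twist_tensor => M N f.
apply: (@tensor_ext A (twist_bimodule xi) M (twist_mod N xi)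
  (twist_tensor N \o tensor_map f)%FUN (mklin (tm_map_linear f) \o twist_tensor M)%FUN) => x m.
rewrite /= tensor_map_pure; apply: (etrans (twist_tensor_pure x (f m))).
by rewrite -linearZ; congr (f _); exact/esym/twist_tensor_pure.
Defined.

Lemma twist_fg : finitely_generated (twist_bimodule xi).
Proof.
exists 1%N, (fun=> (1 : A) : twist_bimodule xi) => x; exists (fun=> xi (x : A)).
rewrite big_ord1; apply: (etrans _ (esym (_ : xi (xi x) * 1 = _))) => //.
by rewrite xiK mulr1.
Qed.

Lemma twist_preserves_w : preserves_w (@quasi_iso A) (lift_functor twist_functor).
Proof. by move=> X Y f h n; exact: h. Qed.

End TwistModule.

Section Xi.
Variables (k : fieldType) (Q : gentle_order_quiver).
Local Notation L := (completed_alg k Q).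
Local Notation S := (@sigma Q).
Local Notation ar := (@arrow k Q).
Local Notation e_ := (@idem k Q).
Implicit Types (a b c d : Q1 Q) (i v : Q0 Q) (f g : L).

Lemma rdiv_expansion f : f = \sum_i coef f i [::] *: e_ i + \sum_c rdiv c f * ar c.
Proof.
apply: pcP => a n; rewrite pcD !pc_sum (bigD1 (src a)) //= pcZ pc_idem eqxx /=.
rewrite [X in _ + X + _]big1 ?addr0 => [|i ne]; last first.
  by rewrite pcZ pc_idem eq_sym (negbTE ne) mulr0.
case: n => [|n].
  by rewrite mulr1 big1 ?addr0 // => c _; exact: pc_rdivK0.
rewrite mulr0 add0r (bigD1 a) //= pc_rdivK eqxx mul1r big1 ?addr0 // => c ne.
by rewrite pc_rdivK eq_sym (negbTE ne) mul0r.
Qed.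

Variable xi : {rmorphism L -> L}.

(** No continuity of [xi] is assumed. An element is a finite sum of idempotents with scalars and of
    left multiples of arrows, so multiplicativity reduces a coefficient of length n + 1 to one of
    length n of the image of a quotient. *)
Lemma xi_signs : is_xi xi -> exists sg : Q1 Q -> k,
  [/\ forall a, sg a * sg a = 1, forall a b, a != b -> src a = src b -> sg a + sg b = 0 &
      xi =1 twist sg].
Proof.
move=> [_ xiZ xie xia].
suff [sg [sg2 sgo xis]] : exists sg : Q1 Q -> k, [/\ forall a, sg a * sg a = 1,
    forall a b, a != b -> src a = src b -> sg a + sg b = 0 &
    forall a, xi (ar a) = (sg (S a) * sg a) *: ar a].
  exists sg; split=> // f; apply: pcP => a n; rewrite pc_twist //.
  elim: n f a => [|n IH] f a; rewrite {1}[f]rdiv_expansion rmorphD !rmorph_sum pcD !pc_sum.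
    rewrite (bigD1 (src a)) //= xiZ xie pcZ pc_idem eqxx mulr1 sg2 mul1r.
    rewrite big1 ?addr0 => [|i ne]; last first.
      by rewrite xiZ xie pcZ pc_idem eq_sym (negbTE ne) mulr0.
    rewrite big1 ?addr0 // => c _.
    by rewrite rmorphM xis pcM0 pcZ pc_arrow andbF !mulr0.
  rewrite big1 ?add0r => [|i _]; last by rewrite xiZ xie pcZ pc_idem andbF mulr0.
  have E c : pc (xi (rdiv c f * ar c)) a n.+1 =
      sg (S c) * sg c * ((a == c)%:R * pc (xi (rdiv c f)) (S c) n).
    rewrite rmorphM xis -pc_Marrow -pcZ; congr (pc _ a _); apply: pcP => a' m.
    by rewrite pcZ !pcM big_distrr /=; apply: eq_bigr => j _; rewrite pcZ mulrCA.
  rewrite (bigD1 a) //= E eqxx mul1r IH pc_rdiv_sigma -iterSr big1 ?addr0 => [|c ne].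
    have := sg2 (S a); move: (sg (S a)) (sg a) (sg (iter n.+1 S a)) (pc f _ _) => u v w p u2.
    by transitivity (u * u * (w * v * p)); [ring|rewrite u2 mul1r].
  by rewrite E eq_sym (negbTE ne) mul0r mulr0.
move: xia; case: ifPn => [ch2 xia|_ [sgn [hn xia]]].
  (* In characteristic 2 all signs are 1, and the sum of two of them is still zero. *)
  exists (fun=> 1); split=> [a|a b _ _|a]; rewrite ?mulr1 //.
    exact: (pcharf0 ch2).
  by rewrite scale1r.
exists (fun a => (-1) ^+ sgn a); split=> [a|a b ne e|a] //.
  by rewrite -expr2 sqrr_sign.
by have := hn a b ne e; case: (sgn a); case: (sgn b) => // _; rewrite expr1 expr0 ?addrN ?addNr.
Qed.

Variable sg : Q1 Q -> k.
Hypothesis sg2 : forall a, sg a * sg a = 1.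
Hypothesis sg_opp : forall a b, a != b -> src a = src b -> sg a + sg b = 0.
Hypothesis xi_twist : xi =1 twist sg.

Lemma pc_xi f a n : pc (xi f) a n = sg (iter n S a) * sg a * pc f a n.
Proof. by rewrite xi_twist pc_twist. Qed.

Lemma pc_xi0 f a : pc (xi f) a 0 = pc f a 0.
Proof. by rewrite pc_xi sg2 mul1r. Qed.

Lemma xi_invol : involutive xi.
Proof.
move=> f; apply: pcP => a n; rewrite !pc_xi mulrA.
by rewrite [X in X * _](_ : _ = 1) ?mul1r // mulrACA !sg2 mulr1.
Qed.

Lemma xi_idem i : xi (e_ i) = e_ i.
Proof.
apply: pcP => a n; rewrite pc_xi pc_idem; case: n => [|n]; last by rewrite andbF mulr0.
by rewrite /= sg2 mul1r.
Qed.

Lemma xi_arrowZ (M : lmodType L) c (m : M) :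
  (xi (ar c) *: m = 0 -> ar c *: m = 0) /\ exists z : L, ar c *: m = xi (ar c) *: (z *: m).
Proof.
pose s : L := (sg (S c) * sg c) *: (1 : L).
have sr f : f * s = (sg (S c) * sg c) *: f.
  apply: pcP => a n; rewrite pcM pcZ big_ord_recl /= pcZ pc1 eqxx mulr1 subn0 mulrC.
  by rewrite big1 ?addr0 // => j _; rewrite pcZ pc1 !mulr0.
have sl f : s * f = (sg (S c) * sg c) *: f.
  apply: pcP => a n; rewrite pcM pcZ big_ord_recr /= subnn pcZ pc1 eqxx mulr1.
  rewrite big1 ?add0r // => j _; rewrite pcZ pc1 subn_eq0 leqNgt ltn_ord.
  by rewrite mulr0 mul0r.
have ss : s * s = 1.
  by rewrite sr; apply: pcP => a n; rewrite !pcZ mulrA mulrACA !sg2 mulr1 mul1r.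
have xe : xi (ar c) = ar c * s.
  rewrite sr; apply: pcP => a n; rewrite pc_xi pcZ pc_arrow; case: (a =P c) => [->|_].
    by case: n => [|[|n]]; rewrite /= ?mulr0.
  by rewrite !mulr0.
split; last by exists s; rewrite xe scalerA -mulrA ss mulr1.
by move=> h; rewrite -[ar c]mulr1 -ss mulrA -xe sr -sl -scalerA h scaler0.
Qed.

Lemma twist_left_exact (F : pred (Q1 Q)) (M : lmodType L) :
  left_exact F M -> left_exact F (twist_mod M xi).
Proof.
move=> h c Fc tc m; rewrite !tm_scaleE xi_idem => em /(xi_arrowZ c (m : M)).1 cm.
have [w ew] := h c Fc tc m em cm; move: ew; rewrite /parr; case: ifPn => _ ew.
  by exists 0; rewrite scaler0 ew scale0r.
have [z ez] := (xi_arrowZ (prv c) w).2.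
by exists (z *: w : M); rewrite tm_scaleE ew ez.
Qed.

End Xi.

Section SemilinearTensor.
Variables (A : pzRingType) (lam rho : {rmorphism A -> A}).
Hypothesis lamK : involutive lam.

(* [phi (x) j], semilinear for [lam] when [phi] and [j] agree on the middle action. *)
Definition semi_tensor (B B' : bimodule A) (M M' : lmodType A) (phi : B -> B') (j : M -> M')
  (phiD : forall x y, phi (x + y) = phi x + phi y)
  (phiR : forall x a, phi (ract x a) = ract (phi x) (rho a))
  (phiZ : forall a x, phi (a *: x) = lam a *: phi x)
  (jD : forall m m', j (m + m') = j m + j m')
  (jZ : forall a m, j (a *: m) = rho a *: j m) :
  {linear tensor B M -> twist_mod (tensor B' M') lam}.
Proof.
apply: (@tensor_lift A B M (twist_mod (tensor B' M') lam) (fun x m => pure (phi x) (j m))).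
- by move=> x y m; rewrite phiD pureDl.
- by move=> x m m'; rewrite jD pureDr.
- by move=> x a m; rewrite phiR pure_balanced jZ.
- by move=> a x m; rewrite phiZ pureZ tm_scaleE.
Defined.

Lemma semi_tensor_pure B B' M M' phi j phiD phiR phiZ jD jZ x m :
  @semi_tensor B B' M M' phi j phiD phiR phiZ jD jZ (pure x m) = pure (phi x) (j m).
Proof. exact: tensor_lift_pure. Qed.

Lemma semi_tensorK B B' M M' phi j phiD phiR phiZ jD jZ phi' j' phiD' phiR' phiZ' jD' jZ' :
  cancel phi phi' -> cancel j j' ->
  forall z, @semi_tensor B' B M' M phi' j' phiD' phiR' phiZ' jD' jZ'
    (@semi_tensor B B' M M' phi j phiD phiR phiZ jD jZ z : tensor B' M') = z.
Proof.
move=> phiK jK z; have [s ->] := tensor_sum_pure z.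
rewrite (linear_sum (semi_tensor phiD phiR phiZ jD jZ)).
rewrite (linear_sum (semi_tensor phiD' phiR' phiZ' jD' jZ')).
apply: eq_bigr => p _; apply: (etrans (congr1 _ (semi_tensor_pure _ _ _ _ _ _ _))).
by rewrite semi_tensor_pure phiK jK.
Qed.

End SemilinearTensor.

(** * The twist commutes with I(X), and omega is the twist of I(Q_0^t) *)

Section XiTensor.
Variables (k : fieldType) (Q : gentle_order_quiver).
Local Notation L := (completed_alg k Q).
Local Notation tr := (transition Q).
Local Notation It := (gentle_ideal k (transition Q)).
Implicit Types (a b c d : Q1 Q) (i v : Q0 Q) (f g : L).

Variables (xi : {rmorphism L -> L}) (sg : Q1 Q -> k).
Hypothesis sg2 : forall a, sg a * sg a = 1.
Hypothesis sg_opp : forall a b, a != b -> src a = src b -> sg a + sg b = 0.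
Hypothesis xi_twist : xi =1 twist sg.
Local Notation xiK := (xi_invol sg2 xi_twist).
Local Notation Xi := (twist_functor xiK).
Local Notation Tm X := (tensor_mod (gentle_ideal_fg k X)).

Section Ideal.
Variable X : {set Q0 Q}.
Local Notation I := (gentle_ideal k X).

Lemma xi_in (x : I) a : src a \in X -> pc (xi (ival x)) a 0 = 0.
Proof. by move=> aX; rewrite (pc_xi0 sg2 xi_twist) ideal_el0. Qed.

Definition xi_ideal (x : I) : I := ideal_el (xi_in x).

Lemma xi_idealK : involutive xi_ideal.
Proof. by move=> x; apply: ival_inj; exact: xiK. Qed.

Lemma xi_idealD x y : xi_ideal (x + y) = xi_ideal x + xi_ideal y.
Proof. by apply: ival_inj; exact: rmorphD. Qed.

Lemma xi_idealR x f : xi_ideal (ract x f) = ract (xi_ideal x) (xi f).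
Proof. by apply: ival_inj; exact: rmorphM. Qed.

Lemma xi_idealZ f x : xi_ideal (f *: x) = xi f *: xi_ideal x.
Proof. by apply: ival_inj; exact: rmorphM. Qed.

Lemma untwistZ (M : lmodType L) f (m : twist_mod M xi) : (f *: m : M) = xi f *: (m : M).
Proof. by []. Qed.

Lemma retwistZ (M : lmodType L) f (m : M) : f *: m = xi f *: (m : twist_mod M xi).
Proof. by rewrite tm_scaleE xiK. Qed.

Definition xi_swap (M : lmodType L) :
  {linear tensor I (twist_mod M xi) -> twist_mod (tensor I M) xi} :=
  semi_tensor (j := fun m : twist_mod M xi => (m : M))
    xi_idealD xi_idealR xi_idealZ (fun _ _ => erefl) (@untwistZ M).

Lemma xi_swap_pure (M : lmodType L) x m : xi_swap M (pure x m) = pure (xi_ideal x) (m : M).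
Proof. exact: semi_tensor_pure. Qed.

Definition xi_unswap (M : lmodType L) :
  {linear tensor I M -> twist_mod (tensor I (twist_mod M xi)) xi} :=
  semi_tensor (M' := twist_mod M xi) (j := fun m : M => (m : twist_mod M xi))
    xi_idealD xi_idealR xi_idealZ (fun _ _ => erefl) (@retwistZ M).

Lemma xi_swap_surj (M : lmodType L) y : exists z, xi_swap M z = y.
Proof. by exists (xi_unswap M y); apply: semi_tensorK => //; exact: xi_idealK. Qed.

Lemma xi_swap_inj (M : lmodType L) z : xi_swap M z = 0 -> z = 0.
Proof.
move=> e; have K : xi_unswap M (xi_swap M z : tensor I M) = z.
  by apply: semi_tensorK => //; exact: xi_idealK.
by rewrite -K e; exact: (linear0 (xi_unswap M)).
Qed.

Definition xi_swap_nat : mod_nat (mod_comp (Tm X) Xi) (mod_comp Xi (Tm X)).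
Proof.
exists xi_swap => M N f.
apply: (@tensor_ext L I (twist_mod M xi) (twist_mod (tensor I N) xi)
  (xi_swap N \o tensor_map (mklin (tm_map_linear f)))%FUN
  (mklin (tm_map_linear (tensor_map f)) \o xi_swap M)%FUN) => x m.
have e : (xi_swap N \o tensor_map (mklin (tm_map_linear (xi := xi) f)))%FUN (pure x m) =
    pure (xi_ideal x) (f m).
  by apply: (etrans (congr1 (xi_swap N) (tensor_map_pure _ _ _))); exact: xi_swap_pure.
apply: (etrans e).
change (pure (xi_ideal x) (f m) = tensor_map f (xi_swap M (pure x m) : tensor I M)).
by rewrite xi_swap_pure tensor_map_pure.
Defined.

End Ideal.

Local Notation Th := (Theta sg_opp).

Definition Theta_inv (phi : dual_alg k Q) : It := sval (cid (Theta_surj sg2 sg_opp phi)).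

Lemma Theta_invK phi : Th (Theta_inv phi) = phi.
Proof. exact: (svalP (cid (Theta_surj sg2 sg_opp phi))). Qed.

Lemma Theta_invE y : Theta_inv (Th y) = y.
Proof. by apply: (@Theta_inj _ _ _ sg2 sg_opp); exact: Theta_invK. Qed.

Lemma Theta_xi y f : Th (f *: y) = xi f *: Th y.
Proof. by rewrite -{1}[f]xiK xi_twist Theta_twist. Qed.

Lemma omega_fg : finitely_generated (omega k Q).
Proof.
have [n [g hg]] := gentle_ideal_fg k tr; exists n, (fun j => Th (g j) : omega k Q) => phi.
have [c ec] := hg (Theta_inv phi); exists (fun j => xi (c j)).
rewrite -[LHS](Theta_invK phi) ec.
have Th0 : Th 0 = 0 by apply: (addrI (Th 0)); rewrite -ThetaD !addr0.
rewrite (big_morph _ (ThetaD sg_opp) Th0).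
by apply: eq_bigr => j _; exact: Theta_xi.
Qed.

Lemma Theta_invD phi psi : Theta_inv (phi + psi) = Theta_inv phi + Theta_inv psi.
Proof. by rewrite -[RHS]Theta_invE ThetaD !Theta_invK. Qed.

Lemma Theta_invR (phi : omega k Q) f : Theta_inv (ract phi f) = ract (Theta_inv phi) (idfun f).
Proof. by rewrite -[RHS]Theta_invE Theta_ract Theta_invK. Qed.

Lemma Theta_invZ f (phi : omega k Q) : Theta_inv (f *: phi) = xi f *: Theta_inv phi.
Proof. by rewrite -[RHS]Theta_invE Theta_xi xiK Theta_invK. Qed.

Definition omega_twist (M : lmodType L) :
  {linear tensor (omega k Q) M -> twist_mod (tensor It M) xi} :=
  @semi_tensor _ xi idfun (omega k Q) It M M Theta_inv id
    Theta_invD Theta_invR Theta_invZ (fun _ _ => erefl) (fun _ _ => erefl).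

Lemma omega_twist_pure (M : lmodType L) x (m : M) : omega_twist M (pure x m) = pure (Theta_inv x) m.
Proof. exact: semi_tensor_pure. Qed.

Definition omega_untwist (M : lmodType L) :
  {linear tensor It M -> twist_mod (tensor (omega k Q) M) xi} :=
  @semi_tensor _ xi idfun It (omega k Q) M M Th id
    (ThetaD sg_opp) (Theta_ract sg_opp) (fun f y => Theta_xi y f)
    (fun _ _ => erefl) (fun _ _ => erefl).

Lemma omega_twist_surj (M : lmodType L) y : exists z, omega_twist M z = y.
Proof. by exists (omega_untwist M y); apply: semi_tensorK => //; exact: Theta_invE. Qed.

Lemma omega_twist_inj (M : lmodType L) z : omega_twist M z = 0 -> z = 0.
Proof.
move=> e; have K : omega_untwist M (omega_twist M z : tensor It M) = z.
  by apply: semi_tensorK => //; exact: Theta_invK.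
by rewrite -K e; exact: (linear0 (omega_untwist M)).
Qed.

Definition omega_twist_nat (fg : finitely_generated (omega k Q)) :
  mod_nat (tensor_mod fg) (mod_comp Xi (Tm tr)).
Proof.
exists omega_twist => M N f.
apply: (@tensor_ext L (omega k Q) M (twist_mod (tensor It N) xi)
  (omega_twist N \o tensor_map f)%FUN
  (mklin (tm_map_linear (tensor_map f)) \o omega_twist M)%FUN) => x m.
have e : (omega_twist N \o tensor_map f)%FUN (pure x m) = pure (Theta_inv x) (f m).
  by apply: (etrans (congr1 (omega_twist N) (tensor_map_pure _ _ _))); exact: omega_twist_pure.
apply: (etrans e).
change (pure (Theta_inv x) (f m) = tensor_map f (omega_twist M (pure x m) : tensor It M)).
by rewrite omega_twist_pure tensor_map_pure.
Defined.

End XiTensor.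

(** * The map Hom_R(I(Q_0^t), M) -> M obtained from the trace form *)

Section Augmentation.
Variables (k : fieldType) (Q : gentle_order_quiver).
Local Notation L := (completed_alg k Q).
Local Notation R := (power_series k).
Local Notation tr := (transition Q).
Local Notation om := (@order_map k Q).
Local Notation Rs := (@order_scalars k Q).
Local Notation It := (gentle_ideal k (transition Q)).
Implicit Types (f g : L).

Lemma dual_basis n (b : 'I_n -> L) : order_basis b ->
  exists phi : 'I_n -> dual_alg k Q, forall f, f = \sum_i om (phi i f) * b i.
Proof.
move=> [gen ind]; have [co eco] := choice gen.
have uniq (r r' : 'I_n -> R) : \sum_i om (r i) * b i = \sum_i om (r' i) * b i -> forall i, r i = r' i.
  move=> e i; apply/eqP; rewrite -subr_eq0; apply/eqP.
  apply: (ind (fun i => r i - r' i)).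
  rewrite -[RHS](subrr (\sum_i om (r i) * b i)) {2}e -sumrB; apply: eq_bigr => j _.
  by rewrite order_mapD order_mapN mulrBl.
have coD i f g : co (f + g) i = co f i + co g i.
  apply: (uniq (co (f + g)) (fun i => co f i + co g i)); rewrite -eco.
  rewrite {1}[f]eco {1}[g]eco -big_split; apply: eq_bigr => j _.
  by rewrite order_mapD mulrDl.
have coZ i r f : co (om r * f) i = r * co f i.
  apply: (uniq (co (om r * f)) (fun i => r * co f i)); rewrite -eco.
  by rewrite {1}[f]eco big_distrr /=; apply: eq_bigr => j _; rewrite order_mapM mulrA.
by exists (fun i => DualAlg (coD i) (fun r f => coZ i r f)).
Qed.

Variable sg : Q1 Q -> k.
Hypothesis sg2 : forall a, sg a * sg a = 1.
Hypothesis sg_opp : forall a b, a != b -> src a = src b -> sg a + sg b = 0.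
Local Notation Th := (Theta sg_opp).

Variables (n : nat) (b : 'I_n -> L) (phi : 'I_n -> dual_alg k Q) (y : 'I_n -> It).
Hypothesis phiP : forall f, f = \sum_i om (phi i f) * b i.
Hypothesis yP : forall i, Th (y i) = phi i.

Lemma Theta_om (r : R) (x : It) z : Th (om r *: x) z = r * Th x z.
Proof. rewrite -dual_lin; change (tau sg (om r * ival x * z) = tau sg (ival x * (om r * z))).
by rewrite mulrA order_map_central. Qed.

Lemma Theta_sum (I : Type) (s : seq I) (F : I -> It) z :
  Th (\sum_(i <- s) F i) z = \sum_(i <- s) Th (F i) z.
Proof.
have Th0 : Th 0 = 0 by apply: (addrI (Th 0)); rewrite -ThetaD !addr0.
by elim/big_rec2: _ => [|i x x' _ <-]; rewrite ?Th0 // ThetaD.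
Qed.

Lemma dual_basis_ract i f : ract (y i) f = \sum_j om (phi i (f * b j)) *: y j.
Proof.
apply: (@Theta_inj _ _ _ sg2 sg_opp); apply: dualP => z; rewrite Theta_sum.
have -> : Th (ract (y i) f) z = phi i (f * z) by rewrite Theta_ract yP.
rewrite {1}(phiP z) mulr_sumr dual_sum; apply: eq_bigr => j _.
by rewrite Theta_om yP mulrA -order_map_central -mulrA dual_lin mulrC.
Qed.

(* The y_i form the basis of I(Q_0^t) dual to the b_i under Theta, so this map does not
   depend on the basis; hence its Lambda-linearity. *)
Definition trace_aug_fun (M : lmodType L) (h : hom_over It Rs M) : M := \sum_i b i *: h (y i).

Lemma hom_overZ (M : lmodType L) (h : hom_over It Rs M) r x : h (om r *: x) = om r *: h x.
Proof. by apply: hfunZ; exists r. Qed.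

Lemma trace_aug_linear (M : lmodType L) : linear (@trace_aug_fun M).
Proof.
move=> f h h'; rewrite /trace_aug_fun.
rewrite (eq_bigr (fun i => b i *: h (ract (y i) f) + b i *: h' (y i))) => [|i _]; last first.
  by rewrite -scalerDr.
rewrite big_split; congr (_ + _); rewrite scaler_sumr.
transitivity (\sum_i \sum_j (b i * om (phi i (f * b j))) *: h (y j)).
  apply: eq_bigr => i _; rewrite dual_basis_ract hfun_sum scaler_sumr.
  by apply: eq_bigr => j _; rewrite hom_overZ scalerA.
rewrite exchange_big; apply: eq_bigr => j _ /=; rewrite scalerA {2}(phiP (f * b j)).
by rewrite scaler_suml; apply: eq_bigr => i _; rewrite order_map_central.
Qed.

Definition trace_aug : mod_aug (induced k tr).
Proof.
exists (fun M => mklin (@trace_aug_linear M)) => M N f h.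
by rewrite /= /trace_aug_fun linear_sum; apply: eq_bigr => i _; rewrite linearZ.
Defined.

(** Its image under the augmentation is the sum of the [phi i 1 * b i], that is 1, times [m]. *)
Definition trace_section (M : lmodType L) (m : M) : hom_over It Rs M.
Proof.
exists (fun x => om (Th x 1) *: m) => [x x'|_ x [r ->]].
  by rewrite ThetaD order_mapD scalerDl.
by rewrite Theta_om order_mapM scalerA.
Defined.

Lemma trace_aug_surj (M : lmodType L) (m : M) : exists h, trace_aug M h = m.
Proof.
exists (trace_section m); rewrite /= /trace_aug_fun /=.
rewrite -[RHS]scale1r [in RHS](phiP 1) scaler_suml; apply: eq_bigr => i _.
by rewrite scalerA order_map_central -yP.
Qed.

End Augmentation.

(** * Products of the ideals *)

Section Multiplication.
Variables (k : fieldType) (Q : gentle_order_quiver).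
Local Notation L := (completed_alg k Q).
Local Notation tr := (transition Q).
Local Notation ar := (@arrow k Q).
Local Notation e_ := (@idem k Q).
Local Notation I X := (gentle_ideal k X).
Local Notation arX X c := (ideal_arrow k X c).
Local Notation Tm X := (tensor_mod (gentle_ideal_fg k X)).
Implicit Types (a b c d : Q1 Q) (i v : Q0 Q) (f g : L).

Section Empty.
Variable M : lmodType L.
Local Notation I0 := (I (@set0 (Q0 Q))).

Definition tensor_unit_map : {linear tensor I0 M -> M}.
Proof.
apply: (@tensor_lift L I0 M M (fun x m => ival x *: m)).
- by move=> x y m; exact: scalerDl.
- by move=> x m m'; exact: scalerDr.
- by move=> x a m; rewrite scalerA.
- by move=> a x m; rewrite scalerA.
Defined.

Lemma tensor_unit_map_pure x m : tensor_unit_map (pure x m) = ival x *: m.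
Proof. exact: tensor_lift_pure. Qed.

Lemma unit_in a : src a \in @set0 (Q0 Q) -> pc (1 : L) a 0 = 0.
Proof. by rewrite inE. Qed.
Local Notation u := (ideal_el unit_in).

Lemma tensor_unit_map_surj m : exists z, tensor_unit_map z = m.
Proof. by exists (pure u m); rewrite tensor_unit_map_pure scale1r. Qed.

Lemma tensor_unit_map_inj z : tensor_unit_map z = 0 -> z = 0.
Proof.
move=> e; suff -> : z = pure u (tensor_unit_map z) by rewrite e pure0r.
have [s {e}->] := tensor_sum_pure z; rewrite linear_sum pure_sum.
apply: eq_bigr => p _; rewrite tensor_unit_map_pure -pure_balanced; congr pure.
by apply: ival_inj; rewrite /= mul1r.
Qed.
End Empty.

Definition tensor_unit : mod_aug (Tm (@set0 (Q0 Q))).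
Proof.
exists tensor_unit_map => M N f z.
apply: (@tensor_ext L _ M N (tensor_unit_map N \o tensor_map f)%FUN (f \o tensor_unit_map M)%FUN) => x m.
change (tensor_unit_map N (tensor_map f (pure x m)) = f (tensor_unit_map M (pure x m))).
by rewrite tensor_map_pure !tensor_unit_map_pure linearZ.
Defined.

Section Product.
Variables (X Y : {set Q0 Q}).
Local Notation XY := (X :|: Y).

Lemma ideal_mul_in (x : I X) (y : I Y) a : src a \in XY -> pc (ival x * ival y) a 0 = 0.
Proof.
by rewrite inE pcM0 => /orP[] h; [rewrite [X in X * _]ideal_el0|rewrite [X in _ * X]ideal_el0];
  rewrite ?mul0r ?mulr0.
Qed.

Definition ideal_mul x y : I XY := ideal_el (@ideal_mul_in x y).

Section Map.
Variable M : lmodType L.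

Definition mul_left (x : I X) (z : tensor (I Y) M) : tensor (I XY) M :=
  @tensor_lift_fun L (I Y) M (tensor (I XY) M) (fun y m => pure (ideal_mul x y) m) z.

Lemma mul_left_formal x s :
  mul_left x (formal s) = \sum_(p <- s) pure (ideal_mul x p.1) p.2.
Proof.
apply: tensor_lift_formal.
- by move=> y y' m; rewrite -pureDl; congr pure; apply: ival_inj; exact: mulrDr.
- by move=> y m m'; exact: pureDr.
- by move=> y a m; rewrite -pure_balanced; congr pure; apply: ival_inj; exact: mulrA.
Qed.

Lemma mul_left_pure x y m : mul_left x (pure y m) = pure (ideal_mul x y) m.
Proof. by rewrite mul_left_formal big_seq1. Qed.

Definition tensor_mul : {linear tensor (I X) (tensor (I Y) M) -> tensor (I XY) M}.
Proof.
apply: (@tensor_lift L (I X) (tensor (I Y) M) (tensor (I XY) M) mul_left).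
- move=> x x' z; rewrite -(formal_repr z) !mul_left_formal -big_split /=; apply: eq_bigr => p _.
  by rewrite -pureDl; congr pure; apply: ival_inj; exact: mulrDl.
- move=> x z z'; rewrite -(formal_repr z) -(formal_repr z') -formal_cat !mul_left_formal.
  by rewrite big_cat.
- move=> x a z; rewrite -(formal_repr z) [a *: _]ts_scaleE !mul_left_formal big_map.
  by apply: eq_bigr => p _; congr pure; apply: ival_inj; exact/esym/mulrA.
- move=> a x z; rewrite -(formal_repr z) !mul_left_formal scaler_sumr.
  by apply: eq_bigr => p _; rewrite -pureZ; congr pure; apply: ival_inj; exact/esym/mulrA.
Defined.

Lemma tensor_mul_pure x y m : tensor_mul (pure x (pure y m)) = pure (ideal_mul x y) m.
Proof. by rewrite -mul_left_pure; exact: tensor_lift_pure. Qed.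
End Map.

Definition tensor_mul_nat : mod_nat (mod_comp (Tm X) (Tm Y)) (Tm XY).
Proof.
exists tensor_mul => M N f z.
apply: (@tensor_ext L _ (tensor (I Y) M) _ (tensor_mul N \o tensor_map (tensor_map f))%FUN
  (tensor_map f \o tensor_mul M)%FUN) => x {}z.
change (tensor_mul N (tensor_map (tensor_map f) (pure x z)) = tensor_map f (tensor_mul M (pure x z))).
have [s ->] := tensor_sum_pure z; rewrite tensor_map_pure.
rewrite (linear_sum (tensor_map f)) !pure_sum (linear_sum (tensor_mul N)) (linear_sum (tensor_mul M)).
rewrite (linear_sum (tensor_map f)); apply: eq_bigr => p _.
apply: (etrans (congr1 (fun u => tensor_mul N (pure x u)) (tensor_map_pure f p.1 p.2))).
by rewrite !tensor_mul_pure [RHS]tensor_map_pure.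
Defined.

Hypothesis X_tr : forall i, i \in X -> i \in tr.
Hypothesis Y_tr : forall i, i \in Y -> i \in tr.
Variables (F G : pred (Q1 Q)) (thX : thread_set X F) (thY : thread_set Y G).
Hypothesis FG : forall c, F c -> G c -> False.

Let XY_tr i : i \in XY -> i \in tr.
Proof. by rewrite inE => /orP[/X_tr|/Y_tr]. Qed.

Section Bijective.
Variable M : lmodType L.

(** An arrow from [Y] to [X] would lie on threads of both sets. *)
Lemma src_tgt c : tgt c \in X -> src c \notin Y.
Proof. by move=> cX; apply/negP => cY; apply: (@FG c); [exact: thread_in thX _ cX|exact: thread_out thY _ cY]. Qed.

Lemma tensor_mul_surj w : exists z, tensor_mul M z = w.
Proof.
suff H v : exists z, tensor_mul M z = e_ v *: w.
  have [z ez] := choice H; exists (\sum_v z v); rewrite linear_sum [RHS]idem_decomp.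
  by apply: eq_bigr => v _; exact: ez.
have [c cv] := in_arrow v; subst v.
have [vX|vX] := boolP (tgt c \in X).
  have [|m em ->] := tensor_arrow XY_tr w (_ : tgt c \in XY); first by rewrite inE vX.
  have sY := src_tgt vX; exists (pure (arX X c) (pure (ideal_idem k sY) m)).
  by rewrite tensor_mul_pure; congr pure; apply: ival_inj; exact: arrow_src.
have [vY|vY] := boolP (tgt c \in Y).
  have [|m em ->] := tensor_arrow XY_tr w (_ : tgt c \in XY); first by rewrite inE vY orbT.
  exists (pure (ideal_idem k vX) (pure (arX Y c) m)).
  by rewrite tensor_mul_pure; congr pure; apply: ival_inj; exact: arrow_tgt.
have vXY : tgt c \notin XY by rewrite inE negb_or vX.
have [m em ->] := tensor_idem vXY w.
exists (pure (ideal_idem k vX) (pure (ideal_idem k vY) m)).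
by rewrite tensor_mul_pure; congr pure; apply: ival_inj; exact: idem_idem.
Qed.

(** At each vertex at most one of the two factors forms a cokernel, and it is the cokernel formed by
    the product ideal. *)
Lemma tensor_mul_inj z : tensor_mul M z = 0 -> z = 0.
Proof.
move=> z0; suff H v : e_ v *: z = 0 by rewrite [z]idem_decomp big1 => [|v _]; rewrite ?H.
have {z0} zv : tensor_mul M (e_ v *: z) = 0 by rewrite linearZ_LR z0 scaler0.
have [c cv] := in_arrow v; subst v.
have [vX|vX] := boolP (tgt c \in X).
  have [u eu e] := tensor_arrow X_tr z vX; rewrite e in zv *.
  have sY := src_tgt vX; have [m em eum] := tensor_idem sY u.
  rewrite -eu eum in zv *.
  rewrite tensor_mul_pure (_ : ideal_mul _ _ = arX XY c) in zv; last first.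
    by apply: ival_inj; exact: arrow_src.
  have [|w ew] := pure_arrow_eq0 XY_tr (c := c) _ em zv; first by rewrite inE vX.
  move: ew; rewrite /parr; case: ifPn => [_ ->|sc ->]; first by rewrite scale0r !pure0r.
  set b := prv c; have tb : tgt b = src c := tgt_prv c.
  have sX : src c \notin X by exact: (notin_tr X_tr sc).
  have Fb : F b by have [] := thread_src thX (thread_in thX vX) sX.
  have bY : src b \notin Y by apply/negP => bY; apply: (FG Fb); exact: thread_out thY _ bY.
  (* The arrow [b] lies on a thread of [X], so it starts outside [Y]. It can therefore be moved
     through the inner tensor product, over to the outer factor, where c b = 0. *)
  rewrite -pure_balanced (_ : ract _ _ = ar b *: ideal_idem k bY); last first.
    by apply: ival_inj; rewrite /= -tb arrow_tgt arrow_src.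
  rewrite pureZ -pure_balanced (_ : ract _ _ = 0) ?pure0l //.
  by apply: ival_inj; rewrite /=; have := arrow_parr k c; rewrite /parr (negbTE sc).
have [vY|vY] := boolP (tgt c \in Y).
  have [u eu e] := tensor_idem vX z; rewrite e in zv *.
  have [m em eum] := tensor_arrow Y_tr u vY; rewrite -eu eum in zv *.
  rewrite tensor_mul_pure (_ : ideal_mul _ _ = arX XY c) in zv; last first.
    by apply: ival_inj; exact: arrow_tgt.
  have [|w ->] := pure_arrow_eq0 XY_tr (c := c) _ em zv; first by rewrite inE vY orbT.
  rewrite -[pure (arX Y c) _]pure_balanced (_ : ract _ _ = 0) ?pure0l ?pure0r //.
  by apply: ival_inj; exact: arrow_parr.
have vXY : tgt c \notin XY by rewrite inE negb_or vX.
have [u eu e] := tensor_idem vX z; rewrite e in zv *.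
have [m em eum] := tensor_idem vY u; rewrite -eu eum in zv *.
rewrite tensor_mul_pure (_ : ideal_mul _ _ = ideal_idem k vXY) in zv; last first.
  by apply: ival_inj; exact: idem_idem.
by rewrite -em (pure_idem_eq0 zv) !pure0r.
Qed.

(** The sources of the arrows involved and the inner vertices of the threads of [X] lie outside [Y],
    where tensoring with I(Y) changes nothing. *)
Lemma tensor_left_exact_disjoint : left_exact F M -> left_exact F (tensor (I Y) M).
Proof.
move=> hM c Fc tc u eu cu.
have sY : src c \notin Y by apply/negP => cY; apply: (FG Fc); exact: thread_out thY _ cY.
have tY := notin_tr Y_tr tc.
have [m em eum] := tensor_idem sY u; rewrite eu in eum.
have {}cu : pure (ideal_idem k tY) (ar c *: m) = 0.
  rewrite -cu eum -pureZ -pure_balanced; congr pure; apply: ival_inj.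
  by rewrite /= arrow_src arrow_tgt.
have cm : ar c *: m = 0 by rewrite -(pure_idem_eq0 cu) idem_arrowZ.
have [w ew] := hM c Fc tc m em cm; rewrite eum ew /parr.
case: ifPn => [_|sc]; first by exists 0; rewrite scaler0 scale0r pure0r.
set b := prv c; have tb : tgt b = src c := tgt_prv c.
have sX : src c \notin X by exact: (notin_tr X_tr sc).
have [_ Fb] := thread_src thX Fc sX.
have bY : src b \notin Y by apply/negP => bY; apply: (FG Fb); exact: thread_out thY _ bY.
exists (pure (ideal_idem k bY) w); rewrite -pure_balanced -pureZ; congr pure.
by apply: ival_inj; rewrite /= -tb arrow_tgt arrow_src.
Qed.

End Bijective.
End Product.
End Multiplication.

(** * Forbidden threads *)

Section ForbiddenThreads.
Variable Q : gentle_order_quiver.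
Local Notation tr := (transition Q).
Local Notation N := (@nxt Q).
Implicit Types (a b c d : Q1 Q) (i j v : Q0 Q) (X : {set Q0 Q}).

(** These are the unions of kappa-orbits, stated through [nxt] so that threads need not be handled
    as lists. *)
Definition saturated X : Prop :=
  (forall i, i \in X -> i \in tr) /\
  (forall a c, fconnect N a c -> src a \in X -> src c \in tr -> src c \in X).

Definition threads X : pred (Q1 Q) := fun c => [exists a, fconnect N c a && (src a \in X)].

Lemma nxt_sym a c : fconnect N a c = fconnect N c a.
Proof. exact: fconnect_sym (@nxt_inj Q) a c. Qed.

Lemma threads_connect X a c : fconnect N a c -> threads X c -> threads X a.
Proof.
move=> ac /existsP[d /andP[cd dX]]; apply/existsP; exists d; rewrite dX andbT.
exact: connect_trans cd.
Qed.

Lemma iter_prvK n a : iter n (@prv Q) (iter n N a) = a.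
Proof. by elim: n a => // n IH a; rewrite iterSr iterS nxtK IH. Qed.

Section Saturated.
Variables (X : {set Q0 Q}) (hX : saturated X).

Lemma threads_rank c : threads X c -> exists n, src (iter n (@prv Q) c) \in X.
Proof.
move=> /existsP[a /andP[]]; rewrite nxt_sym => /iter_findex <- aX.
by exists (findex N a c); rewrite iter_prvK.
Qed.

Lemma threads_corank c : threads X c -> exists n, tgt (iter n N c) \in X.
Proof.
move=> /existsP[a /andP[ca aX]]; have : fconnect N c (prv a).
  by apply: connect_trans ca _; rewrite nxt_sym -{2}(prvK a) fconnect1.
by move/iter_findex => e; exists (findex N c (prv a)); rewrite e tgt_prv.
Qed.

(** A total minimum, so that ranks are defined for all arrows; the default 0 serves those that lie
    on no thread. *)
Definition least (P : pred nat) : nat :=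
  if pselect (exists n, P n) is left h then ex_minn h else 0%N.

Lemma leastP (P : pred nat) n : P n -> P (least P) /\ (least P <= n)%N.
Proof.
rewrite /least; case: pselect => [h Pn|no Pn]; last by case: no; exists n.
by case: ex_minnP => m Pm; move/(_ n Pn).
Qed.

Lemma saturated_threads_src c : threads X c -> src c \in tr -> src c \in X.
Proof.
move=> /existsP[a /andP[]]; rewrite nxt_sym => ac aX ct; exact: hX.2 ac aX ct.
Qed.

Lemma threads_nxt c : threads X c -> threads X (nxt c).
Proof. by apply: threads_connect; rewrite nxt_sym fconnect1. Qed.

Lemma threads_prv c : threads X c -> threads X (prv c).
Proof. by apply: threads_connect; rewrite -{2}(prvK c) fconnect1. Qed.

Definition saturated_threads : thread_set X (threads X).
Proof.
(* The rank counts the steps back to an arrow starting in X, the corank the steps forward to an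
   arrow ending in X. *)
exists (fun c => least (fun n => src (iter n (@prv Q) c) \in X))
  (fun c => least (fun n => tgt (iter n N c) \in X)).
- move=> c tc cX; split; last exact: threads_prv.
  by apply: contra cX; exact: saturated_threads_src.
- move=> c tc cX; split; last exact: threads_nxt.
  by apply: contra cX; rewrite -src_nxt; apply: saturated_threads_src; exact: threads_nxt.
- by move=> c cX; apply/existsP; exists c; rewrite connect0.
- by move=> c cX; apply/existsP; exists (nxt c); rewrite fconnect1 src_nxt.
- move=> c tc cX; have [n hn] := threads_rank tc.
  have [] := @leastP (fun n => src (iter n (@prv Q) c) \in X) n hn.
  case: (least _) => [|m]; first by rewrite (negbTE cX).
  rewrite iterSr => hm _; rewrite ltnS.
  by have [] := @leastP (fun n => src (iter n (@prv Q) (prv c)) \in X) m hm.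
move=> c tc cX; have [n hn] := threads_corank tc.
have [] := @leastP (fun n => tgt (iter n N c) \in X) n hn.
case: (least _) => [|m]; first by rewrite (negbTE cX).
rewrite iterSr => hm _; rewrite ltnS.
by have [] := @leastP (fun n => tgt (iter n N (nxt c)) \in X) m hm.
Defined.

End Saturated.

Lemma saturated_tr : saturated tr.
Proof. by split. Qed.

Lemma saturated0 : saturated set0.
Proof. by split=> [i|a c _]; rewrite inE. Qed.

Lemma saturatedU X Y : saturated X -> saturated Y -> saturated (X :|: Y).
Proof.
move=> [Xt hX] [Yt hY]; split=> [i|a c ac]; first by rewrite inE => /orP[/Xt|/Yt].
by rewrite in_setU [src c \in _ :|: _]in_setU => /orP[aX ct|aY ct]; [rewrite (hX a c ac aX ct)|rewrite (hY a c ac aY ct) orbT].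
Qed.

Lemma threads_disjoint X Y : saturated X -> saturated Y -> [disjoint X & Y] ->
  forall c, threads X c -> threads Y c -> False.
Proof.
move=> hX hY dXY c /existsP[a /andP[ca aX]] /existsP[d /andP[cd dY]].
have ad : fconnect N a d by apply: connect_trans cd; rewrite nxt_sym.
have := disjointFr dXY (hX.2 _ _ ad aX (hY.1 _ dY)).
by rewrite dY.
Qed.

Lemma threads_sub X c : saturated X -> threads X c -> threads tr c.
Proof.
move=> hX /existsP[a /andP[ca /hX.1 aX]]; apply/existsP; exists a; exact/andP.
Qed.

Lemma thread_fpath b w : path (fun a c => zrel c a) b w ->
  fpath N b w /\ {in w, forall a, src a \notin tr}.
Proof.
elim: w b => [|c w IH] b //= /andP[]; rewrite zrel_nxt => /andP[/eqP-> h] /IH[-> hw].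
split; first by rewrite eqxx.
by move=> a; rewrite inE => /orP[/eqP->//|/hw].
Qed.

Lemma traject_thread b n : (forall m, (m < n)%N -> tgt (iter m N b) \notin tr) ->
  path (fun a c => zrel c a) b (traject N (N b) n).
Proof.
elim: n b => //= n IH b h; rewrite zrel_ex ?(h 0%N) //=; apply: IH => m lt.
by rewrite -iterSr; exact: h.
Qed.

Lemma thread_exists b : src b \in tr -> exists w, thread_from (src b) w.
Proof.
move=> bt; have ex : exists n, tgt (iter n N b) \in tr.
  have : fconnect N b (prv b) by rewrite nxt_sym -{2}(prvK b) fconnect1.
  by move/iter_findex => e; exists (findex N b (prv b)); rewrite e tgt_prv.
pose n := ex_minn ex.
have [nt nmin] : tgt (iter n N b) \in tr /\ forall m, (m < n)%N -> tgt (iter m N b) \notin tr.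
  rewrite /n; case: ex_minnP => m mt mm; split=> // l; rewrite ltnNge.
  exact/contra/mm.
exists (traject N b n.+1); rewrite /thread_from /= eqxx andbT last_traject.
apply/and5P; split.
(* A repetition would give b a period m + 1 <= n, and then the m-th iterate already ends at the
   transition vertex [src b], against the minimality of n. *)
- change (uniq (traject N b n.+1)); rewrite looping_uniq; apply/negP => /trajectP[i lt e].
  have [m em] : exists m, (n - i)%N = m.+1 by exists (n - i).-1; rewrite prednK // subn_gt0.
  have iter_inj l : injective (iter l N) by elim: l => // l IH x y /= /nxt_inj/IH.
  have eb : iter m.+1 N b = b by apply: (iter_inj i); rewrite -e -em -iterD subnKC // ltnW.
  have := nmin m; rewrite -src_nxt -iterS eb bt; suff -> : (m < n)%N by move/(_ isT).
  by rewrite -em leq_subr.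
- exact: traject_thread.
- by rewrite zrel_nxt bt andbF.
- by apply/forallP => a; rewrite zrel_nxt bt andbF.
apply/forallP => a; rewrite zrel_nxt; case: eqP => //= ->.
by rewrite src_nxt nt.
Qed.

Lemma thread_from_iter b w : thread_from (src b) w -> src b \in tr ->
  exists n, [/\ path_end (src b) w = src (iter n.+1 N b), src (iter n.+1 N b) \in tr &
    forall m, (m < n)%N -> src (iter m.+1 N b) \notin tr].
Proof.
case: w => // b' w /andP[/and5P[_ p _ _ /forallP mx] /eqP eb] bt.
have {eb} eb : b = b' by apply: trans_out.
subst b'; have [fp wt] := thread_fpath p; have /fpathP[n ew] := fp.
have el : last b w = iter n N b by rewrite ew last_traject.
exists n; split.
- by rewrite /path_end /= last_map el -src_nxt -iterS.
- by apply/negPn/negP => h; have := mx (nxt (last b w)); rewrite zrel_nxt eqxx el -iterS h.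
move=> m lt; apply: wt; rewrite ew iterSr; apply/trajectP; by exists m.
Qed.

Lemma kappa_iter b : src b \in tr ->
  exists n, [/\ kappa (src b) = src (iter n.+1 N b), src (iter n.+1 N b) \in tr &
    forall m, (m < n)%N -> src (iter m.+1 N b) \notin tr].
Proof.
move=> bt; rewrite /kappa; case: pselect => [h|]; last by case; exact: thread_exists.
exact: thread_from_iter (svalP (cid h)) bt.
Qed.

Lemma kappa_orbitE b i : src b \in tr ->
  (i \in orbit (@kappa Q) (src b)) = (i \in tr) && [exists a, fconnect N b a && (src a == i)].
Proof.
move=> bt; rewrite -fconnect_orbit; apply/idP/andP => [|[it /existsP[a /andP[ba /eqP ea]]]].
  move=> /iter_findex <-; elim: (findex _ _ _) => [|n [it /existsP[a /andP[ba /eqP ea]]]].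
    by split=> //; apply/existsP; exists b; rewrite connect0 eqxx.
  rewrite iterS -ea; have [|m [-> mt _]] := @kappa_iter a; first by rewrite ea.
  split=> //; apply/existsP; exists (iter m.+1 N a); rewrite eqxx andbT.
  apply: connect_trans ba _; exact: fconnect_iter.
have := iter_findex ba; move: (findex _ _ _) => n; subst i.
(* Strong induction on the number of [nxt] steps, because one application of kappa accounts for m +
   1 of them. *)
elim/ltn_ind: n b bt {ba} => -[|n] IH b bt en; first by rewrite -en connect0.
have [m [ek mt mmin]] := kappa_iter bt.
have lmn : (m <= n)%N.
  by rewrite leqNgt; apply/negP => /mmin; rewrite en it.
apply: connect_trans (fconnect1 _ _) _; rewrite ek; apply: (IH (n - m)%N) => //.
  by rewrite ltnS leq_subr.
by rewrite -iterD addnS subnK.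
Qed.

Lemma kappa_orbit_setE b i : src b \in tr -> (i \in [set v in orbit (@kappa Q) (src b)]) =
  (i \in tr) && [exists a, fconnect N b a && (src a == i)].
Proof. by move=> bt; rewrite in_set kappa_orbitE. Qed.

Lemma kappa_orbitP X : kappa_orbit X -> saturated X /\ exists i, i \in X.
Proof.
move=> [j jt ->]; have [b eb] := out_arrow j; subst j; split; last first.
  by exists (src b); rewrite inE -fconnect_orbit connect0.
split=> [i|a c ac]; first by rewrite kappa_orbit_setE // => /andP[].
rewrite !kappa_orbit_setE // => /andP[at_ /existsP[d /andP[bd /eqP ed]]] ct; rewrite ct.
apply/existsP; exists c; rewrite eqxx andbT; apply: connect_trans bd _.
by rewrite -(trans_out at_ ed).
Qed.

Lemma kappa_orbit_disjoint X Y : kappa_orbit X -> kappa_orbit Y -> X != Y -> [disjoint X & Y].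
Proof.
move=> [i it ->] [j jt ->]; have [a ea] := out_arrow i; have [b eb] := out_arrow j.
subst i j; apply: contraNT => /pred0Pn[v /andP[/=]]; rewrite !kappa_orbit_setE //.
move=> /andP[vt /existsP[c /andP[ac /eqP ec]]] /andP[_ /existsP[d /andP[bd /eqP ed]]].
have ecd : c = d by apply: trans_out; rewrite ec ?ed.
subst d; have ab : fconnect N a b by apply: connect_trans ac _; rewrite nxt_sym.
apply/eqP/setP => w; rewrite !kappa_orbit_setE //; congr (_ && _).
by apply: eq_existsb => d; rewrite (same_connect (fconnect_sym (@nxt_inj Q)) ab).
Qed.

Lemma kappa_orbit_cover i : i \in tr -> exists2 X, kappa_orbit X & i \in X.
Proof.
move=> it; exists [set v in orbit (@kappa Q) i]; first by exists i.
by rewrite inE -fconnect_orbit connect0.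
Qed.

End ForbiddenThreads.

(** * Derived equivalences *)

Section Resolutions.
Variables (k : fieldType) (Q : gentle_order_quiver).
Local Notation L := (completed_alg k Q).
Local Notation Ch := (complexes L).
Local Notation tr := (transition Q).

Section Left.
Variable sg : Q1 Q -> k.
Hypothesis sg2 : forall a, sg a * sg a = 1.
Hypothesis sg_opp : forall a b, a != b -> src a = src b -> sg a + sg b = 0.

Lemma left_resolution_exact (F : pred (Q1 Q)) (th : thread_set tr F) :
  exists (r : functor Ch Ch) (q : nat_trans r (functor_id Ch)),
    (forall X, quasi_iso (q X)) /\ forall (X : complex L) m, left_exact F ((r X : complex L) m).
Proof.
have [n [b hb]] := order_free k Q; have [phi phiP] := dual_basis hb.
have [y yP] := choice (fun i => Theta_surj sg2 sg_opp (phi i)).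
pose p := trace_aug sg2 phiP yP.
have ps (M : lmodType L) (x : M) : exists h, p M h = x by exact: trace_aug_surj.
pose fg (M : lmodType L) (h : finitely_generated M) := fg_ker (p M) (mobj_fg (induced k tr) h).
pose K := ker_functor fg; pose i : mod_nat K (induced k tr) := ker_nat fg.
have pi0 (M : lmodType L) (z : K M) : p M (i M z) = 0 by exact: kvalP.
(* Each step of the resolution secures the arrows of one more rank. *)
pose N := (\max_c thread_rank th c).+1.
exists (projT1 (left_resolution pi0 N)), (projT2 (left_resolution pi0 N)); split=> [X|X m].
  apply: left_resolution_quasi_iso; first exact: ps.
    by move=> M l e; exists (KerMod e).
  by move=> M z e; exact: kval_inj.
have := @left_resolution_terms _ _ _ _ _ pi0 (left_upto th (k := k)) _ _ _ _ N X m.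
move=> H c Fc; apply: H => //; last by rewrite Fc /= /N ltnS; exact: leq_bigmax.
- by move=> s M M'; exact: left_exact_prod.
- by move=> M d /andP[_]; rewrite ltn0.
- move=> s M hM; apply: left_upto_ker => //; exact: induced_left_exact.
- by move=> s M; exact: induced_left_exact.
Qed.
End Left.

Lemma right_resolution_exact (F : pred (Q1 Q)) (th : thread_set tr F) :
  exists (c : functor Ch Ch) (j : nat_trans (functor_id Ch) c),
    (forall X, quasi_iso (j X)) /\ forall (X : complex L) m, right_exact F ((c X : complex L) m).
Proof.
pose NN := induced k (@set0 (Q0 Q)); pose i := coind_unit k Q.
pose S := coker_functor (@coind_retrD k Q) (@coind_retrK k Q) (@coind_retr_nat k Q)
  (fun M => @mobj_fg _ NN M).
pose p : mod_nat NN S := coker_nat (@coind_retrD k Q) (@coind_retrK k Q) (@coind_retr_nat k Q)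
  (fun M => @mobj_fg _ NN M).
have pi0 (M : lmodType L) (z : M) : p M (i M z) = 0.
  apply: cval_inj; apply: (etrans (congr1 (fun w => i M z - i M w) (coind_retrK z))).
  exact: subrr.
have ps (M : lmodType L) (x : S M) : exists l, p M l = x.
  exists (cval x); apply: cval_inj.
  apply: (etrans (congr1 (fun w => cval x - i M w) (cvalP x))).
  by rewrite linear0 subr0.
have kp (M : lmodType L) (l : NN M) : p M l = 0 -> exists z, i M z = l.
  move=> e; exists (coind_retr l); apply/esym/eqP; rewrite -subr_eq0; apply/eqP.
  exact: (congr1 (fun w : S M => cval w) e).
have ji (M : lmodType L) (z : M) : i M z = 0 -> z = 0.
  by move=> e; rewrite -[z]coind_retrK -/(i M z) e.
pose N := (\max_c thread_corank th c).+1.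
exists (projT1 (right_resolution pi0 N)), (projT2 (right_resolution pi0 N)); split=> [X|X m].
  exact: right_resolution_quasi_iso.
have := @right_resolution_terms _ _ _ _ _ pi0 (right_upto th (k := k)) _ _ _ _ N X m.
move=> H c Fc; apply: H => //; last by rewrite Fc /= /N ltnS; exact: leq_bigmax.
- by move=> s M M'; exact: right_exact_prod.
- by move=> M d /andP[_]; rewrite ltn0.
- move=> s M hM; apply: (@right_upto_coker _ _ _ _ th (@saturated_tr _).1 s M (NN M) (S M) (i M) (p M)) => //.
  + exact: kp.
  + exact: ji.
  + exact: coinduced_right_exact.
- by move=> s M; exact: coinduced_right_exact.
Qed.

End Resolutions.

Section Whiskering.
Variable C : category.
Implicit Types (F G H r s c : functor C C).

Definition nat_assoc_r H G F :
  nat_trans (functor_comp (functor_comp H G) F) (functor_comp H (functor_comp G F)).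
Proof.
unshelve eexists; first by move=> X; exact: (idc (H (G (F X)))).
by move=> X Y f; apply: heq_trans (comp_id_l (fmap H (fmap G (fmap F f)))) (heq_sym (comp_id_r _)).
Defined.

Definition nat_unit_l F : nat_trans (functor_comp (functor_id C) F) F.
Proof.
unshelve eexists; first by move=> X; exact: (idc (F X)).
by move=> X Y f; apply: heq_trans (comp_id_l (fmap F f)) (heq_sym (comp_id_r _)).
Defined.

Definition nat_unit_r F :
  nat_trans (functor_comp F (functor_id C)) F.
Proof.
unshelve eexists; first by move=> X; exact: (idc (F X)).
by move=> X Y f; apply: heq_trans (comp_id_l (fmap F f)) (heq_sym (comp_id_r _)).
Defined.

(** For a composite of two derived functors: it removes the inner resolution once the values of
    [G s] are already adapted to [F]. *)
Definition nat_drop F r G s (q : nat_trans r (functor_id C)) :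
  nat_trans (functor_comp (functor_comp F r) (functor_comp G s))
            (functor_comp (functor_comp F G) s).
Proof.
exists (fun X => fmap F (q (G (s X)))) => X Y f.
exact: (naturality (nat_whisk_l F q) (fmap G (fmap s f))).
Defined.

Definition nat_insert F c G s (j : nat_trans (functor_id C) c) :
  nat_trans (functor_comp (functor_comp F G) s)
            (functor_comp (functor_comp F c) (functor_comp G s)).
Proof.
exists (fun X => fmap F (j (G (s X)))) => X Y f.
exact: (naturality (nat_whisk_l F j) (fmap G (fmap s f))).
Defined.

Definition nat_drop_last F G r (q : nat_trans r (functor_id C)) :
  nat_trans (functor_comp F (functor_comp G r)) (functor_comp F G).
Proof.
exists (fun X => fmap F (fmap G (q X))) => X Y f.
exact: (naturality (nat_whisk_l F (nat_whisk_l G q)) f).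
Defined.

End Whiskering.

Section LiftNat.
Variable A : pzRingType.
Local Notation Ch := (complexes A).
Local Notation qi := (@quasi_iso A).

Lemma lift_nat_bij (F G : mod_functor A) (u : mod_nat F G) (X : Ch) :
  (forall M z, u M z = 0 -> z = 0) -> (forall M y, exists z, u M z = y) ->
  qi (lift_nat u X : @hom Ch _ _).
Proof. by move=> ui us; apply: quasi_iso_bij => n; [exact: ui|exact: us]. Qed.

Lemma quasi_iso_id (X : Ch) : qi (idc X).
Proof. by apply: quasi_iso_bij => // n y; exists y. Qed.

Lemma nat_comp_qi (F G H : functor Ch Ch) (v : nat_trans G H) (u : nat_trans F G) :
  (forall X, qi (v X)) -> (forall X, qi (u X)) -> forall X, qi (nat_comp v u X).
Proof. by move=> vW uW X; exact: (quasi_iso_comp (vW X) (uW X)). Qed.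

Lemma nat_assoc_r_qi (H G F : functor Ch Ch) X : qi (nat_assoc_r H G F X).
Proof. exact: quasi_iso_id. Qed.

Lemma preserves_w_transfer (F G : functor Ch Ch) (u : nat_trans F G) :
  (forall X, qi (u X)) -> preserves_w qi G -> preserves_w qi F.
Proof.
move=> uW hG X Y f fW; apply: (@quasi_iso_cancel_l _ _ _ _ (u Y)); first exact: uW.
apply: (@quasi_iso_heq _ _ _ (Defs.comp (fmap G f) (u X))); last first.
  exact: (quasi_iso_comp (hG _ _ _ fW) (uW X)).
by move=> n x; apply: esym; exact: (naturality u f).
Qed.

Lemma preserves_w_transfer_r (F G : functor Ch Ch) (u : nat_trans F G) :
  (forall X, qi (u X)) -> preserves_w qi F -> preserves_w qi G.
Proof.
move=> uW hF X Y f fW; apply: (@quasi_iso_cancel_r _ _ _ _ _ (u X)); first exact: uW.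
apply: (@quasi_iso_heq _ _ _ (Defs.comp (u Y) (fmap F f))).
  by move=> n x; exact: (naturality u f).
exact: (quasi_iso_comp (uW Y) (hF _ _ _ fW)).
Qed.

Lemma quasi_iso_transfer (F G : functor Ch Ch) (u : nat_trans F G) X Y (f : hom X Y) :
  (forall X, qi (u X)) -> qi (fmap G f) -> qi (fmap F f).
Proof.
move=> uW fW; apply: (@quasi_iso_cancel_l _ _ _ _ (u Y)); first exact: uW.
apply: (@quasi_iso_heq _ _ _ (Defs.comp (fmap G f) (u X))); last first.
  exact: (quasi_iso_comp fW (uW X)).
by move=> n x; apply: esym; exact: (naturality u f).
Qed.

Lemma preserves_w_comp (F G : functor Ch Ch) : preserves_w qi F -> preserves_w qi G ->
  preserves_w qi (functor_comp G F).
Proof. by move=> hF hG X Y f fW; exact/hG/hF. Qed.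

Lemma preserves_w_id : preserves_w qi (functor_id Ch).
Proof. by []. Qed.

Definition lift_compose (G F : mod_functor A) :
  nat_trans (lift_functor (mod_comp G F)) (functor_comp (lift_functor G) (lift_functor F)).
Proof.
unshelve eexists.
  move=> X; apply: (@ChainMap _ (lift_complex (mod_comp G F) X)
    (lift_complex G (lift_complex F X)) (fun n => idfun)) => n x; exact: erefl.
by move=> X Y f n x.
Defined.

Definition lift_decompose (G F : mod_functor A) :
  nat_trans (functor_comp (lift_functor G) (lift_functor F)) (lift_functor (mod_comp G F)).
Proof.
unshelve eexists.
  move=> X; apply: (@ChainMap _ (lift_complex G (lift_complex F X))
    (lift_complex (mod_comp G F) X) (fun n => idfun)) => n x; exact: erefl.
by move=> X Y f n x.
Defined.

Lemma tensor_derived (B : bimodule A) (Bfg : finitely_generated B) (r : functor Ch Ch)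
  (q : nat_trans r (functor_id Ch))
  (h : preserves_w qi (functor_comp (lift_functor (tensor_mod Bfg)) r)) :
  (forall X, qi (q X)) -> (forall X, qi (fmap (lift_functor (tensor_mod Bfg)) (q (r X)))) ->
  exists2 LF, derived_tensor Bfg LF & nat_iso LF (loc_lift h).
Proof.
move=> qW TqW; pose u := nat_whisk_r r (tensor_lift_nat Bfg).
have uW X : qi (tensor_lift_nat Bfg X).
  by apply: quasi_iso_bij => // n y; exists y.
have h' : preserves_w qi (functor_comp (tensor_functor Bfg) r).
  by apply: (preserves_w_transfer (u := u)) h => X; exact: uW.
exists (loc_lift h').
  apply: (left_derived_of_resolution h' qW) => X.
  exact: (quasi_iso_transfer uW (TqW X)).
by apply: (loc_lift_iso h' h (u := u)) => X; exact: uW.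
Qed.

End LiftNat.

(** * Explicit models of the derived tensor products with I(X) *)

Section Derived.
Variables (k : fieldType) (Q : gentle_order_quiver).
Local Notation L := (completed_alg k Q).
Local Notation Ch := (complexes L).
Local Notation qi := (@quasi_iso L).
Local Notation tr := (transition Q).
Local Notation Tm X := (tensor_mod (gentle_ideal_fg k X)).
Local Notation T X := (lift_functor (Tm X)).
Implicit Types (X Y : {set Q0 Q}).

(** The threads of X are among those of Q_0^t, so one resolution, made for Q_0^t, serves all X at
    once. *)
Lemma left_exact_sub X (M : lmodType L) : saturated X ->
  left_exact (threads tr) M -> left_exact (threads X) M.
Proof. by move=> hX hM c /(threads_sub hX); exact: hM. Qed.

Lemma right_exact_sub X (M : lmodType L) : saturated X ->
  right_exact (threads tr) M -> right_exact (threads X) M.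
Proof. by move=> hX hM c /(threads_sub hX); exact: hM. Qed.

Lemma tensor_quasi_iso X (hX : saturated X) (C D : complex L) (f : chain_map C D) :
  (forall n, left_exact (threads X) (C n)) -> (forall n, left_exact (threads X) (D n)) ->
  qi (f : @hom Ch _ _) -> qi (fmap (T X) (f : @hom Ch _ _)).
Proof.
move=> hC hD; apply: (lift_quasi_iso _ _ hC hD); first by move=> M N; exact: left_exact_prod.
by move=> E hE; apply: (tensor_acyclic hX.1 (saturated_threads hX)).
Qed.

Lemma hom_ideal_fg X (M : lmodType L) : finitely_generated M ->
  finitely_generated (hom_over (gentle_ideal k X) (fun=> True) M).
Proof. exact: fg_hom_ideal. Qed.

Local Notation Hm X := (hom_functor (@hom_ideal_fg X)).
Local Notation H X := (lift_functor (Hm X)).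

Lemma hom_quasi_iso X (hX : saturated X) (C D : complex L) (f : chain_map C D) :
  (forall n, right_exact (threads X) (C n)) -> (forall n, right_exact (threads X) (D n)) ->
  qi (f : @hom Ch _ _) -> qi (fmap (H X) (f : @hom Ch _ _)).
Proof.
move=> hC hD; apply: (lift_quasi_iso _ _ hC hD); first by move=> M N; exact: right_exact_prod.
by move=> E hE; apply: (hom_acyclic hX.1 (saturated_threads hX)).
Qed.

Definition unit_nat X : mod_coaug (mod_comp (Hm X) (Tm X)).
Proof.
exists (fun M => mklin (@unit_linear k Q X M)) => M N f m; apply: hom_overP => x /=.
exact/esym/tensor_map_pure.
Defined.

Definition counit_nat X : mod_aug (mod_comp (Tm X) (Hm X)).
Proof.
exists (@counit k Q X) => M N f z.
change (@counit k Q X N (tensor_map (ho_map (gentle_ideal k X) (fun=> True) f) z) = f (@counit k Q X M z)).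
apply: (@tensor_ext L _ (hom_over (gentle_ideal k X) (fun=> True) M) N
  (@counit k Q X N \o tensor_map (ho_map (gentle_ideal k X) (fun=> True) f))%FUN (f \o @counit k Q X M)%FUN) => x phi.
change (@counit k Q X N (tensor_map (ho_map (gentle_ideal k X) (fun=> True) f) (pure x phi)) = f (@counit k Q X M (pure x phi))).
by rewrite tensor_map_pure !counit_pure.
Defined.

Variables (r : functor Ch Ch) (q : nat_trans r (functor_id Ch)).
Hypothesis qW : forall C, qi (q C).
Hypothesis rP : forall (C : complex L) m, left_exact (threads tr) ((r C : complex L) m).
Variables (c : functor Ch Ch) (j : nat_trans (functor_id Ch) c).
Hypothesis jW : forall C, qi (j C).
Hypothesis cP : forall (C : complex L) m, right_exact (threads tr) ((c C : complex L) m).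

Lemma res_w : preserves_w qi r.
Proof. exact: preserves_w_transfer qW (@preserves_w_id L). Qed.

Lemma cores_w : preserves_w qi c.
Proof. exact: preserves_w_transfer_r jW (@preserves_w_id L). Qed.

Lemma tensor_res_w X (hX : saturated X) : preserves_w qi (functor_comp (T X) r).
Proof.
move=> C D f fW; apply: (tensor_quasi_iso hX) => [n|n|]; try exact/left_exact_sub/rP.
exact: res_w.
Qed.

Lemma hom_cores_w X (hX : saturated X) : preserves_w qi (functor_comp (H X) c).
Proof.
move=> C D f fW; apply: (hom_quasi_iso hX) => [n|n|]; try exact/right_exact_sub/cP.
exact: cores_w.
Qed.

Definition LT X (hX : saturated X) := loc_lift (tensor_res_w hX).

Lemma LT_derived X (hX : saturated X) :
  exists2 LF, derived_tensor (gentle_ideal_fg k X) LF & nat_iso LF (LT hX).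
Proof.
apply: (tensor_derived (tensor_res_w hX) qW) => C.
by apply: (tensor_quasi_iso hX) => // n; exact/left_exact_sub/rP.
Qed.

Lemma LT_irr X (hX hX' : saturated X) : nat_iso (LT hX) (LT hX').
Proof. by apply: (loc_lift_iso _ _ (u := nat_id _)) => C; exact: quasi_iso_id. Qed.

Lemma loc_lift_unit (F : functor Ch Ch) (hF : preserves_w qi F)
  (h : preserves_w qi (functor_comp (functor_id Ch) F)) (p : nat_trans F (functor_id Ch)) :
  (forall C, qi (p C)) -> nat_iso (loc_lift h) (functor_id _).
Proof.
move=> pW; apply: nat_iso_trans (loc_lift_iso h hF (u := nat_unit_l F) _) _.
  by move=> C; exact: quasi_iso_id.
exact: nat_iso_trans (loc_lift_iso hF (@preserves_w_id L) pW) (loc_lift_id _).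
Qed.

Lemma loc_lift_counit (F : functor Ch Ch) (hF : preserves_w qi F)
  (h : preserves_w qi (functor_comp (functor_id Ch) F)) (p : nat_trans (functor_id Ch) F) :
  (forall C, qi (p C)) -> nat_iso (loc_lift h) (functor_id _).
Proof.
move=> pW; apply: nat_iso_trans (loc_lift_iso h hF (u := nat_unit_l F) _) _.
  by move=> C; exact: quasi_iso_id.
apply: nat_iso_trans (nat_iso_sym (loc_lift_iso (@preserves_w_id L) hF pW)) _.
exact: loc_lift_id.
Qed.

Lemma preserves_w_unit (F : functor Ch Ch) : preserves_w qi F ->
  preserves_w qi (functor_comp (functor_id Ch) F).
Proof. by move=> hF; exact: preserves_w_comp hF (@preserves_w_id L). Qed.

Lemma LT_equivalence X (hX : saturated X) : is_equivalence (LT hX).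
Proof.
have thX := saturated_threads hX.
have resX (C : complex L) n : left_exact (threads X) ((r C : complex L) n).
  exact/left_exact_sub/rP.
have coresX (C : complex L) n : right_exact (threads X) ((c C : complex L) n).
  exact/right_exact_sub/cP.
have TrX (C : complex L) n : right_exact (threads X) ((T X (r C) : complex L) n).
  exact: (tensor_right_exact hX.1 thX).
have HcX (C : complex L) n : left_exact (threads X) ((H X (c C) : complex L) n).
  exact: (hom_left_exact hX.1 thX).
exists (loc_lift (hom_cores_w hX)); split.
  pose h := preserves_w_comp (tensor_res_w hX) (hom_cores_w hX).
  apply: nat_iso_trans (loc_lift_comp (tensor_res_w hX) (hom_cores_w hX) h) _.
  pose u1 := nat_whisk_r r (nat_comp (lift_compose (Hm X) (Tm X)) (lift_coaug (unit_nat X))).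
  have u1W C : qi (u1 C).
    apply: quasi_iso_bij => n x; first by move/(unit_inj hX.1 thX (resX C n)).
    by have [m em] := unit_surj hX.1 thX x (resX C n); exists m.
  (* The terms of [T X (r C)] are right exact, so Hom preserves the coresolution map at this
     complex. *)
  pose u2 := nat_insert (H X) (T X) r j.
  have u2W C : qi (u2 C) by exact: (hom_quasi_iso hX (TrX C) (coresX _) (jW _)).
  have hr := preserves_w_unit res_w.
  apply: nat_iso_trans (nat_iso_sym (loc_lift_iso hr h (u := nat_comp u2 u1) _)) _.
    exact: nat_comp_qi.
  exact: loc_lift_unit res_w _ q qW.
pose h := preserves_w_comp (hom_cores_w hX) (tensor_res_w hX).
apply: nat_iso_trans (loc_lift_comp (hom_cores_w hX) (tensor_res_w hX) h) _.
pose v1 := nat_drop (T X) (H X) c q.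
have v1W C : qi (v1 C) by exact: (tensor_quasi_iso hX (resX _) (HcX C) (qW _)).
pose v2 := nat_whisk_r c (nat_comp (lift_aug (counit_nat X)) (lift_decompose (Tm X) (Hm X))).
have v2W C : qi (v2 C).
  apply: quasi_iso_bij => n x; first by move/(counit_inj hX.1 thX (coresX C n)).
  by have [m em] := counit_surj hX.1 thX x (coresX C n); exists m.
have hc := preserves_w_unit cores_w.
apply: nat_iso_trans (loc_lift_iso h hc (u := nat_comp v2 v1) _) _.
  exact: nat_comp_qi.
exact: loc_lift_counit cores_w _ j jW.
Qed.

Lemma LT_empty : nat_iso (LT (@saturated0 Q)) (functor_id _).
Proof.
pose u := nat_whisk_r r (lift_aug (tensor_unit k Q)).
have uW C : qi (u C).
  by apply: quasi_iso_bij => n; [exact: tensor_unit_map_inj|exact: tensor_unit_map_surj].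
have hr := preserves_w_unit res_w.
apply: nat_iso_trans (loc_lift_iso (tensor_res_w (@saturated0 Q)) hr (u := u) uW) _.
exact: loc_lift_unit res_w _ q qW.
Qed.

(** As I(Y) (x) - keeps the exactness along the threads of X, the inner resolution is dropped;
    multiplication of ideals does the rest. *)
Lemma LT_union X Y (hX : saturated X) (hY : saturated Y) (hXY : saturated (X :|: Y)) :
  [disjoint X & Y] -> nat_iso (functor_comp (LT hX) (LT hY)) (LT hXY).
Proof.
move=> dXY; have dF := threads_disjoint hX hY dXY.
have thX := saturated_threads hX; have thY := saturated_threads hY.
pose h := preserves_w_comp (tensor_res_w hY) (tensor_res_w hX).
apply: nat_iso_trans (loc_lift_comp (tensor_res_w hY) (tensor_res_w hX) h) _.
pose u1 := nat_drop (T X) (T Y) r q.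
have u1W C : qi (u1 C).
  apply: (tensor_quasi_iso hX) (qW _) => n; first exact/left_exact_sub/rP.
  by apply: (tensor_left_exact_disjoint hX.1 hY.1 thX thY dF); exact/left_exact_sub/rP.
pose u2 := nat_whisk_r r (nat_comp (lift_nat (tensor_mul_nat k X Y)) (lift_decompose (Tm X) (Tm Y))).
have u2W C : qi (u2 C).
  apply: quasi_iso_bij => n x.
    exact: (tensor_mul_inj hX.1 hY.1 thX thY dF).
  exact: (tensor_mul_surj hX.1 hY.1 thX thY dF).
apply: (loc_lift_iso h (tensor_res_w hXY) (u := nat_comp u2 u1)); exact: nat_comp_qi.
Qed.

End Derived.

(** * The twist functor and the factorization of the Nakayama functor *)

Section Nakayama.
Variables (k : fieldType) (Q : gentle_order_quiver).
Local Notation L := (completed_alg k Q).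
Local Notation Ch := (complexes L).
Local Notation qi := (@quasi_iso L).
Local Notation tr := (transition Q).
Local Notation Tm X := (tensor_mod (gentle_ideal_fg k X)).
Local Notation T X := (lift_functor (Tm X)).
Implicit Types (X Y : {set Q0 Q}).

Variables (r : functor Ch Ch) (q : nat_trans r (functor_id Ch)).
Hypothesis qW : forall C, qi (q C).
Hypothesis rP : forall (C : complex L) m, left_exact (threads tr) ((r C : complex L) m).

Variables (xi : {rmorphism L -> L}) (sg : Q1 Q -> k).
Hypothesis sg2 : forall a, sg a * sg a = 1.
Hypothesis sg_opp : forall a b, a != b -> src a = src b -> sg a + sg b = 0.
Hypothesis xi_twist : xi =1 twist sg.
Local Notation xiK := (xi_invol sg2 xi_twist).
Local Notation Xm := (twist_functor xiK).
Local Notation Xi := (lift_functor Xm).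
Local Notation xi_w := (twist_preserves_w xiK).
Local Notation LX hX := (LT qW rP hX).

Definition Lxi := loc_lift xi_w.

(** Twisting leaves the underlying complexes unchanged, hence is exact, and the identity serves as
    resolution. *)
Lemma Lxi_derived :
  exists2 LF, derived_tensor (twist_fg xiK) LF & nat_iso LF Lxi.
Proof.
pose v := lift_nat (twist_tensor_nat xiK (twist_fg xiK)).
have vW C : qi (v C).
  apply: lift_nat_bij => M; [exact: twist_tensor_inj|exact: twist_tensor_surj].
have hv := preserves_w_transfer vW xi_w.
have h := preserves_w_comp (@preserves_w_id L) hv.
have [C|C|LF d i] := tensor_derived (q := nat_id _) h; last 1 first.
- exists LF => //; apply: nat_iso_trans i _.
  pose u := nat_comp v (nat_unit_r (lift_functor (tensor_mod (twist_fg xiK)))).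
  apply: (loc_lift_iso h xi_w (u := u)) => C.
  exact: (quasi_iso_comp (vW C) (quasi_iso_id _)).
- exact: quasi_iso_id.
apply: hv; exact: quasi_iso_id.
Qed.

Lemma twist_twist_linear (M : lmodType L) :
  linear (id : twist_mod (twist_mod M xi) xi -> M).
Proof. by move=> f m m'; rewrite !tm_scaleE xiK. Qed.

Definition twist_twist : mod_aug (mod_comp Xm Xm).
Proof. by exists (fun M => mklin (@twist_twist_linear M)). Defined.

Lemma Lxi_equivalence : is_equivalence Lxi.
Proof.
suff h : nat_iso (functor_comp Lxi Lxi) (functor_id _) by exists Lxi.
have hh := preserves_w_comp xi_w xi_w.
apply: nat_iso_trans (loc_lift_comp xi_w xi_w hh) _.
pose u := nat_comp (lift_aug twist_twist) (lift_decompose Xm Xm).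
apply: nat_iso_trans (loc_lift_iso hh (@preserves_w_id L) (u := u) _) (loc_lift_id _) => C.
by apply: quasi_iso_bij => // n y; exists y.
Qed.

(** With T for tensoring, the zigzag from T r Xi r has one leg to T r Xi, dropping the last
    resolution, and one to T Xi r and on to Xi T r, dropping the middle one because Xi preserves
    left exactness. *)
Lemma Lxi_LT X (hX : saturated X) :
  nat_iso (functor_comp Lxi (LX hX)) (functor_comp (LX hX) Lxi).
Proof.
have hT := tensor_res_w qW rP hX.
have h1 := preserves_w_comp hT xi_w; have h2 := preserves_w_comp xi_w hT.
apply: nat_iso_trans (loc_lift_comp _ _ h1) _.
apply: nat_iso_trans _ (nat_iso_sym (loc_lift_comp _ _ h2)).
have h := preserves_w_comp (preserves_w_comp (res_w qW) xi_w) hT.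
pose v := nat_drop_last (functor_comp (T X) r) Xi q.
have vW C : qi (v C) by apply: hT; apply: xi_w; exact: qW.
apply: nat_iso_trans _ (loc_lift_iso h h2 (u := v) vW); apply: nat_iso_sym.
pose u1 := nat_drop (T X) Xi r q.
have u1W C : qi (u1 C).
  apply: (tensor_quasi_iso hX) (qW _) => n; first exact/left_exact_sub/rP.
  by apply: (twist_left_exact sg2 xi_twist); exact/left_exact_sub/rP.
pose u2 := nat_whisk_r r (nat_comp (lift_compose Xm (Tm X))
  (nat_comp (lift_nat (xi_swap_nat sg2 xi_twist X)) (lift_decompose (Tm X) Xm))).
have u2W C : qi (u2 C).
  by apply: quasi_iso_bij => n x; [exact: xi_swap_inj|exact: xi_swap_surj].
pose u3 := nat_assoc_r Xi (T X) r.
apply: (loc_lift_iso h h1 (u := nat_comp u3 (nat_comp u2 u1))); apply: nat_comp_qi.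
  exact: nat_assoc_r_qi.
exact: (nat_comp_qi u2W u1W).
Qed.

(** The isomorphism of omega (x) M with the twist of I(Q_0^t) (x) M exists before deriving, and the
    twist is exact, so the resolution for I(Q_0^t) also derives tensoring with omega. *)
Lemma nakayama_derived (fg : finitely_generated (omega k Q)) :
  exists2 LF, derived_tensor fg LF & nat_iso LF (functor_comp Lxi (LX (@saturated_tr Q))).
Proof.
have hT := tensor_res_w qW rP (@saturated_tr Q).
pose v := nat_comp (lift_compose Xm (Tm tr)) (lift_nat (omega_twist_nat sg2 sg_opp xi_twist fg)).
have vW C : qi (v C).
  by apply: quasi_iso_bij => n x; [exact: omega_twist_inj|exact: omega_twist_surj].
have h1 := preserves_w_comp hT xi_w.
pose u := nat_comp (nat_assoc_r Xi (T tr) r) (nat_whisk_r r v).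
have uW C : qi (u C).
  by apply: nat_comp_qi; [exact: nat_assoc_r_qi|move=> D; exact: vW].
have h := preserves_w_transfer uW h1.
have [C|LF d i] := tensor_derived h qW.
  apply: (quasi_iso_transfer vW); apply: xi_w.
  by apply: (tensor_quasi_iso (@saturated_tr Q)) (qW _) => n; exact: rP.
exists LF => //; apply: nat_iso_trans i _.
apply: nat_iso_trans _ (nat_iso_sym (loc_lift_comp _ _ h1)).
exact: (loc_lift_iso h h1 uW).
Qed.

Lemma LT_composite b (X : 'I_b -> {set Q0 Q}) (F : 'I_b -> functor (derived_cat L) (derived_cat L))
  (hX : forall a, saturated (X a)) :
  (forall a a', a != a' -> [disjoint X a & X a']) ->
  (forall a, nat_iso (F a) (LX (hX a))) ->
  forall s (hs : saturated (\bigcup_(a <- s) X a)), uniq s ->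
  nat_iso (foldr (fun a G => functor_comp G (F a)) (functor_id _) s) (LX hs).
Proof.
move=> dX eF; elim=> [|a s IH] hs /=.
  move=> _; move: hs; rewrite big_nil => hs; apply: nat_iso_sym.
  exact: nat_iso_trans (LT_irr _ _ _ (@saturated0 Q)) (LT_empty qW rP).
move=> /andP[as_ us].
have hs' : saturated (\bigcup_(c <- s) X c).
  elim: (s) => [|c l IHl]; first by rewrite big_nil; exact: saturated0.
  by rewrite big_cons; exact: saturatedU.
apply: nat_iso_trans (nat_iso_comp (IH hs' us) (eF a)) _.
(* The fold applies [F a] first, so [X a] is the right-hand term of the union. *)
move: hs; rewrite big_cons setUC => hs; apply: LT_union.
elim: (s) as_ => [|c l IHl]; first by rewrite big_nil -setI_eq0 set0I.
rewrite inE negb_or => /andP[ac /IHl]; rewrite big_cons -!setI_eq0 setIUl => /eqP->.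
by rewrite setU0 setI_eq0 disjoint_sym; exact: dX.
Qed.

End Nakayama.

Theorem theorem0p1 (k : fieldType) (Q : gentle_order_quiver)
    (b : nat) (X : 'I_b -> {set Q0 Q})
    (xi : {rmorphism completed_alg k Q -> completed_alg k Q})
    (X_inj : injective X)
    (X_orbits : forall Y : {set Q0 Q}, (exists a, X a = Y) <-> kappa_orbit Y)
    (xi_spec : is_xi xi) :
  exists (fgI : forall a, finitely_generated (gentle_ideal k (X a)))
         (fgxi : finitely_generated (twist_bimodule xi))
         (fgw : finitely_generated (omega k Q)),
    (forall a, exists T, derived_tensor (fgI a) T) /\
    (exists xis, derived_tensor fgxi xis) /\
    (exists nu, derived_tensor fgw nu) /\
    forall (T : 'I_b -> functor (derived_cat (completed_alg k Q))
                                (derived_cat (completed_alg k Q)))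
           (xis nu : functor (derived_cat (completed_alg k Q))
                             (derived_cat (completed_alg k Q))),
      (forall a, derived_tensor (fgI a) (T a)) ->
      derived_tensor fgxi xis ->
      derived_tensor fgw nu ->
      is_equivalence xis /\
      (forall a, is_equivalence (T a)) /\
      (forall a, nat_iso (functor_comp xis (T a)) (functor_comp (T a) xis)) /\
      (forall a a', nat_iso (functor_comp (T a) (T a'))
                            (functor_comp (T a') (T a))) /\
      is_equivalence nu /\
      nat_iso nu (functor_comp xis (composite T)).
Proof.
have [sg [sg2 sg_opp xi_twist]] := xi_signs xi_spec.
have orb a : kappa_orbit (X a) by apply/X_orbits; exists a.
have hX a : saturated (X a) by have [] := kappa_orbitP (orb a).
have dX a a' : a != a' -> [disjoint X a & X a'].
  by move=> ne; apply: kappa_orbit_disjoint => //; apply: contra ne => /eqP/X_inj->.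
have [r [q [qW rP]]] := left_resolution_exact sg2 sg_opp (saturated_threads (@saturated_tr Q)).
have [c [j [jW cP]]] := right_resolution_exact k (saturated_threads (@saturated_tr Q)).
have uniq_derived (B : bimodule (completed_alg k Q)) (Bfg : finitely_generated B) F F' :
    derived_tensor Bfg F -> derived_tensor Bfg F' -> nat_iso F F'.
  by move=> [e d] [e' d']; exact: left_derived_unique d d'.
have fgw := omega_fg sg2 sg_opp xi_twist.
exists (fun a => gentle_ideal_fg k (X a)), (twist_fg (xi_invol sg2 xi_twist)), fgw.
split=> [a|]; first by have [LF] := LT_derived qW rP (hX a); exists LF.
have [Lx dx ix] := Lxi_derived sg2 xi_twist; split; first by exists Lx.
have [Ln dn in_] := nakayama_derived qW rP sg2 sg_opp xi_twist fgw; split; first by exists Ln.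
move=> T xis nu dT dxi dnu.
pose LX a := LT qW rP (hX a); pose LXi := Lxi sg2 xi_twist.
have eT a : nat_iso (T a) (LX a).
  by have [LF d i] := LT_derived qW rP (hX a); exact: nat_iso_trans (uniq_derived _ _ _ _ (dT a) d) i.
have exi : nat_iso xis LXi := nat_iso_trans (uniq_derived _ _ _ _ dxi dx) ix.
have enu := nat_iso_trans (uniq_derived _ _ _ _ dnu dn) in_.
(* The orbits exhaust the transition vertices, so the composite of all T is the functor of the
   single ideal I(Q_0^t). *)
have bigX : \bigcup_(a <- enum 'I_b) X a = transition Q.
  apply/setP => i; rewrite big_enum /=; apply/bigcupP/idP => [[a _ ia]|it].
    exact: (hX a).1.
  have [Y /X_orbits[a <-] iY] := kappa_orbit_cover it; by exists a.
have hs : saturated (\bigcup_(a <- enum 'I_b) X a) by rewrite bigX; exact: saturated_tr.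
have eC : nat_iso (composite T) (LT qW rP (@saturated_tr Q)).
  apply: nat_iso_trans (LT_composite dX eT hs (enum_uniq _)) _.
  by move: hs; rewrite bigX => hs; exact: LT_irr.
have eqX : is_equivalence xis.
  exact: is_equivalence_iso (nat_iso_sym exi) (Lxi_equivalence sg2 xi_twist).
split=> //; split=> [a|].
  exact: is_equivalence_iso (nat_iso_sym (eT a)) (LT_equivalence qW rP jW cP (hX a)).
split=> [a|].
  apply: nat_iso_trans (nat_iso_comp exi (eT a)) _.
  apply: nat_iso_trans (Lxi_LT qW rP sg2 xi_twist (hX a)) _.
  exact: nat_iso_comp (nat_iso_sym (eT a)) (nat_iso_sym exi).
split=> [a a'|].
  have [->|ne] := eqVneq a a'; first exact: nat_iso_refl.
  (* Both composites are models for the ideal of the union of the two orbits, which is symmetric. *)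
  have hU := saturatedU (hX a) (hX a'); have hU' := saturatedU (hX a') (hX a).
  have u := LT_union qW rP (hX a) (hX a') hU (dX _ _ ne).
  have u' : nat_iso (functor_comp (LX a') (LX a)) (LT qW rP hU').
    by apply: LT_union; apply: dX; rewrite eq_sym.
  have w : nat_iso (LT qW rP hU) (LT qW rP hU').
    by move: hU' {u'}; rewrite setUC => hU'; exact: LT_irr.
  apply: nat_iso_trans (nat_iso_comp (eT a) (eT a')) _.
  apply: nat_iso_trans (nat_iso_trans u w) _.
  apply: nat_iso_trans (nat_iso_sym u') _.
  exact: nat_iso_comp (nat_iso_sym (eT a')) (nat_iso_sym (eT a)).
have e : nat_iso nu (functor_comp xis (composite T)).
  by apply: nat_iso_trans enu _; apply: nat_iso_comp; exact: nat_iso_sym.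
split=> //; apply: is_equivalence_iso (nat_iso_sym enu) _.
exact: is_equivalence_comp (Lxi_equivalence sg2 xi_twist)
  (LT_equivalence qW rP jW cP (@saturated_tr Q)).
Qed.
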